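(* Let $K/k$ be a finite field extension and let $G$ be a finite group acting on $K(x,y)$ by purely quasi-monomial $k$-automorphisms. Put $N=\{\sigma\in G\mid \sigma(x)=x,\ \sigma(y)=y\}$ and $H=\{\sigma\in G\mid \sigma(\alpha)=\alpha \text{ for all }\alpha\in K\}$. Then $K(x,y)^G$ is $k$-rational except possibly when $\mathrm{char}\,k\neq 2$ and $(G/N,HN/N)\simeq (C_4,C_2)$ or $(D_4,C_2)$. In these exceptional situations one may choose $u,v\in k(x,y)$ with $k(x,y)^{HN/N}=k(u,v)$ (so $K(x,y)^{HN/N}=K(u,v)$) such that: (i) if $(G/N,HN/N)\simeq(C_4,C_2)$, then $K^N=k(\sqrt a)$ for some $a\in k\setminus k^2$, $G/N=\langle\sigma\rangle\simeq C_4$, and $\sigma$ acts on $K^N(u,v)$ by $\sqrt a\mapsto-\sqrt a$, $u\mapsto 1/u$, $v\mapsto -1/v$; (ii) if $(G/N,HN/N)\simeq(D_4,C_2)$, then $K^N=k(\sqrt a,\sqrt b)$ is biquadratic over $k$ with $a,b\in k\setminus k^2$, $G/N=\langle\sigma,\tau\rangle\simeq D_4$, with $\sigma:\sqrt a\mapsto-\sqrt a,\ \sqrt b\mapsto\sqrt b,\ u\mapsto 1/u,\ v\mapsto -1/v$ and $\tau:\sqrt a\mapsto\sqrt a,\ \sqrt b\mapsto -\sqrt b,\ u\mapsto u,\ v\mapsto -v$. In case (i), $K(x,y)^G$ is $k$-rational if and only if $(a,-1)_k=0$; in case (ii), $K(x,y)^G$ is $k$-rational if and only if $(a,-b)_k=0$.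 Moreover, if $K(x,y)^G$ is not $k$-rational, then $\mathrm{Br}(k)$ is nontrivial and $K(x,y)^G$ is not $k$-unirational.
   Context: Let $K/k$ be a finite field extension and $K(x_1,\ldots,x_n)$ the rational function field over $K$ (here $n=2$, $x=x_1$, $y=x_2$). A finite subgroup $G\subset\mathrm{Aut}_k(K(x_1,\ldots,x_n))$ acts by purely quasi-monomial $k$-automorphisms if $\sigma(K)\subset K$ for all $\sigma\in G$, $K^G=k$, and for every $\sigma\in G$, $\sigma(x_j)=\prod_{i=1}^n x_i^{a_{ij}}$ with $[a_{ij}]\in GL_n(\mathbb{Z})$. $D_4$ is the dihedral group of order $8$, $C_m$ the cyclic group of order $m$. For $\mathrm{char}\,k\ne2$, $(a,b)_k\in\mathrm{Br}(k)$ is the class of the quaternion algebra generated by $u,v$ with $u^2=a$, $v^2=b$, $uv=-vu$. A field is $k$-rational if purely transcendental over $k$, and $k$-unirational if it lies between $k$ and some rational function field over $k$. *)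

(* Defs.v *)
From HB Require Import structures.
From mathcomp Require Import all_boot all_order all_algebra all_fingroup all_solvable all_field.
From mathcomp Require Import mpoly.
From Stdlib Require Import ClassicalEpsilon.
Set Implicit Arguments. Unset Strict Implicit. Unset Printing Implicit Defensive.
Import GRing.Theory.
Local Open Scope ring_scope.

Definition cbool (P : Prop) : bool :=
  if excluded_middle_informative P then true else false.

Section Setting.
Variables (k : fieldType) (K : fieldExtType k).

Definition RF : fieldType := {fraction {poly {poly K}}}.

Definition cK (a : K) : RF := tofrac ((a%:P)%:P).
Definition ck (c : k) : RF := cK (c%:A).

Definition xF : RF := tofrac (('X : {poly K})%:P).
Definition yF : RF := tofrac ('X : {poly {poly K}}).

Definition pair2 (u v : RF) : 'I_2 -> RF := fun i => if i == ord0 then u else v.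

Definition kval m (t : 'I_m -> RF) (p : {mpoly k[m]}) : RF := mmap ck t p.

Definition in_kgen m (t : 'I_m -> RF) (z : RF) : Prop :=
  exists p q : {mpoly k[m]}, kval t q != 0 /\ z = kval t p / kval t q.

Definition alg_indep m (t : 'I_m -> RF) : Prop :=
  forall p : {mpoly k[m]}, kval t p = 0 -> p = 0.

Definition k_rational (L : RF -> Prop) : Prop :=
  exists m (t : 'I_m -> RF), alg_indep t /\ (forall z, L z <-> in_kgen t z).

Definition k_unirational (L : RF -> Prop) : Prop :=
  exists m (phi : RF -> {fraction {mpoly k[m]}}),
    (forall z w, L z -> L w -> phi (z + w) = phi z + phi w) /\
    (forall z w, L z -> L w -> phi (z * w) = phi z * phi w) /\
    (forall c : k, phi (ck c) = tofrac (c%:MP)) /\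
    (forall z w, L z -> L w -> phi z = phi w -> z = w).

Definition fixedF (gT : finGroupType) (act : gT -> RF -> RF) (A : {set gT})
  (z : RF) : Prop := forall g, g \in A -> act g z = z.

Definition pqm_action (gT : finGroupType) (G : {group gT})
  (act : gT -> RF -> RF) : Prop :=
  (forall z, act 1%g z = z) /\
  (forall g h z, g \in G -> h \in G -> act (g * h)%g z = act g (act h z)) /\
  (forall g, g \in G -> (forall z, act g z = z) -> g = 1%g) /\
  (forall g, g \in G ->
     [/\ forall z w, act g (z + w) = act g z + act g w,
         forall z w, act g (z * w) = act g z * act g w,
         act g 1 = 1 &
         forall c : k, act g (ck c) = ck c]) /\
  (forall g a, g \in G -> exists b, act g (cK a) = cK b) /\
  (forall a, (forall g, g \in G -> act g (cK a) = cK a) ->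
     exists c : k, a = c%:A) /\
  (forall g, g \in G -> exists M : 'M[int]_2,
     [/\ M \in unitmx,
         act g xF = xF ^ (M ord0 ord0) * yF ^ (M ord_max ord0) &
         act g yF = xF ^ (M ord0 ord_max) * yF ^ (M ord_max ord_max)]).

Definition NN (gT : finGroupType) (G : {group gT}) (act : gT -> RF -> RF)
  : {set gT} := [set g in G | (act g xF == xF) && (act g yF == yF)].

Definition HH (gT : finGroupType) (G : {group gT}) (act : gT -> RF -> RF)
  : {set gT} := [set g in G | cbool (forall a : K, act g (cK a) = cK a)].

End Setting.

(* Br(k) is nontrivial: there is a central division k-algebra of finite
   dimension > 1, i.e. a nonzero class in the Brauer group. *)
Definition Br_nontrivial (k : fieldType) : Prop :=
  exists D : falgType k,
    [/\ forall z : D, z != 0 -> z \is a GRing.unit,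
        forall z : D, (forall w : D, z * w = w * z) -> exists c : k, z = c%:A &
        (1 < \dim (fullv : {vspace D}))%N].

(* (a,b)_k = 0 in Br(k): the quaternion algebra generated by u, v with
   u^2 = a, v^2 = b, uv = -vu is isomorphic to M_2(k), i.e. u |-> U, v |-> V
   defines an algebra map whose images of the basis 1,u,v,uv form a basis. *)
Definition quat_split (k : fieldType) (a b : k) : Prop :=
  exists U V : 'M[k]_2,
    [/\ U *m U = a%:M, V *m V = b%:M, U *m V = - (V *m U) &
        forall c0 c1 c2 c3 : k,
          c0 *: (1%:M : 'M[k]_2) + c1 *: U + c2 *: V + c3 *: (U *m V) = 0 ->
          [/\ c0 = 0, c1 = 0, c2 = 0 & c3 = 0]].

Definition nonsquare (k : fieldType) (a : k) : Prop := forall c : k, c * c != a.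

(* Main.v *)
Require Import Defs.
From HB Require Import structures.
From mathcomp Require Import all_boot all_order all_algebra all_fingroup all_solvable all_field.
From mathcomp Require Import mpoly zify ring.
From Stdlib Require Import Classical ClassicalEpsilon.
Set Implicit Arguments. Unset Strict Implicit. Unset Printing Implicit Defensive.
Import Order.TTheory GRing.Theory Num.Theory.
Local Open Scope ring_scope.

(* Reducing a G-invariant positive binary quadratic form on the exponent lattice gives
   monomial coordinates in which G acts either by signed permutations of the exponents of x and y,
   or by permutations of x, y, (xy)^-1 up to a common inversion. In all cases but one, rationality
   comes from a tower K(x, y) = K(e, f) on whose steps G acts by affine maps: Dedekind's independence
   of characters for G/H acting on K provides the coefficients that make these maps trivial.

   Without a 3-cycle the second action is of the first kind in other coordinates; with one, the
   kernel H decides which tower to take; for H = 1 it comes from a G-stable quadric, projected from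
   a point with coordinates in K.

   For signed permutations in characteristic not 2, the Cayley transforms X = (1-x)/(1+x) and
   Y = (1-y)/(1+y) are permuted up to sign, and w = X/Y is sent to w, -w, 1/w or -1/w. The tower
   K(w, Y) works as soon as K contains v0 on which G acts by the same formulas. This can only fail if
   H = {1, -1} on X, Y and some s sends w to -1/w, that is, in the cases C4 and D4. There
   K^N = k(sqrt a) or k(sqrt a, sqrt b), and v0 exists when -b is a norm from k(sqrt a) (with b = 1
   for C4), that is, when (a, -b) splits. Conversely A = sqrt b (w - 1/w) and
   B = sqrt a sqrt b (w + 1/w) are invariant and B^2 - a A^2 = 4ab, so if the fixed field embeds in
   a rational function field over k, comparing leading terms makes -b a norm. *)

(** An affine step is trivialised by degrees: affine maps preserve the degree in the new variable,
    so Euclidean division by an invariant of least positive degree stays among the invariants and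
    exhibits that invariant as a generator. The work lies in finding the towers. Most come from an
    equivariant point, over [K], of a line, a conic or a quadric, from which the variety is
    projected. When [H] is trivial such points are built from the coefficients of an invariant
    linear form over [K], and this form exists because sums over [G / H] determine the elements they
    come from. Elements of [H] act trivially on [K] and give no such freedom; they are divided out
    by passing to a subfield of small index. For [H = {1, -1}] the ratio [w] is fixed by [H], and in
    the exceptional cases [K(w)^G] is the function field of the conic [B^2 - a A^2 = 4ab] over [k],
    which may lack a point. All fields are subfields of one ambient field, so transcendence degree
    two enters only through the exchange property. *)

Lemma cboolP (P : Prop) : reflect P (cbool P).
Proof. by rewrite /cbool; case: excluded_middle_informative => h; constructor. Qed.

(** * Subfields and algebraic dependence *)

Section Subfields.
Variable F : fieldType.
Implicit Types (S : divringClosed F) (t z : F) (p q : {poly F}).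

Section SubfieldType.
Variable S : divringClosed F.
(** The predicate made a field type, so that results on [algebraicOver] and on polynomial division
    under [val] apply. *)
Record sub_field := SubField { sub_field_val : F; _ : sub_field_val \in S }.
HB.instance Definition _ := [isSub for sub_field_val].
HB.instance Definition _ := [Choice of sub_field by <:].
HB.instance Definition _ := [SubChoice_isSubComUnitRing of sub_field by <:].
HB.instance Definition _ := [SubComUnitRing_isSubIntegralDomain of sub_field by <:].
HB.instance Definition _ := [SubIntegralDomain_isSubField of sub_field by <:].
End SubfieldType.

Definition adj S t : {pred F} := fun z => cbool (exists p q,
  [/\ p \is a polyOver S, q \is a polyOver S, q.[t] != 0 & z = p.[t] / q.[t]]).

Arguments adj : simpl never.

Lemma adjP S t z : reflect (exists p q, [/\ p \is a polyOver S,
  q \is a polyOver S, q.[t] != 0 & z = p.[t] / q.[t]]) (z \in adj S t).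
Proof. exact: cboolP. Qed.

Lemma adj_closed S t : divring_closed (adj S t).
Proof.
split=> [|_ _ /adjP[p [q [pS qS q0 ->]]] /adjP[p' [q' [pS' qS' q0' ->]]]|
         _ _ /adjP[p [q [pS qS q0 ->]]] /adjP[p' [q' [pS' qS' q0' ->]]]]; apply/adjP.
- by exists 1, 1; rewrite !hornerC divr1 oner_eq0 !rpred1.
- exists (p * q' - p' * q), (q * q').
  rewrite !hornerE mulf_neq0 //; split=> //; first by rewrite rpredB ?rpredM.
    by rewrite rpredM.
  by field; rewrite q0 q0'.
- have [p0|p0] := eqVneq p'.[t] 0.
    exists 0, 1; rewrite !hornerC oner_eq0 rpred0 rpred1 p0.
    by split=> //; rewrite mul0r invr0 mulr0 mul0r.
  exists (p * q'), (q * p'); rewrite !hornerE mulf_neq0 ?rpredM //; split=> //.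
  by field; rewrite q0 q0' p0.
Qed.
HB.instance Definition _ S t :=
  GRing.isDivringClosed.Build F (adj S t) (adj_closed S t).

Lemma adj_base S t z : z \in S -> z \in adj S t.
Proof.
move=> zS; apply/adjP; exists z%:P, 1.
by rewrite !hornerC oner_eq0 divr1 polyOverC rpred1.
Qed.

Lemma adj_gen S t : t \in adj S t.
Proof.
apply/adjP; exists 'X, 1.
by rewrite hornerX hornerC oner_eq0 divr1 polyOverX rpred1.
Qed.
Hint Resolve adj_gen : core.

Lemma adj_min S S' t : {subset S <= S'} -> t \in S' -> {subset adj S t <= S'}.
Proof.
move=> SS' tS' _ /adjP[p [q [/polyOverP pS /polyOverP qS _ ->]]].
by rewrite rpred_div ?rpred_horner //; apply/polyOverP => i; apply: SS'.
Qed.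

Lemma horner_adj S t p : p \is a polyOver S -> p.[t] \in adj S t.
Proof.
move=> /polyOverP pS; apply: rpred_horner (adj_gen S t).
by apply/polyOverP => i; apply: adj_base.
Qed.

(** The ambient field in the role of a subfield, for [alg_fixed], where orbits have to stay in a
    subfield. *)
Definition full_field : {pred F} := predT.
Lemma full_field_closed : divring_closed full_field. Proof. by []. Qed.
HB.instance Definition _ :=
  GRing.isDivringClosed.Build F full_field full_field_closed.

Definition alg S z := exists p, [/\ p \is a polyOver S, p != 0 & root p z].

Lemma polyOver_sub S p : p \is a polyOver S ->
  exists p0 : {poly sub_field S}, p = map_poly val p0.
Proof.
move=> /polyOverP pS; exists (\poly_(i < size p) SubField (pS i)).
apply/polyP=> i; rewrite coef_map coef_poly; case: ltnP => //= h.
by rewrite nth_default.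
Qed.

Lemma sub_polyOver S (p0 : {poly sub_field S}) : map_poly val p0 \is a polyOver S.
Proof. by apply/polyOverP => i; rewrite coef_map; case: (p0`_i). Qed.

Lemma algE S z : alg S z <-> algebraicOver (val : sub_field S -> F) z.
Proof.
split=> [[p [/polyOver_sub[p0 ->] p0N r]]|[p0 p0N r]].
  by exists p0 => //; rewrite map_poly_eq0 in p0N.
by exists (map_poly val p0); rewrite sub_polyOver map_poly_eq0.
Qed.

Lemma alg_id S z : z \in S -> alg S z.
Proof.
move=> zS; exists ('X - z%:P).
by rewrite polyXsubC_eq0 root_XsubC polyOverXsubC.
Qed.

Lemma alg_divring S (T : {pred F}) : (forall z, (z \in T) <-> alg S z) -> divring_closed T.
Proof.
move=> H; split=> [|a b|a b].
- exact/H/alg_id/rpred1.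
- by move=> /H/algE ha /H/algE hb; apply/H/algE/algebraic_sub.
- by move=> /H/algE ha /H/algE hb; apply/H/algE/algebraic_div.
Qed.

Definition algp S : {pred F} := fun z => cbool (alg S z).
Lemma algpP S z : reflect (alg S z) (z \in algp S). Proof. exact: cboolP. Qed.
Lemma algp_closed S : divring_closed (algp S).
Proof. by apply: (@alg_divring S) => z; split=> /algpP. Qed.
HB.instance Definition _ S :=
  GRing.isDivringClosed.Build F (algp S) (algp_closed S).

Lemma alg_sub S S' z : {subset S <= S'} -> alg S z -> alg S' z.
Proof.
move=> SS' [p [/polyOverP pS p0 r]]; exists p; split=> //.
by apply/polyOverP=> i; apply: SS'.
Qed.

(** Over a field algebraic means integral: the polynomial made monic has coefficients integral over
    [S], and integrality is transitive. *)
Lemma alg_trans S S' z : (forall s, s \in S' -> alg S s) -> alg S' z -> alg S z.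
Proof.
move=> SS' [p [/polyOverP pS p0 r]]; apply/algE/integral_algebraic.
pose m := (lead_coef p)^-1 *: p.
have l0 : lead_coef p != 0 by rewrite lead_coef_eq0.
apply: (@integral_root_monic _ _ _ _ m).
- by rewrite monicE lead_coefZ mulVf.
- by rewrite rootZ // invr_eq0.
- apply/integral_poly => i; apply/integral_algebraic/algE/algpP.
  by rewrite coefZ rpredM ?rpredV //; apply/algpP/SS'/pS.
Qed.

Lemma alg_adj S t z : alg S t -> z \in adj S t -> alg S z.
Proof.
move=> ht /(@adj_min S (algp S)) h; apply/algpP/h; last exact/algpP.
by move=> s sS; apply/algpP/alg_id.
Qed.
End Subfields.

Section Exchange.
Variable F : fieldType.
Implicit Types (S : divringClosed F) (t u v x y z : F) (p q : {poly F}).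

Lemma adj_sub S S' t : {subset S <= S'} -> {subset adj S t <= adj S' t}.
Proof. by move=> h; apply: adj_min (adj_gen S' t) => z /h; apply: adj_base. Qed.

Lemma adjC S u v : {subset adj (adj S u) v <= adj (adj S v) u}.
Proof.
apply: adj_min; last exact/adj_base/adj_gen.
by apply: adj_min (adj_gen _ _) => z zS; apply/adj_base/adj_base.
Qed.

(** Turns a relation over [S(u)] into a polynomial in two variables over [S], with the [P i] as
    coefficients in the outer variable. *)
Lemma clear_denominators S u p : p \is a polyOver (adj S u) ->
  exists q (P : nat -> {poly F}), [/\ q \is a polyOver S, q.[u] != 0,
    forall i, P i \is a polyOver S & forall i, q.[u] * p`_i = (P i).[u]].
Proof.
elim/poly_ind: p => [_|p c IH].
  exists 1, (fun=> 0); rewrite hornerC oner_eq0 rpred1; split=> // [_|i].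
    exact: rpred0.
  by rewrite coef0 mulr0 horner0.
rewrite -cons_poly_def => /polyOverP h.
have /IH[q [P [qS q0 PS qP]]] : p \is a polyOver (adj S u).
  by apply/polyOverP => i; have := h i.+1; rewrite coef_cons.
have := h 0; rewrite coef_cons eqxx => /adjP[a [b [aS bS b0 ->]]].
exists (q * b), (fun i => if i is j.+1 then P j * b else q * a).
rewrite hornerM mulf_neq0 ?rpredM //; split=> // [[|i]|[|i]]; rewrite ?rpredM //.
  by rewrite coef_cons eqxx hornerM; field.
by rewrite coef_cons /= hornerM -qP; ring.
Qed.

(** The relation of [x] over [S(u)], with denominators cleared, is reread as a polynomial in [u]
    with coefficients [(C j).[x]]. If it vanished, every [C j] would have the root [x], hence be
    zero, although some [P i] is nonzero. *)
Lemma alg_swap S x u : ~ alg S x -> alg (adj S u) x -> alg (adj S x) u.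
Proof.
move=> xS [p [/clear_denominators[q [P [qS q0 PS qP]]] p0 /rootP px]].
pose R := \sum_(i < size p) x ^+ i *: P i.
pose C j := \poly_(i < size p) (P i)`_j.
have RC j : R`_j = (C j).[x].
  rewrite coef_sum horner_poly; apply: eq_bigr => i _.
  by rewrite coefZ mulrC.
have CS j : C j \is a polyOver S.
  by apply: polyOver_poly => i _; have /polyOverP := PS i.
exists R; split.
- by apply/polyOverP => j; rewrite RC horner_adj.
- have [i lei pi0] : exists2 i, (i < size p)%N & P i != 0.
    exists (size p).-1; first by rewrite ltn_predL lt0n size_poly_eq0.
    apply: contraNneq p0 => Pi0; rewrite -lead_coef_eq0.
    by have /eqP := qP (size p).-1; rewrite Pi0 horner0 mulf_eq0 (negPf q0).
  apply/eqP => R0; case: xS; exists (C (size (P i)).-1); split=> //.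
    apply/eqP => /(congr1 (fun f : {poly F} => f`_i)).
    rewrite coef_poly lei coef0 => /eqP.
    by rewrite -lead_coefE lead_coef_eq0 (negPf pi0).
  by apply/rootP; rewrite -RC R0 coef0.
- apply/rootP; transitivity (q.[u] * p.[x]); last by rewrite px mulr0.
  rewrite horner_sum (horner_coef p) mulr_sumr.
  by apply: eq_bigr => i _; rewrite hornerZ -qP; ring.
Qed.

(** If [v] were algebraic, [x] and [y] would be algebraic over [S(u)]; swapping [x] and [u] then
    makes [y] algebraic over [S(x)]. *)
Lemma exchange_last S x y u v : ~ alg S x -> ~ alg (adj S x) y ->
  alg (adj (adj S u) v) x -> alg (adj (adj S u) v) y -> ~ alg (adj S u) v.
Proof.
move=> xS yS ax ay av.
have red z : alg (adj (adj S u) v) z -> alg (adj S u) z.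
  by apply: alg_trans => s; apply: alg_adj.
have/(alg_swap xS) au := red _ ax.
apply: yS; apply: alg_trans (alg_sub _ (red _ ay)).
  by move=> s; apply: alg_adj au.
exact/adj_sub/adj_base.
Qed.

(** Steinitz exchange for a transcendence basis of two elements; the first conclusion is
    [exchange_last] with [u] and [v] interchanged. *)
Lemma exchange S x y u v : ~ alg S x -> ~ alg (adj S x) y ->
  alg (adj (adj S u) v) x -> alg (adj (adj S u) v) y ->
  ~ alg S u /\ ~ alg (adj S u) v.
Proof.
move=> xS yS ax ay; split; last exact: exchange_last ax ay.
move=> au; apply: (@exchange_last S x y v u) => //.
- exact/(alg_sub _ ax)/adjC.
- exact/(alg_sub _ ay)/adjC.
- exact/(alg_sub _ au)/adj_base.
Qed.

Lemma alg_root S t p : ~ alg S t -> p \is a polyOver S -> p.[t] = 0 -> p = 0.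
Proof.
move=> tS pS pt; apply/eqP/negP => p0; apply: tS; exists p; split=> //; first exact/negP.
exact/rootP.
Qed.
End Exchange.

Section SubfieldDivision.
Variables (F : fieldType) (S : divringClosed F).

Lemma polyOver_divp (p q : {poly F}) : p \is a polyOver S -> q \is a polyOver S ->
  p %/ q \is a polyOver S.
Proof.
by move=> /polyOver_sub[p0 ->] /polyOver_sub[q0 ->]; rewrite -map_divp sub_polyOver.
Qed.

Lemma polyOver_modp (p q : {poly F}) : p \is a polyOver S -> q \is a polyOver S ->
  p %% q \is a polyOver S.
Proof.
by move=> /polyOver_sub[p0 ->] /polyOver_sub[q0 ->]; rewrite -map_modp sub_polyOver.
Qed.
End SubfieldDivision.

(** * Finite groups acting by affine maps *)

Section FieldAction.
Variables (gT : finGroupType) (F : fieldType) (act : gT -> {rmorphism F -> F}).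
Implicit Types (G : {group gT}) (A : {set gT}) (S : divringClosed F).

Definition acts_auto G := (forall z, act 1%g z = z) /\
  (forall g h z, g \in G -> h \in G -> act (g * h)%g z = act g (act h z)).

Definition fixp S (A : {set gT}) : {pred F} :=
  fun z => (z \in S) && [forall g in A, act g z == z].

Lemma fixpP S A z :
  reflect (z \in S /\ forall g, g \in A -> act g z = z) (z \in fixp S A).
Proof.
apply: (iffP andP) => -[zS h]; split=> //.
  by move=> g gA; apply/eqP; move/forall_inP: h; apply.
by apply/forall_inP => g gA; apply/eqP/h.
Qed.

Lemma fixp_closed S A : divring_closed (fixp S A).
Proof.
split=> [|a b /fixpP[aS ha] /fixpP[bS hb]|a b /fixpP[aS ha] /fixpP[bS hb]]; apply/fixpP.
- by split=> [|g _]; rewrite ?rpred1 ?rmorph1.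
- by split=> [|g gA]; rewrite ?rpredB // rmorphB ha ?hb.
- by split=> [|g gA]; rewrite ?rpred_div // fmorph_div ha ?hb.
Qed.
HB.instance Definition _ S A :=
  GRing.isDivringClosed.Build F (fixp S A) (fixp_closed S A).

Section Orbits.
Variable G : {group gT}.
Hypothesis actG : acts_auto G.

Lemma actK g z : g \in G -> act g (act g^-1 z) = z.
Proof. by case: actG => a1 aM gG; rewrite -aM ?groupV // mulgV a1. Qed.

Lemma actVK g z : g \in G -> act g^-1 (act g z) = z.
Proof. by case: actG => a1 aM gG; rewrite -aM ?groupV // mulVg a1. Qed.

Lemma act_prod_fixed g z : g \in G ->
  act g (\prod_(h in G) act h z) = \prod_(h in G) act h z.
Proof.
case: actG => a1 aM gG; rewrite rmorph_prod [RHS](reindex_inj (mulgI g)) /=.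
by apply: eq_big => [h|h hG]; rewrite ?groupMl // aM.
Qed.

(** [z] is a root of the orbit polynomial, the product of the factors ['X - (act h z)%:P], whose
    coefficients are fixed by [G]. *)
Lemma alg_fixed S S' z : (forall g, g \in G -> act g z \in S') ->
  {subset fixp S' G <= S} -> alg S z.
Proof.
move=> zS' fS; case: actG => a1 aM; pose p := \prod_(h in G) ('X - (act h z)%:P).
exists p; split.
- apply/polyOverP => i; apply/fS/fixpP; split=> [|g gG].
    by apply/polyOverP/rpred_prod => h hG; rewrite polyOverXsubC zS'.
  rewrite -coef_map; suff -> : map_poly (act g) p = p by [].
  rewrite {2}/p (reindex_inj (mulgI g)) rmorph_prod /=.
  apply: eq_big => [h|h hG]; first by rewrite groupMl.
  by rewrite map_polyXsubC /= aM.
- by apply: monic_neq0; apply: monic_prod => h _; rewrite monicXsubC.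
- by rewrite /p (bigD1 1%g) //= a1 rootM root_XsubC eqxx.
Qed.

Section Affine.
Variables (S : divringClosed F) (t : F).
Hypothesis stabS : forall g s, g \in G -> s \in S -> act g s \in S.
Hypothesis trS : ~ alg S t.
Hypothesis afft : forall g, g \in G ->
  exists a b, [/\ a \in S, b \in S & act g t = a * t + b].

Lemma transS_inj p q : p \is a polyOver S -> q \is a polyOver S ->
  p.[t] = q.[t] -> p = q.
Proof.
move=> pS qS pq; apply/eqP; rewrite -subr_eq0; apply/eqP/(alg_root trS).
  exact: rpredB.
by rewrite hornerD hornerN pq subrr.
Qed.

(** The linear coefficient of [act g t] is nonzero, since otherwise the inverse of [g] would bring
    [t] back into [S]; hence the substitution preserves degrees. *)
Lemma act_horner g p : g \in G -> p \is a polyOver S ->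
  exists p', [/\ p' \is a polyOver S, size p' = size p & act g p.[t] = p'.[t]].
Proof.
move=> gG /polyOverP pS; have [a [b [aS bS gt]]] := afft gG.
exists ((map_poly (act g) p) \Po (a *: 'X + b%:P)); split.
- apply: polyOver_comp.
    by apply/polyOverP => i; rewrite coef_map; apply/stabS/pS.
  by rewrite rpredD ?polyOverC // polyOverZ // polyOverX.
- rewrite size_comp_poly2 ?size_map_poly // size_polyDl; last first.
    rewrite size_scale ?size_polyX; last first.
      apply/eqP => a0; apply: trS; apply: alg_id.
      by rewrite -(actVK t gG) gt a0 mul0r add0r stabS ?groupV.
    by apply: leq_ltn_trans (size_polyC_leq1 _) _.
  rewrite size_scale ?size_polyX //.
  apply/eqP => a0; apply: trS; apply: alg_id.
  by rewrite -(actVK t gG) gt a0 mul0r add0r stabS ?groupV.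
- by rewrite horner_comp !hornerE -gt horner_map.
Qed.

Lemma norm_horner (A : {pred gT}) p : {subset A <= G} -> p \is a polyOver S -> p != 0 ->
  exists p', [/\ p' \is a polyOver S, size p' = (#|A| * (size p).-1).+1 &
                 \prod_(g in A) act g p.[t] = p'.[t]].
Proof.
move=> AG pS p0.
have h g : exists p', g \in A ->
    [/\ p' \is a polyOver S, size p' = size p & act g p.[t] = p'.[t]].
  case gA: (g \in A); last by exists 0.
  by have [p' hp] := act_horner (AG _ gA) pS; exists p'.
have [P hP] := fin_all_exists h; exists (\prod_(g in A) P g); split.
- by apply: rpred_prod => g /hP[].
- rewrite size_prod; last by move=> g /hP[_ s _]; rewrite -size_poly_eq0 s size_poly_eq0.
  rewrite (eq_bigr (fun=> size p)); last by move=> g /hP[].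
  rewrite sum_nat_const -subn1 mulnBr muln1 subSn //.
  by rewrite leq_pmulr // lt0n size_poly_eq0.
- by rewrite horner_prod; apply: eq_bigr => g /hP[].
Qed.

(** An invariant [f] of least positive degree in [t] generates. By uniqueness of Euclidean division,
    quotient and remainder of an invariant by [f] are invariant; the remainder is constant by
    minimality, and the quotient has smaller degree. *)
Theorem affine_fixed : exists2 f, f \in fixp (adj S t) G &
  {subset fixp (adj S t) G <= adj (fixp S G) f}.
Proof.
case: (actG) => a1 aM.
pose fx p := p \is a polyOver S /\ forall g, g \in G -> act g p.[t] = p.[t].
pose P n := cbool (exists p, [/\ fx p, (1 < size p)%N & size p = n]).
have [|n /cboolP[f [[fS ff] f1 sf]] minf] := @ex_minnP P.
  (* The norm of [t] is an invariant polynomial of degree [#|G|], so the minimum exists. *)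
  have [|p [pS sp tp]] := @norm_horner (mem G) 'X (fun=> id) (polyOverX _).
    by rewrite polyX_eq0.
  exists (size p); apply/cboolP; exists p; split=> //; last first.
    by rewrite sp size_polyX muln1 ltnS cardG_gt0.
  by split=> // g gG; rewrite -tp act_prod_fixed.
have f0 : f != 0 by rewrite -size_poly_gt0 ltnW.
have main p : fx p -> p.[t] \in adj (fixp S G) f.[t].
  have [m] := ubnP (size p); elim: m p => // m IH p; rewrite ltnS => lem [pS pf].
  have [sp|sp] := leqP (size p) 1.
    have pC : p.[t] = p`_0 by rewrite {1}(size1_polyC sp) hornerC.
    rewrite pC; apply: adj_base; apply/fixpP.
    by split=> [|g gG]; [move/polyOverP: pS | rewrite -pC pf].
  have key g : g \in G -> act g (p %/ f).[t] = (p %/ f).[t] /\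
                          act g (p %% f).[t] = (p %% f).[t].
    move=> gG; have [q' [qS' sq tq]] := act_horner gG (polyOver_divp pS fS).
    have [r' [rS' sr tr]] := act_horner gG (polyOver_modp pS fS).
    have eqp : q' * f + r' = p.
      apply: transS_inj => //; first by rewrite rpredD ?rpredM.
      by rewrite !hornerE -tq -tr -(ff g gG) -rmorphM -rmorphD -hornerM -hornerD -divp_eq pf.
    have sr' : (size r' < size f)%N by rewrite sr ltn_modp.
    by rewrite tq tr -eqp; split; rewrite ?divp_addl_mul_small ?modp_addl_mul_small.
  have q_in : (p %/ f).[t] \in adj (fixp S G) f.[t].
    apply: IH; last by split=> [|g /key[]//]; apply: polyOver_divp.
    apply: leq_trans lem; rewrite size_divp //.
    by rewrite ltn_subrL -subn1 subn_gt0 f1 (ltnW sp).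
  have r_in : (p %% f).[t] \in adj (fixp S G) f.[t].
    have fr : fx (p %% f) by split=> [|g /key[]//]; apply: polyOver_modp.
    have sr : (size (p %% f)%R <= 1)%N.
      rewrite leqNgt; apply/negP => s1.
      have/minf : P (size (p %% f)) by apply/cboolP; exists (p %% f).
      by rewrite -sf leqNgt ltn_modp f0.
    case: fr => /polyOverP rS rf.
    have rC : (p %% f).[t] = (p %% f)`_0 by rewrite {1}(size1_polyC sr) hornerC.
    by rewrite rC; apply: adj_base; apply/fixpP; split=> [|g gG]; [exact: rS | rewrite -rC rf].
  by rewrite (divp_eq p f) hornerD hornerM rpredD ?rpredM ?adj_gen.
exists f.[t]; first by apply/fixpP; split=> //; apply: horner_adj.
move=> _ /fixpP[/adjP[p [q [pS qS q0 ->]]] zf].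
have qN : q != 0 by apply: contraNneq q0 => ->; rewrite horner0.
(* Multiplying numerator and denominator by the other conjugates of the denominator makes the
   denominator a norm; then the numerator is invariant too. *)
have [N [NS _ tN]] := @norm_horner (mem G) q (fun=> id) qS qN.
have [|M [MS _ tM]] := @norm_horner [pred g in G | g != 1%g] q _ qS qN.
  by move=> g /andP[].
have NM : N.[t] = q.[t] * M.[t].
  by rewrite -tN -tM (bigD1 1%g) //= a1.
have fN : fx N by split=> // g gG; rewrite -tN act_prod_fixed.
have N0 : N.[t] != 0.
  rewrite -tN prodf_seq_neq0; apply/allP => g _; apply/implyP => _.
  by rewrite fmorph_eq0.
have zN : p.[t] / q.[t] = (p * M).[t] / N.[t].
  rewrite NM hornerM; move: N0; rewrite NM mulf_eq0 => /norP[_ M0].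
  by field; rewrite q0 M0.
rewrite zN rpred_div ?main //; split; first exact: rpredM.
move=> g gG; apply: (mulIf (invr_neq0 N0)).
by have := zf g gG; rewrite zN fmorph_div (fN.2 g gG).
Qed.
End Affine.
End Orbits.
End FieldAction.

(** * Descent and independence of characters *)

Section Descent.
Variables (gT : finGroupType) (F : fieldType) (act : gT -> {rmorphism F -> F}).
Implicit Types (S : divringClosed F).

(** Reduce the numerator [p] and the denominator [q] of [z] modulo [m]. Then [p - z q] has degree
    less than the number of conjugates [h t] and vanishes at all of them, so it is zero. Its
    coefficient in the degree of [q] gives [z] as a quotient of elements of [S]. *)
Lemma fixed_in_base S t m (hs : seq {rmorphism F -> F}) z :
  m \is monic -> m \is a polyOver S -> m.[t] = 0 -> (size m <= (size hs).+1)%N ->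
  uniq [seq (h : {rmorphism F -> F}) t | h <- hs] ->
  (forall h : {rmorphism F -> F}, List.In h hs -> h z = z /\ forall s, s \in S -> h s = s) ->
  z \in adj S t -> z \in S.
Proof.
move=> mm mS mt sm ut hsP /adjP[p [q [pS qS q0 zE]]].
have m0 : m != 0 by apply: monic_neq0.
have modt r : (r %% m).[t] = r.[t].
  by rewrite {2}(divp_eq r m) !hornerE mt mulr0 add0r.
have Sr := polyOver_modp pS mS; have Sq := polyOver_modp qS mS.
have zq : z * (q %% m).[t] = (p %% m).[t] by rewrite !modt zE divfK.
have sz r : (size (r %% m)%R <= size hs)%N by rewrite -ltnS (leq_trans _ sm) // ltn_modp.
pose d := p %% m - z *: (q %% m).
have d0 : d = 0.
  apply/eqP; apply: contraT => dn0.
  have sd : (size d <= size hs)%N.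
    rewrite (leq_trans (size_polyD _ _)) // geq_max sz size_polyN.
    by rewrite (leq_trans (size_scale_leq _ _)).
  have := max_poly_roots dn0 _ ut; rewrite size_map ltnNge sd => H.
  suff : false by []; apply: H.
  suff : forall h : {rmorphism F -> F}, List.In h hs -> root d (h t).
    by elim: (hs) => //= h l IH Hl; rewrite Hl ?IH //; [move=> *; apply: Hl; right | left].
  move=> h /hsP[hz hS]; apply/rootP.
  have mapS r : r \is a polyOver S -> map_poly h r = r.
    by move=> /polyOverP rS; apply/polyP => i; rewrite coef_map /= hS.
  have ev r : r \is a polyOver S -> r.[h t] = h r.[t].
    by move=> rS; rewrite -horner_map mapS.
  by rewrite hornerD hornerN hornerZ !ev // -{1}hz -rmorphM zq subrr.
have qm0 : q %% m != 0.
  by apply: contraNneq q0 => qm; rewrite -modt qm horner0.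
have lq : lead_coef (q %% m) != 0 by rewrite lead_coef_eq0.
have := congr1 (fun r : {poly F} => r`_(size (q %% m)).-1) d0.
rewrite coefB coefZ coef0 -lead_coefE => /eqP; rewrite subr_eq0 => /eqP e.
rewrite -(mulfK lq z) -e; apply: rpred_div; first by move/polyOverP: Sr; apply.
by move/polyOverP: Sq; apply.
Qed.

Variables (G H : {group gT}) (K : divringClosed F).
Hypothesis actG : acts_auto act G.
Hypothesis stabK : forall g s, g \in G -> s \in K -> act g s \in K.
Hypothesis HK : forall g, reflect (g \in G /\ forall a, a \in K -> act g a = a) (g \in H).

Lemma kernel_sub : {subset H <= G}.
Proof. by move=> g /HK[]. Qed.

Lemma kernel_indicator_seq (s : seq gT) : {subset s <= G} -> {subset s <= [predC H]} ->
  exists l : seq (F * F), [/\ forall x, x \in l -> x.1 \in K /\ x.2 \in K,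
    forall h, h \in H -> \sum_(x <- l) x.1 * act h x.2 = 1 &
    forall g, g \in s -> \sum_(x <- l) x.1 * act g x.2 = 0].
Proof.
elim: s => [|g s IH] sG sH.
  exists [:: (1, 1)]; split=> // [x|h _]; first by rewrite inE => /eqP->; rewrite rpred1.
  by rewrite big_seq1 mul1r rmorph1.
have [|x xs|l [lK lH ls]] := IH; first by move=> x xs; apply: sG; rewrite inE xs orbT.
  by apply: sH; rewrite inE xs orbT.
have gG : g \in G by apply: sG; rewrite mem_head.
have gH : g \notin H by apply: sH; rewrite mem_head.
have [a [aK ga]] : exists a, a \in K /\ act g a != a.
  apply: NNPP => na; case/negP: gH; apply/HK; split=> // a aK; apply/eqP/negPn/negP => ga.
  by case: na; exists a.
have dn : a - act g a != 0 by rewrite subr_eq0 eq_sym.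
pose c := (a - act g a)^-1; pose b := act g a.
have bK : b \in K by apply: stabK.
have cK : c \in K by rewrite rpredV rpredB.
(* The two halves of the list multiply the previous sum by [(act g' a - act g a) / (a - act g a)],
   which is 1 on [H] and 0 at [g]. *)
pose l' := [seq (c * x.1, a * x.2) | x <- l] ++ [seq (- (c * b) * x.1, x.2) | x <- l].
have l'E g' : \sum_(x <- l') x.1 * act g' x.2 =
    c * (act g' a - b) * \sum_(x <- l) x.1 * act g' x.2.
  rewrite big_cat !big_map /= -big_split /= mulr_sumr; apply: eq_bigr => x _.
  by rewrite rmorphM; ring.
exists l'; split.
- move=> x; rewrite mem_cat => /orP[] /mapP[y /lK[y1 y2] ->] /=.
    by rewrite !rpredM.
  by split=> //; rewrite rpredM // rpredN rpredM.
- move=> h hH; rewrite l'E lH // mulr1 /c; case/HK: (hH) => _ ->//.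
  by rewrite mulVf.
- move=> g'; rewrite inE l'E => /predU1P[->|/ls ->]; last by rewrite mulr0.
  by rewrite subrr mulr0 mul0r.
Qed.

(* The explicit form of Dedekind's independence of characters for [G/H] acting on [K]. *)
Lemma kernel_indicator : exists l : seq (F * F),
  [/\ forall x, x \in l -> x.1 \in K /\ x.2 \in K,
    forall h, h \in H -> \sum_(x <- l) x.1 * act h x.2 = 1 &
    forall g, g \in G -> g \notin H -> \sum_(x <- l) x.1 * act g x.2 = 0].
Proof.
have [g|g|l [lK lH ls]] := @kernel_indicator_seq (enum (G :\: H)).
- by rewrite mem_enum inE => /andP[].
- by rewrite mem_enum inE => /andP[].
exists l; split=> // g gG gH; apply: ls; by rewrite mem_enum inE gG gH.
Qed.

Definition subspace (V : F -> Prop) :=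
  [/\ V 0, forall a b, V a -> V b -> V (a + b) & forall c a, c \in K -> V a -> V (c * a)].

(** Summing over [G / H] produces invariants in [W], and by [kernel_indicator] the element [v] is a
    [K]-combination of the sums obtained from its multiples by elements of [K]. They cannot all lie
    in [V]. *)
Lemma fixed_outside (V W : F -> Prop) v : subspace V -> subspace W ->
  (forall g w, g \in G -> W w -> W (act g w)) ->
  (forall h, h \in H -> act h v = v) -> W v -> ~ V v ->
  exists T, [/\ W T, ~ V T & forall g, g \in G -> act g T = T].
Proof.
case: actG => a1 aM [V0 VD VZ] [W0 WD WZ] Wstab vH Wv nV.
have HG : H \subset G by apply/subsetP/kernel_sub.
pose Tr w := \sum_(C in lcosets H G) act (repr C) w.
have reprG C : C \in lcosets H G -> exists2 g, g \in G & C = (g *: H)%g.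
  by move=> /lcosetsP[g gG ->]; exists g.
have inC C : C \in lcosets H G -> repr C \in C.
  by move=> /reprG[g gG ->]; apply: (mem_repr g); apply: lcoset_refl.
have CG C g : C \in lcosets H G -> g \in C -> g \in G.
  move=> /reprG[h hG ->] /lcosetP[k kH ->]; rewrite groupM //; exact: (subsetP HG).
have TrF w g : (forall h, h \in H -> act h w = w) -> g \in G -> act g (Tr w) = Tr w.
  move=> wH gG; rewrite /Tr rmorph_sum.
  have bij : {in lcosets H G, cancel (fun C : {set gT} => (g *: C)%g) (fun C : {set gT} => (g^-1 *: C)%g)}.
    by move=> C _; rewrite lcosetK.
  rewrite [RHS](reindex_onto (fun C : {set gT} => (g *: C)%g) (fun C : {set gT} => (g^-1 *: C)%g)) /=; last first.
    by move=> C _; rewrite lcosetKV.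
  have mem C : ((g *: C)%g \in lcosets H G) = (C \in lcosets H G).
    apply/lcosetsP/lcosetsP => -[h hG e].
      exists (g^-1 * h)%g; first by rewrite groupM ?groupV.
      by rewrite lcosetM -e lcosetK.
    by exists (g * h)%g; rewrite ?groupM // lcosetM e.
  apply: eq_big => [C|C CL]; first by rewrite lcosetK eqxx andbT mem.
  rewrite -aM //; last exact: (CG _ _ CL (inC _ CL)).
  have [h hG CE] := reprG _ CL.
  have gCL : (g *: C)%g \in lcosets H G by rewrite mem.
  have r2 := inC _ gCL; have r1 := inC _ CL.
  have : ((g * repr C)^-1 * repr ((g *: C)%g))%g \in H.
    have CE2 : C = (repr C *: H)%g by rewrite {1}CE; apply/esym/lcoset_eqP; rewrite -CE.
    by rewrite -mem_lcoset lcosetM -CE2.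
  move=> kH; have := wH _ kH.
  set k := (_ * repr _)%g in kH *; move=> wk.
  have -> : repr ((g *: C)%g) = (g * repr C * k)%g by rewrite /k mulKVg.
  have rG : repr C \in G by exact: (CG _ _ CL r1).
  have kG : k \in G by exact: (subsetP HG).
  by rewrite [RHS]aM ?wk // groupM.
have [l [lK lH lG]] := kernel_indicator.
have vE : v = \sum_(x <- l) x.1 * Tr (x.2 * v).
  rewrite /Tr; under eq_bigr do rewrite mulr_sumr.
  rewrite exchange_big /=.
  have HL : (H : {set gT}) \in lcosets H G by apply/lcosetsP; exists 1%g; rewrite ?lcoset1.
  rewrite (bigD1 (H : {set gT})) //= [X in _ + X]big1 ?addr0.
    have rH : repr (H : {set gT}) \in H by apply: inC.
    under eq_bigr do rewrite rmorphM mulrA.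
    by rewrite -mulr_suml lH // mul1r vH.
  move=> C /andP[CL CH]; under eq_bigr do rewrite rmorphM mulrA.
  rewrite -mulr_suml lG ?mul0r //; first exact: (CG _ _ CL (inC _ CL)).
  apply: contra CH => rH; have [h hG CE] := reprG _ CL.
  have := inC _ CL; rewrite {2}CE => /lcoset_eqP e.
  by rewrite CE -e lcoset_id.
have trW w : W w -> W (Tr w).
  move=> Ww; rewrite /Tr; elim/big_rec: _ => // C a CL; apply: WD.
  apply: Wstab => //; exact: (CG _ _ CL (inC _ CL)).
apply: NNPP => nT; apply: nV; rewrite vE.
have {}nT x : x \in l -> V (Tr (x.2 * v)).
  move=> /lK[_ x2]; apply: NNPP => nVx; apply: nT; exists (Tr (x.2 * v)); split=> //.
    by apply: trW; apply: WZ.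
  move=> g gG; apply: TrF => // h hH; rewrite rmorphM vH //.
  by case/HK: hH => _ ->.
elim: (l) lK nT => [|x s IH] lK' nT; first by rewrite big_nil.
rewrite big_cons; apply: VD.
  apply: VZ; last by apply: nT; rewrite mem_head.
  by case: (lK' x); rewrite ?mem_head.
by apply: IH => y ys; [apply: lK' | apply: nT]; rewrite inE ys orbT.
Qed.

(* Artin's theorem in contrapositive form *)
Lemma moved_fixed_elt (A : {group gT}) s : A \subset G -> s \in G ->
  (#|A :&: H|%:R != 0 :> F) ->
  (forall a h, a \in A -> h \in H -> s != (a * h)%g) ->
  exists al, [/\ al \in K, forall a, a \in A -> act a al = al & act s al != al].
Proof.
case: actG => a1 aM AG sG AH sAH; apply: NNPP => nal.
have sub := subsetP AG.
have fx b : b \in K -> act s (\sum_(a in A) act a b) = \sum_(a in A) act a b.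
  move=> bK; apply/eqP/negPn/negP => ne; apply: nal; exists (\sum_(a in A) act a b); split=> //.
    by apply: rpred_sum => a aA; apply: stabK => //; apply: sub.
  move=> a aA; rewrite rmorph_sum [RHS](reindex_inj (mulgI a)) /=.
  by apply: eq_big => [h|h hA]; rewrite ?groupMl // aM //; apply: sub.
have [l [lK lH lG]] := kernel_indicator.
(* The same sum is computed twice. If [s] fixed all [A]-traces of elements of [K], replacing [a] by
   [s * a] would give zero, since no [s * a] lies in [H]. *)
have e1 : \sum_(x <- l) x.1 * \sum_(a in A) act a x.2 = #|A :&: H|%:R.
  under eq_bigr do rewrite mulr_sumr.
  rewrite exchange_big /= (bigID (mem H)) /= [X in _ + X]big1 ?addr0.
    rewrite (eq_bigr (fun=> 1)); last by move=> a /andP[_ /lH].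
    by rewrite sumr_const; congr (_%:R); apply: eq_card => a; rewrite !inE.
  by move=> a /andP[aA aH]; apply: lG => //; apply: sub.
have e2 : \sum_(x <- l) x.1 * \sum_(a in A) act a x.2 = 0.
  rewrite big_seq_cond (eq_bigr (fun x => x.1 * \sum_(a in A) act (s * a)%g x.2)).
    rewrite -big_seq_cond; under eq_bigr do rewrite mulr_sumr.
    rewrite exchange_big /= big1 // => a aA; apply: lG.
      by rewrite groupM ?(sub a).
    apply/negP => /HK[_ saH]; have asH : (a * s)%g \in H.
      apply/HK; split=> [|al alK]; first by rewrite groupM ?(sub a).
      have aG := sub _ aA.
      have := saH (act a^-1 al); rewrite stabK ?groupV // => /(_ isT).
      by rewrite !aM // (actK actG) // => ->; rewrite (actK actG).
    by have := sAH a^-1%g (a * s)%g; rewrite groupV aA mulKg eqxx => /(_ isT asH).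
  move=> x /andP[/lK[x1 x2] _]; rewrite -fx // rmorph_sum; congr (_ * _).
  by apply: eq_bigr => a aA; rewrite aM //; apply: sub.
by move: AH; rewrite -e1 e2 eqxx.
Qed.
End Descent.

(** * Towers of two affine steps *)

Section AffineTower.
Variables (gT : finGroupType) (F : fieldType) (act : gT -> {rmorphism F -> F}).
Variables (G : {group gT}) (K : divringClosed F) (x y : F).
Hypothesis actG : acts_auto act G.
Hypothesis stabK : forall g s, g \in G -> s \in K -> act g s \in K.
Hypothesis tr_x : ~ alg K x.
Hypothesis tr_y : ~ alg (adj K x) y.

Definition rational_fixed := let k := fixp act K G in exists t1 t2,
  [/\ ~ alg k t1, ~ alg (adj k t1) t2,
   forall g, g \in G -> act g t1 = t1 /\ act g t2 = t2 &
   forall z, (forall g, g \in G -> act g z = z) -> z \in adj (adj k t1) t2].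

Lemma stab_adj (S : divringClosed F) t : (forall g s, g \in G -> s \in S -> act g s \in adj S t) ->
  (forall g, g \in G -> act g t \in adj S t) ->
  forall g s, g \in G -> s \in adj S t -> act g s \in adj S t.
Proof.
move=> hS ht g _ gG /adjP[p [q [/polyOverP pS /polyOverP qS q0 ->]]].
have ev (r : {poly F}) : (forall i, r`_i \in S) -> act g r.[t] \in adj S t.
  move=> rS; rewrite -horner_map; apply: rpred_horner (ht _ gG).
  by apply/polyOverP=> i; rewrite coef_map; apply: hS.
by rewrite fmorph_div rpred_div ?ev.
Qed.

(** Both [x] and [y] are algebraic over the field of invariants, hence over any field containing it,
    and the exchange property applies. *)
Lemma trans_of_fixed w f :
  (forall z, (forall g, g \in G -> act g z = z) -> z \in adj (adj K w) f) ->
  ~ alg K w /\ ~ alg (adj K w) f.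
Proof.
move=> hF; apply: (exchange tr_x tr_y);
by apply: (alg_fixed actG (S' := @full_field F)) => // z /fixpP[_]; apply: hF.
Qed.

(** [K(e)] only has to contain the invariants of [K(w)]. This freedom serves when an element of [H]
    moves [w]: then [e] is a generator of the subfield it fixes. *)
Theorem affine_tower w e f :
  (forall g, g \in G -> act g w \in adj K w) ->
  (forall g, g \in G -> exists a b,
     [/\ a \in adj K w, b \in adj K w & act g f = a * f + b]) ->
  (forall z, (forall g, g \in G -> act g z = z) -> z \in adj (adj K w) f) ->
  {subset fixp act (adj K w) G <= adj K e} ->
  (forall g, g \in G -> exists a b, [/\ a \in K, b \in K & act g e = a * e + b]) ->
  rational_fixed.
Proof.
move=> hw hf hF we he.
have [trw trf] := trans_of_fixed hF.
have stabw g s : g \in G -> s \in adj K w -> act g s \in adj K w.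
  by apply: stab_adj => // h s' hG s'K; apply/adj_base/stabK.
have aw : alg (adj K e) w by apply: (alg_fixed actG _ we) => g gG; apply: hw.
have tre : ~ alg K e.
  by move=> ae; apply: trw; apply: alg_trans aw => s; apply: alg_adj.
have [f' /fixpP[_ f'G] hf'] := affine_fixed actG stabw trf hf.
have [e' /fixpP[_ e'G] he'] := affine_fixed actG stabK tre he.
have FG z : (forall g, g \in G -> act g z = z) ->
    z \in adj (adj (fixp act K G) e') f'.
  move=> zG; have : z \in adj (fixp act (adj K w) G) f'.
    by apply: hf'; apply/fixpP; split=> //; apply: hF.
  apply: adj_sub => s sw; apply: he'; apply/fixpP; split; first exact: we.
  by case/fixpP: sw.
have kK : {subset fixp act K G <= K} by move=> s /fixpP[].
have [] := @exchange _ (fixp act K G) x y e' f'.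
- by move=> /(alg_sub kK).
- by move=> /(alg_sub (adj_sub kK)).
- by apply: (alg_fixed actG (S' := @full_field F)) => // z /fixpP[_]; apply: FG.
- by apply: (alg_fixed actG (S' := @full_field F)) => // z /fixpP[_]; apply: FG.
move=> t1 t2; exists e', f'; split=> // g gG; split; [exact: e'G | exact: f'G].
Qed.

Corollary affine_tower2 e f :
  (forall g, g \in G -> exists a b, [/\ a \in K, b \in K & act g e = a * e + b]) ->
  (forall g, g \in G -> exists a b,
     [/\ a \in adj K e, b \in adj K e & act g f = a * f + b]) ->
  (forall z, (forall g, g \in G -> act g z = z) -> z \in adj (adj K e) f) ->
  rational_fixed.
Proof.
move=> he hf hF; apply: (affine_tower (w := e) _ hf hF _ he).
  move=> g /he[a [b [aK bK ->]]]; rewrite rpredD ?rpredM ?adj_gen //; exact: adj_base.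
by move=> z /fixpP[].
Qed.
End AffineTower.

Ltac in_subfield := first
  [ assumption | apply: adj_gen | apply: rpred0 | apply: rpred1 | apply: rpred_nat
  | rewrite rpredN; in_subfield | rewrite rpredV; in_subfield | apply: rpredX; in_subfield
  | apply: rpredD; in_subfield | apply: rpredM; in_subfield | apply: adj_base; in_subfield ].

(** * Signed permutations *)

Section DihedralFour.
Variables (gT : finGroupType) (F : fieldType) (act : gT -> {rmorphism F -> F}).
Variables (G H : {group gT}) (K : divringClosed F).
Hypothesis actG : acts_auto act G.
Hypothesis stabK : forall g s, g \in G -> s \in K -> act g s \in K.
Hypothesis HK : forall g, reflect (g \in G /\ forall a, a \in K -> act g a = a) (g \in H).

(** The case of degree two of [fixed_in_base], with [h] and the identity as embeddings. *)
Lemma fixed_quadratic (S : divringClosed F) (h : {rmorphism F -> F}) t z :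
  h t != t -> t + h t \in S -> t * h t \in S -> (forall s, s \in S -> h s = s) ->
  z \in adj S t -> h z = z -> z \in S.
Proof.
move=> ht tS nS hS zS hz.
apply: (@fixed_in_base F S t (('X - t%:P) * ('X - (h t)%:P)) [:: h; (@idfun F : {rmorphism F -> F})]) => //.
- by rewrite monicMl ?monicXsubC.
- have -> : ('X - t%:P) * ('X - (h t)%:P) = 'X^2 - (t + h t) *: 'X + (t * h t)%:P.
    by rewrite -!mul_polyC polyCD polyCM; ring.
  by rewrite rpredD ?rpredB ?polyOverC ?polyOverXn // polyOverZ // polyOverX.
- by rewrite !hornerE subrr mul0r.
- by rewrite size_Mmonic ?polyXsubC_eq0 ?monicXsubC // !size_XsubC.
- by rewrite /= inE ht.
- by move=> h' /= [<-|[<-|]] //; split.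
Qed.

Lemma fix_adj (S : divringClosed F) (h : {rmorphism F -> F}) e :
  (forall s, s \in S -> h s = s) -> h e = e -> forall s, s \in adj S e -> h s = s.
Proof.
move=> hS he _ /adjP[p [q [/polyOverP pS /polyOverP qS _ ->]]].
have ev (r : {poly F}) : (forall i, r`_i \in S) -> h r.[e] = r.[e].
  move=> rS; rewrite -horner_map he; congr _.[e]; apply/polyP => i.
  by rewrite coef_map /= hS.
by rewrite fmorph_div !ev.
Qed.

Section Char2.
Variables x y : F.
Hypothesis char2 : 1 + 1 = 0 :> F.
Hypothesis tr_x : ~ alg K x.
Hypothesis tr_y : ~ alg (adj K x) y.
Hypothesis full : forall z, z \in adj (adj K x) y.
Hypothesis d4 : forall g, g \in G ->
  ((act g x = x \/ act g x = x^-1) /\ (act g y = y \/ act g y = y^-1)) \/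
  ((act g x = y \/ act g x = y^-1) /\ (act g y = x \/ act g y = x^-1)).

(** In characteristic 2 the substitution [X = 1 / (1 + x)] turns inversion into the translation
    [X + 1]. So [G] permutes [X] and [Y] up to translations, and [X + Y] is only translated. *)
Lemma d4_char2 : rational_fixed act G K.
Proof.
have nz (S : divringClosed F) t : ~ alg S t -> t != 0 /\ 1 + t != 0.
  move=> tS; split; apply/negP => /eqP e; apply: tS; apply: alg_id.
    by rewrite e rpred0.
  by rewrite -(addKr 1 t) e addr0 rpredN rpred1.
have [[x0 x1] [y0 y1]] := (nz _ _ tr_x, nz _ _ tr_y).
have N1 : - 1 = 1 :> F by apply/eqP; rewrite -subr_eq0 -opprD char2 oppr0.
pose X := (1 + x)^-1; pose Y := (1 + y)^-1.
have inv (t : F) : t != 0 -> 1 + t != 0 -> (1 + t^-1)^-1 = 1 + (1 + t)^-1.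
  move=> t0 t1; have e : 1 + (1 + t)^-1 = (1 + t^-1)^-1 + (1 + 1) * (1 + t)^-1.
    by field; rewrite t1 t0.
  by rewrite e char2 mul0r addr0.
have d4' g : g \in G -> exists c1 c2, [/\ c1 \in K, c2 \in K &
    (act g X = X + c1 /\ act g Y = Y + c2) \/ (act g X = Y + c1 /\ act g Y = X + c2)].
  move=> /d4 h; have mX : act g X = (1 + act g x)^-1 by rewrite fmorphV rmorphD rmorph1.
  have mY : act g Y = (1 + act g y)^-1 by rewrite fmorphV rmorphD rmorph1.
  have [k0 k1] : 0 \in K /\ 1 \in K by rewrite rpred0 rpred1.
  rewrite mX mY; case: h => -[[]-> []->]; rewrite ?inv //;
  [exists 0, 0|exists 0, 1|exists 1, 0|exists 1, 1|exists 0, 0|exists 0, 1|exists 1, 0|exists 1, 1];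
  by split=> //; rewrite -/X -/Y ?addr0 ?[1 + X]addrC ?[1 + Y]addrC; auto.
have add2 (z : F) : z + z = 0 :> F by rewrite -[z in z + _]mul1r -[X in _ + X]mul1r -mulrDl char2 mul0r.
have XE : x = X^-1 - 1 by rewrite invrK addrC addKr.
have YE : y = Y^-1 - 1 by rewrite invrK addrC addKr.
apply: (affine_tower2 actG stabK tr_x tr_y (e := X + Y) (f := X)).
- move=> g /d4'[c1 [c2 [c1K c2K h]]]; exists 1, (c1 + c2); split; rewrite ?rpred1 ?rpredD //.
  by rewrite rmorphD; case: h => -[-> ->]; ring.
- move=> g /d4'[c1 [c2 [c1K c2K []]]] [-> _].
    by exists 1, c1; split; [in_subfield | in_subfield | ring].
  exists 1, (X + Y + c1); split; [in_subfield | in_subfield | ].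
  by rewrite mul1r !addrA add2 add0r.
- move=> z _; apply: (adj_min (S' := adj (adj K (X + Y)) X) _ _ (full z)).
    apply: adj_min; first by move=> s sK; in_subfield.
    by rewrite XE; in_subfield.
  have -> : y = (X + Y - X)^-1 - 1 by rewrite [X + Y]addrC addrK.
  by in_subfield.
Qed.
End Char2.
Section OddChar.
Variables X Y : F.
Hypothesis char_n2 : 1 + 1 != 0 :> F.
Hypothesis tr_X : ~ alg K X.
Hypothesis tr_Y : ~ alg (adj K X) Y.
Hypothesis full : forall z, z \in adj (adj K X) Y.
Hypothesis d4 : forall g, g \in G ->
  ((act g X = X \/ act g X = - X) /\ (act g Y = Y \/ act g Y = - Y)) \/
  ((act g X = Y \/ act g X = - Y) /\ (act g Y = X \/ act g Y = - X)).
Let w := X / Y.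

Lemma d4_nz : X != 0 /\ Y != 0.
Proof.
split; apply/negP => /eqP e; [apply: tr_X | apply: tr_Y];
by apply: alg_id; rewrite e rpred0.
Qed.

Lemma d4_ratio g : g \in G ->
  [\/ act g w = w, act g w = - w, act g w = w^-1 | act g w = - w^-1].
Proof.
have [X0 Y0] := d4_nz.
move=> /d4; rewrite /w fmorph_div => -[] [[]-> []->];
rewrite ?mulNr ?invrN ?mulrN ?opprK ?invf_div;
by [constructor 1|constructor 2|constructor 3|constructor 4].
Qed.

Lemma d4_ratio_neq : w != - w /\ w != 0.
Proof.
have [X0 Y0] := d4_nz.
have w0 : w != 0 by rewrite mulf_neq0 ?invr_neq0.
split=> //; rewrite -subr_eq0 opprK -[w]mul1r -mulrDl mulf_neq0 //.
Qed.

Lemma full_ratio z : z \in adj (adj K w) Y.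
Proof.
have [X0 Y0] := d4_nz.
apply: (adj_min (S' := adj (adj K w) Y) _ _ (full z)); last exact: adj_gen.
apply: adj_min => [s sK|]; first by in_subfield.
by rewrite -[X](divfK Y0) -/w; in_subfield.
Qed.

Lemma d4_trans_ratio : ~ alg K w.
Proof.
by have [] := trans_of_fixed actG tr_X tr_Y (w := w) (f := Y) (fun z _ => full_ratio z).
Qed.

Lemma d4_last_affine g : g \in G -> exists a b,
  [/\ a \in adj K w, b \in adj K w & act g Y = a * Y + b].
Proof.
have [X0 Y0] := d4_nz; move=> /d4[] [_ []->].
- by exists 1, 0; split; [in_subfield|in_subfield|ring].
- by exists (-1), 0; split; [in_subfield|in_subfield|ring].
- by exists w, 0; split; [in_subfield|in_subfield|rewrite addr0 divfK].
- by exists (- w), 0; split; [in_subfield|in_subfield|rewrite addr0 mulNr divfK].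
Qed.

(* [w] parametrises a conic; a point of it with coordinate [v0] makes [1 / (w - v0)] affine. *)
Lemma d4_point v0 : v0 \in K ->
  (forall g, g \in G -> [\/ act g w = w /\ act g v0 = v0,
     act g w = - w /\ act g v0 = - v0,
     [/\ v0 != 0, act g w = w^-1 & act g v0 = v0^-1] |
     [/\ v0 != 0, act g w = - w^-1 & act g v0 = - v0^-1]]) ->
  rational_fixed act G K.
Proof.
move=> v0K hv; have [_ w0] := d4_ratio_neq.
have wv : w - v0 != 0.
  rewrite subr_eq0; apply/eqP => e; apply: d4_trans_ratio; apply: alg_id.
  by rewrite e.
have wE : w = ((w - v0)^-1)^-1 + v0 by rewrite invrK subrK.
have wK : w \in adj K (w - v0)^-1.
  by move: (w - v0)^-1 wE => e ->; in_subfield.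
have sub : {subset adj K w <= adj K (w - v0)^-1}.
  by apply: adj_min => // s sK; in_subfield.
apply: (affine_tower2 actG stabK tr_X tr_Y (e := (w - v0)^-1) (f := Y)).
- move=> g gG; rewrite fmorphV rmorphB; case: (hv g gG) => [[-> ->]|[-> ->]|[z0 -> ->]|[z0 -> ->]].
  + by exists 1, 0; split; [in_subfield|in_subfield|ring].
  + exists (-1), 0; split; [in_subfield|in_subfield|rewrite addr0 mulN1r -invrN].
    by congr _^-1; ring.
  (* Here [1 / (w^-1 - v0^-1) = w v0 / (v0 - w)], and writing [w = (w - v0) + v0] gives the two
     constants. *)
  + exists (- v0 ^+ 2), (- v0); split; [in_subfield|in_subfield|].
    by field; rewrite wv w0 z0 mulN1r -opprB oppr_eq0 wv.
  + exists (v0 ^+ 2), v0; split; [in_subfield|in_subfield|].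
    by field; rewrite wv w0 z0.
- move=> g /d4_last_affine[a [b [aw bw e]]]; exists a, b; split=> //; exact: sub.
- by move=> z _; apply: adj_sub sub _ (full_ratio z).
Qed.

(** The field fixed by [h] in [K(w)] is generated by [w^2], [w + w^-1] or [w - w^-1]. On the last
    two [G] acts by signs; [w^2] may be inverted and is replaced by its Cayley transform, where
    inversion becomes a sign. *)
Lemma d4_quotient h : h \in H -> act h w != w -> rational_fixed act G K.
Proof.
have [ww w0] := d4_ratio_neq; have trw := d4_trans_ratio.
have nz (p : {poly F}) : p \is a polyOver K -> p != 0 -> p.[w] != 0.
  by move=> pK p0; apply: contraNneq p0 => e; apply/eqP/(alg_root trw).
have w21 : 1 + w ^+ 2 != 0.
  have := nz (1 + 'X^2); rewrite !hornerE => -> //.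
    by rewrite rpredD ?rpred1 // polyOverXn.
  by rewrite -size_poly_eq0 addrC size_polyDl ?size_polyXn // size_poly1.
move=> hH hw; have [hG hKa] := HK _ hH.
have stw g : g \in G -> act g w \in adj K w.
  by case/d4_ratio=> ->; in_subfield.
have fin e : act h e = e -> w + act h w \in adj K e -> w * act h w \in adj K e ->
    (forall g, g \in G -> act g e = e \/ act g e = - e) -> rational_fixed act G K.
  move=> he sw pw ge; apply: (affine_tower actG stabK tr_X tr_Y stw d4_last_affine (e := e)).
  - by move=> z _; apply: full_ratio.
  - move=> z /fixpP[zw zG].
    apply: (fixed_quadratic hw sw pw); last exact: zG.
      exact: fix_adj.
    by apply: adj_sub zw; apply: adj_base.
  - move=> g /ge[]->; first by exists 1, 0; split; [in_subfield|in_subfield|ring].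
    by exists (-1), 0; split; [in_subfield|in_subfield|ring].
case: (d4_ratio hG) hw => hw; rewrite ?hw ?eqxx // => _.
- pose e := (1 - w ^+ 2) / (1 + w ^+ 2).
  have w2E : (1 + w ^+ 2) * (1 + e) = 1 + 1 by rewrite /e; field.
  have w2 : w ^+ 2 = (1 - e) / (1 + e).
    have e1 : 1 + e != 0 by move: char_n2; rewrite -w2E mulf_eq0 => /norP[].
    by apply: (mulIf e1); rewrite divfK // /e; field.
  apply: (fin e).
  + by rewrite /e fmorph_div rmorphB rmorphD rmorphXn rmorph1 hw sqrrN.
  + by rewrite hw subrr rpred0.
  + by rewrite hw mulrN -expr2 w2; in_subfield.
  + move=> g /d4_ratio h'; rewrite /e fmorph_div rmorphB rmorphD rmorphXn rmorph1.
    case: h' => ->; rewrite ?sqrrN; [by left|by left|right|right];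
    by field; rewrite w21 w0.
- apply: (fin (w + w^-1)).
  + by rewrite rmorphD fmorphV hw invrK addrC.
  + by rewrite hw; in_subfield.
  + by rewrite hw divff // rpred1.
  + move=> g /d4_ratio h'; rewrite rmorphD fmorphV.
    by case: h' => ->; rewrite ?invrN ?invrK; [left|right|left|right]; ring.
- apply: (fin (w - w^-1)).
  + by rewrite rmorphB fmorphV hw invrN invrK opprK addrC.
  + by rewrite hw; in_subfield.
  + by rewrite hw mulrN divff // rpredN rpred1.
  + move=> g /d4_ratio h'; rewrite rmorphB fmorphV.
    by case: h' => ->; rewrite ?invrN ?invrK; [left|right|right|left]; ring.
Qed.

Lemma d4_indep a b : a \in K -> b \in K -> a * X + b * Y = 0 -> a = 0 /\ b = 0.
Proof.
have [X0 Y0] := d4_nz; move=> aK bK e.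
have a0 : a = 0.
  apply/eqP/negP => /negP a0; apply: d4_trans_ratio; apply: alg_id.
  have -> : w = - b / a by rewrite /w; apply/eqP; rewrite eqr_div // mulrC mulNr -addr_eq0 e.
  by in_subfield.
split=> //; move/eqP: e; rewrite a0 mul0r add0r mulf_eq0 (negPf Y0) orbF => /eqP //.
Qed.

(** When [G] acts faithfully on [K] there is an invariant linear form [A X + B Y] over [K] with [A]
    nonzero. Its zero [- B / A], in the coordinate [w], transforms like [w]. *)
Lemma d4_faithful : (forall h, h \in H -> h = 1%g) -> rational_fixed act G K.
Proof.
move=> H1; have [X0 Y0] := d4_nz; have [ww w0] := d4_ratio_neq.
pose V z := exists2 b, b \in K & z = b * Y.
pose W z := exists a b, [/\ a \in K, b \in K & z = a * X + b * Y].
have [||||||T [[A [B [AK BK TE]]] nV TG]] := @fixed_outside _ _ act G H K actG stabK HK V W X.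
- split=> [|_ _ [b bK ->] [c cK ->]|c _ cK [b bK ->]].
  + by exists 0; rewrite ?rpred0 ?mul0r.
  + by exists (b + c); rewrite ?rpredD ?mulrDl.
  + by exists (c * b); rewrite ?rpredM ?mulrA.
- split=> [|_ _ [a [b [aK bK ->]]] [c [d [cK dK ->]]]|c _ cK [a [b [aK bK ->]]]].
  + by exists 0, 0; rewrite rpred0; split=> //; ring.
  + by exists (a + c), (b + d); rewrite !rpredD //; split=> //; ring.
  + by exists (c * a), (c * b); rewrite !rpredM //; split=> //; ring.
- move=> g _ gG [a [b [aK bK ->]]]; rewrite rmorphD !rmorphM.
  have [aK' bK'] : act g a \in K /\ act g b \in K by rewrite !stabK.
  case: (d4 gG) => -[[]-> []->].
  + by exists (act g a), (act g b).
  + by exists (act g a), (- act g b); split; [in_subfield|in_subfield|ring].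
  + by exists (- act g a), (act g b); split; [in_subfield|in_subfield|ring].
  + by exists (- act g a), (- act g b); split; [in_subfield|in_subfield|ring].
  + by exists (act g b), (act g a); split; [in_subfield|in_subfield|ring].
  + by exists (- act g b), (act g a); split; [in_subfield|in_subfield|ring].
  + by exists (act g b), (- act g a); split; [in_subfield|in_subfield|ring].
  + by exists (- act g b), (- act g a); split; [in_subfield|in_subfield|ring].
- by move=> h /H1 ->; case: actG.
- by exists 1, 0; split; [in_subfield|in_subfield|ring].
- move=> [b bK XE]; apply: d4_trans_ratio; apply: alg_id.
  by rewrite /w XE mulfK.
have A0 : A != 0 by apply/eqP => A0; apply: nV; exists B; rewrite // TE A0 mul0r add0r.
apply: (@d4_point (- B / A)); first by in_subfield.
move=> g gG; have e0 := TG g gG; rewrite TE rmorphD !rmorphM in e0.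
have [AK' BK'] : act g A \in K /\ act g B \in K by rewrite !stabK.
have gv : act g (- B / A) = - act g B / act g A by rewrite fmorph_div rmorphN.
have gA0 : act g A != 0 by rewrite fmorph_eq0.
have ind a b : a \in K -> b \in K -> a * X + b * Y = A * X + B * Y -> a = A /\ b = B.
  move=> aK bK e; have [|||/eqP ea /eqP eb] := @d4_indep (a - A) (b - B).
  - by in_subfield.
  - by in_subfield.
  - by rewrite -(subrr (A * X + B * Y)) -{1}e; ring.
  by move: ea eb; rewrite !subr_eq0 => /eqP-> /eqP.
rewrite gv /w fmorph_div; move: e0; case: (d4 gG) => -[[]-> []->] e.
- have [|||eA eB] := ind (act g A) (act g B); [by in_subfield|by in_subfield|by rewrite -e; ring|].
  have gA : act g A = A := eA.
  have gB : act g B = B := eB.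
  by constructor 1; rewrite gA gB; split; field; rewrite ?oppr_eq0 ?A0 ?Y0 ?X0.
- have [|||eA eB] := ind (act g A) (- act g B); [by in_subfield|by in_subfield|by rewrite -e; ring|].
  have gA : act g A = A := eA.
  have gB : act g B = - B by apply/eqP; rewrite -eqr_oppLR eB.
  by constructor 2; rewrite gA gB; split; field; rewrite ?oppr_eq0 ?A0 ?Y0 ?X0.
- have [|||eA eB] := ind (- act g A) (act g B); [by in_subfield|by in_subfield|by rewrite -e; ring|].
  have gA : act g A = - A by apply/eqP; rewrite -eqr_oppLR eA.
  have gB : act g B = B := eB.
  by constructor 2; rewrite gA gB; split; field; rewrite ?oppr_eq0 ?A0 ?Y0 ?X0.
- have [|||eA eB] := ind (- act g A) (- act g B); [by in_subfield|by in_subfield|by rewrite -e; ring|].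
  have gA : act g A = - A by apply/eqP; rewrite -eqr_oppLR eA.
  have gB : act g B = - B by apply/eqP; rewrite -eqr_oppLR eB.
  by constructor 1; rewrite gA gB; split; field; rewrite ?oppr_eq0 ?A0 ?Y0 ?X0.
- have [|||eA eB] := ind (act g B) (act g A); [by in_subfield|by in_subfield|by rewrite -e; ring|].
  have gB : act g B = A := eA.
  have gA : act g A = B := eB.
  have B0 : B != 0 by move: gA0; rewrite gA ?oppr_eq0.
  constructor 3; rewrite gA gB; split; first by rewrite mulf_neq0 ?oppr_eq0 ?invr_eq0.
    by field; rewrite ?oppr_eq0 ?X0 ?Y0.
  by field; rewrite ?oppr_eq0 ?A0 ?B0.
- have [|||eA eB] := ind (- act g B) (act g A); [by in_subfield|by in_subfield|by rewrite -e; ring|].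
  have gB : act g B = - A by apply/eqP; rewrite -eqr_oppLR eA.
  have gA : act g A = B := eB.
  have B0 : B != 0 by move: gA0; rewrite gA ?oppr_eq0.
  constructor 4; rewrite gA gB; split; first by rewrite mulf_neq0 ?oppr_eq0 ?invr_eq0.
    by field; rewrite ?oppr_eq0 ?X0 ?Y0.
  by field; rewrite ?oppr_eq0 ?A0 ?B0.
- have [|||eA eB] := ind (act g B) (- act g A); [by in_subfield|by in_subfield|by rewrite -e; ring|].
  have gB : act g B = A := eA.
  have gA : act g A = - B by apply/eqP; rewrite -eqr_oppLR eB.
  have B0 : B != 0 by move: gA0; rewrite gA ?oppr_eq0.
  constructor 4; rewrite gA gB; split; first by rewrite mulf_neq0 ?oppr_eq0 ?invr_eq0.
    by field; rewrite ?oppr_eq0 ?X0 ?Y0.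
  by field; rewrite ?oppr_eq0 ?A0 ?B0.
- have [|||eA eB] := ind (- act g B) (- act g A); [by in_subfield|by in_subfield|by rewrite -e; ring|].
  have gB : act g B = - A by apply/eqP; rewrite -eqr_oppLR eA.
  have gA : act g A = - B by apply/eqP; rewrite -eqr_oppLR eB.
  have B0 : B != 0 by move: gA0; rewrite gA ?oppr_eq0.
  constructor 3; rewrite gA gB; split; first by rewrite mulf_neq0 ?oppr_eq0 ?invr_eq0.
    by field; rewrite ?oppr_eq0 ?X0 ?Y0.
  by field; rewrite ?oppr_eq0 ?A0 ?B0.
Qed.

(** A kernel that fixes [w] acts on [X] and [Y] by the scalars 1 and -1, since [X^2] and [Y^2] are
    not proportional over [K]. Without -1 it is trivial. If [w] is never sent to [- w^-1], then 1 or
    0 is an equivariant point. *)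
Lemma d4_outcome : (forall g, g \in G -> (forall z, act g z = z) -> g = 1%g) ->
  rational_fixed act G K \/
  [/\ exists h, [/\ h \in H, act h X = - X & act h Y = - Y],
      forall h, h \in H -> act h w = w &
      exists s, s \in G /\ act s w = - w^-1].
Proof.
case: (actG) => a1 aM faith; have [ww w0] := d4_ratio_neq.
have [h1|noh] := classic (exists h, h \in H /\ act h w != w).
  by case: h1 => h [hH hw]; left; apply: d4_quotient hw.
have Hw h : h \in H -> act h w = w.
  by move=> hH; apply/eqP/negPn/negP => hw; case: noh; exists h.
have [hneg|nneg] := classic (exists h, [/\ h \in H, act h X = - X & act h Y = - Y]); last first.
  left; apply: d4_faithful => h hH; have [hG hKa] := HK _ hH.
  apply: faith => // z; have hXY : act h X = X /\ act h Y = Y.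
    have [X0 Y0] := d4_nz.
    have e : act h X * Y = X * act h Y.
      have := Hw h hH; rewrite /w fmorph_div => /eqP.
      by rewrite eqr_div ?fmorph_eq0 // mulrC [X in _ == X]mulrC => /eqP; rewrite mulrC [RHS]mulrC.
    have absurd2 t : t = - t -> t = 0 :> F.
      move/eqP; rewrite -subr_eq0 opprK -[t]mul1r -mulrDl mulf_eq0 (negPf char_n2) => /eqP.
      by rewrite mul1r.
    have swap c : X ^+ 2 = c * Y ^+ 2 -> c \in K -> False.
      move=> e2 cK; apply: d4_trans_ratio; exists ('X^2 - c%:P); split.
      - by rewrite rpredB ?polyOverC ?polyOverXn.
      - by rewrite -size_poly_eq0 size_polyDl ?size_polyXn // size_polyN (leq_ltn_trans (size_polyC_leq1 _)).
      - by apply/rootP; rewrite !hornerE /w expr_div_n e2 mulfK ?subrr // expf_neq0.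
    case: (d4 hG) => -[[] hX [] hY]; rewrite hX hY in e *; split=> //.
    - by apply/eqP; rewrite -subr_eq0; move/eqP: e; rewrite mulrN eq_sym => /eqP/esym/absurd2/eqP;
        rewrite mulf_eq0 (negPf X0) (negPf Y0).
    - by move/eqP: e; rewrite mulNr eq_sym => /eqP/absurd2/eqP; rewrite mulf_eq0 (negPf X0) (negPf Y0).
    - by case: nneg; exists h.
    - by case: nneg; exists h.
    - by case: (swap 1); rewrite ?rpred1 // mul1r !expr2 e.
    - by case: (swap 1); rewrite ?rpred1 // mul1r !expr2 e.
    - by case: (swap (-1)); rewrite ?rpredN ?rpred1 // mulN1r !expr2 e mulrN opprK.
    - by case: (swap (-1)); rewrite ?rpredN ?rpred1 // mulN1r !expr2 e mulrN opprK.
    - by case: (swap (-1)); rewrite ?rpredN ?rpred1 // mulN1r !expr2 -mulNr e.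
    - by case: (swap (-1)); rewrite ?rpredN ?rpred1 // mulN1r !expr2 -mulNr e.
    - by case: (swap 1); rewrite ?rpred1 // mul1r !expr2; move/eqP: e; rewrite mulNr mulrN eqr_opp => /eqP ->.
    - by case: (swap 1); rewrite ?rpred1 // mul1r !expr2; move/eqP: e; rewrite mulNr mulrN eqr_opp => /eqP ->.
  case: hXY => hX hY; apply: (fix_adj _ hY) (full z).
  exact: fix_adj.
have [hs|ns] := classic (exists s, s \in G /\ act s w = - w^-1); first by right.
left; have [[t [tG tw]]|nt] := classic (exists t, t \in G /\ act t w = w^-1).
  (* No element sends [w] to [- w], as its product with [t] would send [w] to [- w^-1]; so the fixed
     point 1 of inversion serves. *)
  apply: (@d4_point 1); first exact: rpred1.
  move=> g gG; rewrite rmorph1 invr1 oner_eq0; case: (d4_ratio gG) => gw.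
  - by constructor 1.
  - case: ns; exists (t * g)%g; rewrite groupM // aM // gw rmorphN tw; by [].
  - by constructor 3.
  - by case: ns; exists g.
apply: (@d4_point 0); first exact: rpred0.
move=> g gG; rewrite rmorph0 oppr0; case: (d4_ratio gG) => gw.
- by constructor 1.
- by constructor 2.
- by case: nt; exists g.
- by case: ns; exists g.
Qed.
End OddChar.
End DihedralFour.

Ltac all_in_subfield := rewrite ?andbT;
  repeat match goal with |- is_true (_ && _) => apply/andP; split end; in_subfield.

(** * Permutations of three monomials of product one *)

Section CubicSurface.
Variables (F : fieldType) (K : divringClosed F) (p q r r' : F).
Let D := p ^+ 2 - p * q + q ^+ 2.
Let ga := (p * q * r - p ^+ 3 - q ^+ 3) / D.
Let ga' := (p * q * r' - p ^+ 3 - q ^+ 3) / D.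
(** The tangent plane at [(1 : 1 : 1 : 1)] of the quadric [ga * ga' = D] in the coordinates [p],
    [q], [ga], [ga']. Below, [e] and [f] are linear forms vanishing at this point divided by [l],
    that is, affine coordinates of the projection from it. *)
Let l := ga + ga' - p - q.
Let e := (p - q) / l.
Let f := (p - ga) / l.
Hypothesis sum_r : r + r' = 3 * p + 3 * q + p * q.
Hypothesis prod_r : r * r' = p ^+ 3 + q ^+ 3 + 9 * D.
Hypotheses (p0 : p != 0) (q0 : q != 0) (D0 : D != 0).

(** [l] is symmetric in [r] and [r'], so it is a function of [p] and [q], whose nonvanishing can be
    checked explicitly. *)
Lemma cubic_plane : l * D = p * q * (3 * p + 3 * q + p * q) - 3 * (p ^+ 3 + q ^+ 3).
Proof.
rewrite -sum_r; have e1 : ga * D = p * q * r - p ^+ 3 - q ^+ 3 by rewrite divfK.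
have e2 : ga' * D = p * q * r' - p ^+ 3 - q ^+ 3 by rewrite divfK.
by rewrite /l !mulrBl mulrDl e1 e2 /D; ring.
Qed.

(* Projecting from its singular point turns the cubic surface of the two relations
   into this quadric, on which [(1 : 1 : 1 : 1)] is fixed by all symmetries. *)
Lemma cubic_quadric : ga * ga' = D.
Proof.
have e1 : ga * D = p * q * r - p ^+ 3 - q ^+ 3 by rewrite divfK.
have e2 : ga' * D = p * q * r' - p ^+ 3 - q ^+ 3 by rewrite divfK.
apply: (mulIf (expf_neq0 2 D0)).
have -> : ga * ga' * D ^+ 2 = (p * q) ^+ 2 * (r * r') - p * q * (p ^+ 3 + q ^+ 3) * (r + r')
    + (p ^+ 3 + q ^+ 3) ^+ 2.
  by rewrite expr2 mulrACA e1 e2; ring.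
by rewrite sum_r prod_r /D; ring.
Qed.

Hypothesis l0 : l != 0.

(** After division by the tangent plane, the equation of the quadric is linear in [p / l] over the
    field of [e] and [f]. *)
Lemma cubic_coords : [/\ p / l = e ^+ 2 + f + f ^+ 2 - e * f, q / l = p / l - e,
  ga / l = p / l - f & ga' / l = 1 + p / l + q / l - ga / l].
Proof.
have := cubic_quadric; rewrite (_ : ga' = l + p + q - ga); last by rewrite /l; ring.
rewrite /e /f /D; move: (l) l0 (ga) => l' l'0 g qu.
split; [|by field|by field|by field].
(* The equation of the quadric enters as a difference of two equal terms, one of which [qu]
   rewrites. *)
have -> : p / l' = ((g * (l' + p + q - g) - (p ^+ 2 - p * q + q ^+ 2)) -
   (g * (l' + p + q - g) - (p ^+ 2 - p * q + q ^+ 2)) + p * l') / l' ^+ 2 by field.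
by rewrite {1}qu; field.
Qed.

(** The ratios of [p], [q], [ga], [ga'] lie in [K(e, f)], hence so do [r / q] and [r' / q]. The
    relation [sum_r], which is not homogeneous, then yields [p] itself. *)
Lemma cubic_generated : [/\ p \in adj (adj K e) f, q \in adj (adj K e) f & r \in adj (adj K e) f].
Proof.
have [pl ql gl gl'] := cubic_coords.
set E := adj (adj K e) f.
have [eE fE] : e \in E /\ f \in E by split; rewrite /E; in_subfield.
have plE : p / l \in E 
  by rewrite pl; apply: rpredB; last apply: rpredM; rewrite // !rpredD // rpredX.
have qlE : q / l \in E by rewrite ql rpredB.
have glE : ga / l \in E by rewrite gl rpredB.
have gl'E : ga' / l \in E by rewrite gl' rpredB // !rpredD // rpred1.
have ratE a : a / l \in E -> a / q \in E.
  by move=> aE; rewrite (_ : a / q = (a / l) / (q / l)); [rewrite rpred_div | field; rewrite q0 l0].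
have la := ratE _ plE; have ng := ratE _ glE; have ng' := ratE _ gl'E.
have solv t : (p * q * t - p ^+ 3 - q ^+ 3) / D / q \in E -> t / q \in E.
  have -> : t / q = ((p * q * t - p ^+ 3 - q ^+ 3) / D / q * ((p / q) ^+ 2 - p / q + 1) +
      (p / q) ^+ 3 + 1) / (p / q).
    by move: D0; rewrite /D => D0'; field; rewrite p0 q0 D0'.
  have ax (S : divringClosed F) (a b : F) : a \in S -> b \in S ->
      (a * (b ^+ 2 - b + 1) + b ^+ 3 + 1) / b \in S by move=> aS bS; in_subfield.
  by move=> aE; apply: ax.
have rqE := solv _ ng; have rqE' := solv _ ng'.
have pE : p \in E.
  have -> : p = r / q + r' / q - 3 * (p / q) - 3 by rewrite -mulrDl sum_r; field.
  have ax (S : divringClosed F) (a b c : F) : a \in S -> b \in S -> c \in S ->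
      a + b - 3 * c - 3 \in S by move=> aS bS cS; in_subfield.
  by apply: ax.
have qE : q \in E by rewrite -(invrK q) -[q^-1](mulKf p0) rpredV rpredM // rpredV.
by split=> //; rewrite -(divfK q0 r) rpredM.
Qed.

(** Such a [g] permutes the coordinates of the quadric and fixes both the point [(1 : 1 : 1 : 1)]
    and [l], so it acts on the projection from the point by affine maps. *)
Lemma cubic_affine (g : {rmorphism F -> F}) :
  [\/ [/\ g p = p, g q = q, g r = r & g r' = r'],
      [/\ g p = p, g q = q, g r = r' & g r' = r],
      [/\ g p = q, g q = p, g r = r' & g r' = r] |
      [/\ g p = q, g q = p, g r = r & g r' = r']] ->
  (exists a b, [/\ a \in K, b \in K & g e = a * e + b]) /\
  (exists a b, [/\ a \in adj K e, b \in adj K e & g f = a * f + b]).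
Proof.
move=> hg; have [pl ql gl gl'] := cubic_coords.
have gD : g D = D.
  by rewrite /D rmorphD rmorphB !(rmorphXn, rmorphM); case: hg => -[-> -> _ _] //; ring.
have gga t : g ((p * q * t - p ^+ 3 - q ^+ 3) / D) = (p * q * g t - p ^+ 3 - q ^+ 3) / D.
  rewrite fmorph_div gD; congr (_ / _); rewrite !rmorphB !(rmorphXn, rmorphM).
  by case: hg => -[-> -> _ _] //; ring.
have gl0 : g l = l.
  rewrite /l !rmorphB rmorphD !gga; case: hg => -[-> -> -> ->] //; rewrite -/ga -/ga'; ring.
have eE : e \in adj K e := adj_gen K e.
have -> : g e = (g p - g q) / l by rewrite fmorph_div rmorphB gl0.
have -> : g f = (g p - (p * q * g r - p ^+ 3 - q ^+ 3) / D) / l.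
  by rewrite fmorph_div rmorphB gl0 gga.
case: hg => -[-> -> -> _]; rewrite -/ga -/ga'; split.
- by exists 1, 0; split; [exact: rpred1 | exact: rpred0 | rewrite mul1r addr0].
- by exists 1, 0; split; [exact: rpred1 | exact: rpred0 | rewrite mul1r addr0].
- by exists 1, 0; split; [exact: rpred1 | exact: rpred0 | rewrite mul1r addr0].
- exists (-1), (e - 1); split; [by rewrite rpredN rpred1 | by rewrite rpredB // rpred1 |].
  rewrite mulrBl gl' gl ql; ring.
- exists (-1), 0; split; [by rewrite rpredN rpred1 | exact: rpred0 |].
  by rewrite addr0 mulN1r -mulNr opprB.
- exists (-1), (-1); split; [by rewrite rpredN rpred1 | by rewrite rpredN rpred1 |].
  rewrite mulrBl gl' gl ql; ring.
- exists (-1), 0; split; [by rewrite rpredN rpred1 | exact: rpred0 |].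
  by rewrite addr0 mulN1r -mulNr opprB.
- exists 1, (- e); split; [exact: rpred1 | by rewrite rpredN |].
  rewrite mulrBl gl ql; ring.
Qed.

Lemma cubic_fixed (g : {rmorphism F -> F}) :
  g p = p -> g q = q -> g r = r -> g r' = r' -> g e = e /\ g f = f.
Proof.
move=> gp gq gr gr'.
have gD : g D = D by rewrite /D rmorphD rmorphB !(rmorphXn, rmorphM) gp gq.
have gga t : g t = t -> g ((p * q * t - p ^+ 3 - q ^+ 3) / D) = (p * q * t - p ^+ 3 - q ^+ 3) / D.
  by move=> gt; rewrite fmorph_div gD; congr (_ / _); rewrite !rmorphB !(rmorphXn, rmorphM) gp gq gt.
have gl0 : g l = l by rewrite /l !rmorphB rmorphD !gga // gp gq.
by split; rewrite fmorph_div rmorphB gl0 ?gga // gp ?gq.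
Qed.
End CubicSurface.

Section Hexagonal.
Variables (gT : finGroupType) (F : fieldType) (act : gT -> {rmorphism F -> F}).
Variables (G H : {group gT}) (K : divringClosed F).
Hypothesis actG : acts_auto act G.
Hypothesis stabK : forall g s, g \in G -> s \in K -> act g s \in K.
Hypothesis HK : forall g, reflect (g \in G /\ forall a, a \in K -> act g a = a) (g \in H).
Variables x y : F.
Hypothesis tr_x : ~ alg K x.
Hypothesis tr_y : ~ alg (adj K x) y.
Hypothesis full : forall z, z \in adj (adj K x) y.
Let z := (x * y)^-1.

Variant hexagonal (f : F -> F) : Prop :=
| Hex_xyz of f x = x & f y = y & f z = z
| Hex_yzx of f x = y & f y = z & f z = x
| Hex_zxy of f x = z & f y = x & f z = y
| Hex_yxz of f x = y & f y = x & f z = z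
| Hex_xzy of f x = x & f y = z & f z = y
| Hex_zyx of f x = z & f y = y & f z = x
| HexV_xyz of f x = x^-1 & f y = y^-1 & f z = z^-1
| HexV_yzx of f x = y^-1 & f y = z^-1 & f z = x^-1
| HexV_zxy of f x = z^-1 & f y = x^-1 & f z = y^-1
| HexV_yxz of f x = y^-1 & f y = x^-1 & f z = z^-1
| HexV_xzy of f x = x^-1 & f y = z^-1 & f z = y^-1
| HexV_zyx of f x = z^-1 & f y = y^-1 & f z = x^-1.

Hypothesis hexG : forall g, g \in G -> hexagonal (act g).

(** Explicit expressions in [x] and [y] are proved nonzero by writing them, up to powers of [x y],
    through the list of their coefficients as polynomials in [y], lowest degree first. *)
Lemma trans_horner_neq0 (S : divringClosed F) t (s : seq F) : ~ alg S t ->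
  all (fun c => c \in S) s -> last 0 s != 0 -> horner_rec s t != 0.
Proof.
move=> tS /allP sS s0; rewrite -horner_Poly; apply/negP => /eqP e.
have pS : Poly s \is a polyOver S.
  apply/polyOverP => i; rewrite coef_Poly; have [h|h] := ltnP i (size s).
    by apply: sS; rewrite mem_nth.
  by rewrite nth_default ?rpred0.
have := congr1 (fun p : {poly F} => p`_(size s).-1) (alg_root tS pS e).
by rewrite coef_Poly coef0 nth_last => /eqP; rewrite (negPf s0).
Qed.

Lemma hex_neq0 : [/\ x != 0, y != 0, z != 0 & 1 - x + x ^+ 2 != 0].
Proof.
have nz (S : divringClosed F) t : ~ alg S t -> t != 0.
  by move=> tS; apply/eqP => e; apply/tS/alg_id; rewrite e rpred0.
have x0 := nz _ _ tr_x; have y0 := nz _ _ tr_y.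
split=> //; first by rewrite invr_eq0 mulf_neq0.
have := @trans_horner_neq0 _ _ [:: 1; -1; 1] tr_x.
have -> : horner_rec [:: 1; -1; 1] x = 1 - x + x ^+ 2 by rewrite /=; ring.
by apply; rewrite /= ?oner_eq0 ?rpredN ?rpred1.
Qed.

Lemma hex_distinct : [/\ x != y, y != z & x != z].
Proof.
have [x0 y0 z0 _] := hex_neq0.
have h (s : seq F) : all (fun c => c \in adj K x) s -> last 0 s != 0 -> horner_rec s y != 0.
  exact: trans_horner_neq0.
split; rewrite -subr_eq0.
- have := h [:: x; -1]; rewrite /= mul0r add0r mulN1r addrC => -> //.
    by rewrite adj_gen rpredN rpred1.
  by rewrite oppr_eq0 oner_eq0.
- have := h [:: -1; 0; x].
  have -> : horner_rec [:: -1; 0; x] y = (y - z) * (x * y) by rewrite /= /z; field; rewrite ?x0 ?y0 ?oner_eq0.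
  move=> H0; suff: (y - z) * (x * y) != 0 by rewrite mulf_eq0 negb_or => /andP[].
  apply: H0 => //.
  by rewrite /= rpredN rpred1 rpred0 adj_gen.
- have := h [:: -1; x ^+ 2].
  have -> : horner_rec [:: -1; x ^+ 2] y = (x - z) * (x * y) by rewrite /= /z; field; rewrite ?x0 ?y0 ?oner_eq0.
  move=> H0; suff: (x - z) * (x * y) != 0 by rewrite mulf_eq0 negb_or => /andP[].
  apply: H0 => //.
    by rewrite /= rpredN rpred1 rpredX ?adj_gen.
  by rewrite /= expf_neq0.
Qed.

Section ThreeCycle.
(** Invariants of the 3-cycle: the elementary symmetric functions and the orbit sums of [x^2 y] and
    [x y^2]. The shifts by 3 move [x = y = z = 1] to the origin, which is the singular point of the
    cubic surface of their relations. *)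
Let s1 := x + y + z.
Let s2 := x^-1 + y^-1 + z^-1.
Let p := s1 - 3.
Let q := s2 - 3.
Let r := x ^+ 2 * y + y ^+ 2 * z + z ^+ 2 * x - 3.
Let r' := x * y ^+ 2 + y * z ^+ 2 + z * x ^+ 2 - 3.
Lemma cyc_sum : r + r' = 3 * p + 3 * q + p * q.
Proof.
have [x0 y0 z0 _] := hex_neq0.
by rewrite /r /r' /p /q /s1 /s2 /z; field; rewrite ?x0 ?y0 ?oner_eq0.
Qed.

Lemma cyc_prod : r * r' = p ^+ 3 + q ^+ 3 + 9 * (p ^+ 2 - p * q + q ^+ 2).
Proof.
have [x0 y0 z0 _] := hex_neq0.
by rewrite /r /r' /p /q /s1 /s2 /z; field; rewrite ?x0 ?y0 ?oner_eq0.
Qed.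

Lemma cyc_neq0 : [/\ p != 0, q != 0, p ^+ 2 - p * q + q ^+ 2 != 0 &
  p * q * (3 * p + 3 * q + p * q) - 3 * (p ^+ 3 + q ^+ 3) != 0].
Proof.
have [x0 y0 z0 xx] := hex_neq0.
have h (s : seq F) : all (fun c => c \in adj K x) s -> last 0 s != 0 -> horner_rec s y != 0.
  exact: trans_horner_neq0.
have xK : x \in adj K x := adj_gen K x.
have fin n a b : a != 0 -> a = b * (x * y) ^+ n -> b != 0.
  by move=> a0 ab; apply: contraNneq a0 => b0; rewrite ab b0 mul0r.
have p0 : p != 0.
  apply: (fin 1 (horner_rec [:: 1; - 3 * x + x ^+ 2; x] y)).
    by apply: h; rewrite //=; all_in_subfield.
  by rewrite /= /p /s1 /z; field; rewrite ?x0 ?y0 ?oner_eq0.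
have q0 : q != 0.
  apply: (fin 1 (horner_rec [:: x; 1 - 3 * x; x ^+ 2] y)).
    apply: h; rewrite ?expf_neq0 //=; all_in_subfield.
  by rewrite /= /q /s2 /z; field; rewrite ?x0 ?y0 ?oner_eq0.
have D0 : p ^+ 2 - p * q + q ^+ 2 != 0.
  (* The coefficients in [y] of the expression times [(x y)^2]; the leading one is
     [x^2 (1 - x + x^2)], whence the last part of [hex_neq0]. *)
  apply: (fin 2 (horner_rec [:: 1 - x + x ^+ 2; - 1 - x - x ^+ 2 - x ^+ 3; 1 - x + 6 * x ^+ 2 - x ^+ 3 + x ^+ 4; - x - x ^+ 2 - x ^+ 3 - x ^+ 4; x ^+ 2 - x ^+ 3 + x ^+ 4] y)).
    apply: h; first by rewrite /=; all_in_subfield.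
    have -> : last 0 [:: 1 - x + x ^+ 2; - 1 - x - x ^+ 2 - x ^+ 3; 1 - x + 6 * x ^+ 2 - x ^+ 3 + x ^+ 4; - x - x ^+ 2 - x ^+ 3 - x ^+ 4; x ^+ 2 - x ^+ 3 + x ^+ 4] = x ^+ 2 * (1 - x + x ^+ 2) by rewrite /=; ring.
    by rewrite mulf_neq0 // expf_neq0.
  by rewrite /= /p /q /s1 /s2 /z; field; rewrite ?x0 ?y0 ?oner_eq0.
(* The same for [l D] of [cubic_plane], multiplied by [(x y)^4]; the leading coefficient is
   [x^6]. *)
split=> //; apply: (fin 4 (horner_rec [:: x ^+ 2; - x - 3 * x ^+ 2 - 3 * x ^+ 3 - x ^+ 4; 1 - 3 * x + 21 * x ^+ 2 - 10 * x ^+ 3 + 21 * x ^+ 4 - 3 * x ^+ 5 + x ^+ 6; - 3 * x - 10 * x ^+ 2 - 15 * x ^+ 3 - 15 * x ^+ 4 - 10 * x ^+ 5 - 3 * x ^+ 6; - x + 21 * x ^+ 2 - 15 * x ^+ 3 + 60 * x ^+ 4 - 15 * x ^+ 5 + 21 * x ^+ 6 - x ^+ 7; - 3 * x ^+ 2 - 10 * x ^+ 3 - 15 * x ^+ 4 - 15 * x ^+ 5 - 10 * x ^+ 6 - 3 * x ^+ 7; x ^+ 2 - 3 * x ^+ 3 + 21 * x ^+ 4 - 10 * x ^+ 5 + 21 * x ^+ 6 - 3 * x ^+ 7 + x ^+ 8; - x ^+ 4 - 3 * x ^+ 5 - 3 * x ^+ 6 - x ^+ 7; x ^+ 6] y)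).
    apply: h; first by rewrite /=; all_in_subfield.
    by rewrite /= expf_neq0.
  by rewrite /= /p /q /s1 /s2 /z; field; rewrite ?x0 ?y0 ?oner_eq0.
Qed.

Lemma cyc_morph (g : {rmorphism F -> F}) : [/\ g p = g x + g y + g z - 3,
  g q = (g x)^-1 + (g y)^-1 + (g z)^-1 - 3,
  g r = g x ^+ 2 * g y + g y ^+ 2 * g z + g z ^+ 2 * g x - 3 &
  g r' = g x * g y ^+ 2 + g y * g z ^+ 2 + g z * g x ^+ 2 - 3].
Proof.
split; rewrite rmorphB rmorph_nat !rmorphD //; first by rewrite !fmorphV.
  by rewrite !(rmorphXn, rmorphM).
by rewrite !(rmorphXn, rmorphM).
Qed.

Lemma cyc_act g : g \in G ->
  [\/ [/\ act g p = p, act g q = q, act g r = r & act g r' = r'],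
      [/\ act g p = p, act g q = q, act g r = r' & act g r' = r],
      [/\ act g p = q, act g q = p, act g r = r' & act g r' = r] |
      [/\ act g p = q, act g q = p, act g r = r & act g r' = r']].
Proof.
move=> gG; have [x0 y0 z0 _] := hex_neq0; have [mp mq mr mr'] := cyc_morph (act g).
rewrite mp mq mr mr' /p /q /r /r' /s1 /s2; case: (hexG gG) => -> -> ->;
[constructor 1|constructor 1|constructor 1|constructor 2|constructor 2|constructor 2|
 constructor 3|constructor 3|constructor 3|constructor 4|constructor 4|constructor 4];
by split; rewrite /z; field; rewrite ?x0 ?y0 ?oner_eq0.
Qed.

(** [K(e, f)] is fixed by [h], and [x] is a root of a cubic over it whose roots [x], [y], [z] are
    reached by the powers of [h]; so [K(e, f)] contains all invariants. *)
Lemma hex_three_cycle h : h \in H -> act h x = y -> act h y = z -> rational_fixed act G K.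
Proof.
move=> hH hx hy; have [x0 y0 z0 _] := hex_neq0; have [xy yz xz] := hex_distinct.
have [hG hKa] := HK _ hH.
have hz : act h z = x by rewrite /z fmorphV rmorphM hx hy /z; field; rewrite ?x0 ?y0 ?oner_eq0.
have [p0 q0 D0 l0] := cyc_neq0; have sr := cyc_sum; have pr := cyc_prod.
have cact := cyc_act.
have [hp hq hr hr'] : [/\ act h p = p, act h q = q, act h r = r & act h r' = r'].
  have [-> -> -> ->] := cyc_morph (act h); rewrite hx hy hz.
  by split; rewrite /p /q /r /r' /s1 /s2; ring.
have s1E : s1 = p + 3 by rewrite subrK.
have s2E : s2 = q + 3 by rewrite subrK.
have yz_s2 : s2 = y * z + x * z + x * y by rewrite /s2 /z; field; rewrite ?x0 ?y0 ?oner_eq0.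
have xyz1 : x * y * z = 1 by rewrite /z mulfV ?mulf_neq0.
have s1D : s1 = x + y + z by [].
have rD : r = x ^+ 2 * y + y ^+ 2 * z + z ^+ 2 * x - 3 by [].
have {}l0 := l0; move: l0; rewrite -(cubic_plane sr D0) mulf_eq0 negb_or => /andP[l0 _].
have [pE qE rE] := cubic_generated K sr pr p0 q0 D0 l0.
have [he hf] := cubic_fixed hp hq hr hr'.
have aff g (gG : g \in G) := cubic_affine K sr pr D0 l0 (cact g gG).
move: he hf aff pE qE rE; set e := (p - q) / _; set f := (p - _) / _ => he hf aff pE qE rE.
clearbody e f p q r r' s1 s2.
set E := adj (adj K e) f in pE qE rE.
have KE : {subset K <= E} by move=> s sK; rewrite /E; in_subfield.
have s1E' : s1 \in E by rewrite s1E rpredD // rpred_nat.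
have s2E' : s2 \in E by rewrite s2E rpredD // rpred_nat.
have hE : forall s, s \in E -> act h s = s by apply: fix_adj hf; apply: fix_adj he.
apply: (affine_tower2 actG stabK tr_x tr_y (e := e) (f := f)).
- by move=> g /aff[].
- by move=> g /aff[].
move=> t tG; apply: (@fixed_in_base _ E x (('X - x%:P) * ('X - y%:P) * ('X - z%:P))
   [:: (@idfun F : {rmorphism F -> F}); act h; act (h * h)%g]).
- by rewrite !monicMl ?monicXsubC.
- have -> : ('X - x%:P) * ('X - y%:P) * ('X - z%:P) = 'X^3 - s1 *: 'X^2 + s2 *: 'X - 1.
    have one : 1 = (x * y * z)%:P by rewrite xyz1.
    by rewrite yz_s2 one s1D -!mul_polyC !polyCD !polyCM; ring.
  by rewrite rpredB ?rpred1 // rpredD ?rpredB ?polyOverXn ?polyOverZ ?polyOverXn ?polyOverX.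
- by rewrite !hornerE subrr !mul0r.
- by rewrite !size_Mmonic ?mulf_neq0 ?polyXsubC_eq0 ?monicMl ?monicXsubC // !size_XsubC.
- by case: actG => _ aM; rewrite /= aM // hx hy !inE !negb_or xy xz yz.
- case: actG => _ aM g /= hg.
  by case: hg => [<-|[<-|[<-|[]]]]; split=> [|s sE] //; rewrite ?aM // ?tG // !hE.
have xA : x \in adj E x := adj_gen E x.
apply: (adj_min (S' := adj E x) _ _ (full t)).
  by apply: adj_min => // s sK; apply/adj_base/KE.
have sub s : s \in E -> s \in adj E x by apply: adj_base.
(* As [y + z = s1 - x] and [y z = x^-1], the sum [r + 3] is linear in [y] over [E(x)], with this
   leading coefficient. *)
have den : x ^+ 2 + x^-1 - x * (s1 - x) = (x - y) * (x - z).
  by rewrite s1D /z; field; rewrite ?x0 ?y0 ?oner_eq0.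
have den0 : x ^+ 2 + x^-1 - x * (s1 - x) != 0.
  by rewrite den mulf_neq0 // subr_eq0.
have -> : y = (r + 3 - x * (s1 - x) ^+ 2 + 1) / (x ^+ 2 + x^-1 - x * (s1 - x)).
  apply: (mulIf den0); rewrite divfK // rD s1D /z; field; rewrite ?x0 ?y0 ?oner_eq0 //.
move: (sub _ rE) (sub _ s1E') xA; move: (adj E x) => A rA s1A xA; in_subfield.
Qed.
End ThreeCycle.
End Hexagonal.

(** * Projection of a quadric from a point over [K] *)

Section QuadricSurface.
Variables (F : fieldType) (K : divringClosed F) (b1 b2 b3 s s' u v w : F).
Hypothesis sum_s : s + s' = b1 + b2 + b3.
Hypothesis prod_s : s * s' = b1 * b2 + b2 * b3 + b3 * b1.
Hypothesis cayley : b1 * b2 * b3 =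
  b1 ^+ 2 + b2 ^+ 2 + b3 ^+ 2 - 2 * (b1 * b2 + b2 * b3 + b3 * b1).
Hypotheses (uK : u \in K) (vK : v \in K) (wK : w \in K) (uvw : u + v + w = 0).
Hypotheses (u0 : u != 0) (v0 : v != 0) (w0 : w != 0).
Hypotheses (b10 : b1 != 0) (b20 : b2 != 0) (b30 : b3 != 0).
Let s0 := u ^+ 2 + u * v + v ^+ 2.
(* The tangent plane of the quadric at its point [(u^2 : v^2 : w^2 : s0)] *)
Let l := v * w * b1 + u * w * b2 + u * v * b3.
Hypothesis l0 : l != 0.
Let e := (b1 / u ^+ 2 - b2 / v ^+ 2) / l.
Let f := (s - s0 * (b1 / u ^+ 2)) / l.
(** This is [(b3 / w^2 - b1 / u^2) / l]. Since [u + v + w = 0], the definition of [l] becomes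
    [u v w (w B - v e) = 1], which makes it affine in [e]. *)
Let B := ((u * v * w)^-1 + v * e) / w.
Let t := b1 / u ^+ 2 / l.

Lemma quadric_coords : [/\ b2 / v ^+ 2 / l = t - e, b3 / w ^+ 2 / l = t + B & s / l = f + s0 * t].
Proof.
rewrite /t /f /e /B /e; split; [by field; rewrite ?l0 ?u0 ?v0| |by field; rewrite ?l0 ?u0].
have e3 : b3 = (l - v * w * b1 - u * w * b2) / (u * v) by rewrite /l; field; rewrite ?u0 ?v0.
rewrite {1}e3; move: (l) l0 => l' l'0.
apply/eqP; rewrite -subr_eq0 -oppr_eq0; apply/eqP.
transitivity (b1 * (u + v + w) / (u ^+ 2 * w * l')); last by rewrite uvw mulr0 mul0r.
by field; rewrite ?l'0 ?u0 ?v0 ?w0.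
Qed.

(** On a line through the chosen point the equation of the quadric is linear in [t], and the
    coefficient of [t] is [u v w (w B - v e) = 1]. *)
Lemma quadric_param : t = f ^+ 2 + f * (v ^+ 2 * e - w ^+ 2 * B) - v ^+ 2 * w ^+ 2 * e * B.
Proof.
have [e2 e3 es] := quadric_coords.
have wE : w = - (u + v) by apply/eqP; rewrite -addr_eq0 addrC uvw.
have h1 : b1 / l = u ^+ 2 * t by rewrite /t; field; rewrite ?l0 ?u0.
have h2 : b2 / l = v ^+ 2 * (t - e) by rewrite -e2; field; rewrite ?l0 ?v0.
have h3 : b3 / l = w ^+ 2 * (t + B) by rewrite -e3; field; rewrite ?l0 ?w0.
have hs : s' / l = b1 / l + b2 / l + b3 / l - s / l by rewrite -!mulrDl -sum_s; field.
have BE : u * v * w * (w * B - v * e) = 1 by rewrite /B; field; rewrite ?u0 ?v0 ?w0.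
have q0 : (s / l) * (s' / l) = (b1 / l) * (b2 / l) + (b2 / l) * (b3 / l) + (b3 / l) * (b1 / l).
  have -> : (s / l) * (s' / l) = (s * s') / l ^+ 2 by field.
  by rewrite prod_s; field.
move: q0; rewrite hs es h1 h2 h3 => /eqP; rewrite -subr_eq0 => /eqP q0.
apply/eqP; rewrite -subr_eq0; apply/eqP; rewrite -[RHS]q0.
transitivity ((u * v * w * (w * B - v * e)) * t -
    (f ^+ 2 + f * (v ^+ 2 * e - w ^+ 2 * B) - v ^+ 2 * w ^+ 2 * e * B)).
  by rewrite BE mul1r.
by rewrite /s0; move: (t) (B) (e) (f) => t' B' e' f'; rewrite wE; ring.
Qed.
(** [K(e, f)] contains the ratios to [l]. The relation [cayley] equates forms of degrees 3 and 2, so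
    it determines [l] from them. *)
Lemma quadric_generated : [/\ b1 \in adj (adj K e) f, b2 \in adj (adj K e) f,
  b3 \in adj (adj K e) f & s \in adj (adj K e) f].
Proof.
have [e2 e3 es] := quadric_coords.
have h1 : b1 / l = u ^+ 2 * t by rewrite /t; field; rewrite ?l0 ?u0.
have h2 : b2 / l = v ^+ 2 * (t - e) by rewrite -e2; field; rewrite ?l0 ?v0.
have h3 : b3 / l = w ^+ 2 * (t + B) by rewrite -e3; field; rewrite ?l0 ?w0.
set E := adj (adj K e) f.
have eE : e \in E by apply/adj_base/adj_gen.
have fE : f \in E by apply: adj_gen.
have KE c : c \in K -> c \in E by move=> cK; apply/adj_base/adj_base.
have [uE vE wE] := And3 (KE _ uK) (KE _ vK) (KE _ wK).
have s0E : s0 \in E by rewrite /s0 !rpredD ?rpredX // rpredM.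
have axB (S : divringClosed F) (a b c d : F) : a \in S -> b \in S -> c \in S -> d \in S ->
  ((a * b * c)^-1 + b * d) / c \in S by move=> *; in_subfield.
have BE : B \in E by apply: axB.
have axt (S : divringClosed F) (a d b c m : F) : a \in S -> d \in S -> b \in S -> c \in S -> m \in S ->
  a ^+ 2 + a * (b ^+ 2 * d - c ^+ 2 * m) - b ^+ 2 * c ^+ 2 * d * m \in S.
  by move=> *; in_subfield.
have tE : t \in E by rewrite quadric_param; apply: axt.
have c1E : b1 / l \in E by rewrite h1 rpredM // rpredX.
have c2E : b2 / l \in E by rewrite h2 rpredM ?rpredX // rpredB.
have c3E : b3 / l \in E by rewrite h3 rpredM ?rpredX // rpredD.
have axl (S : divringClosed F) (a b c : F) : a \in S -> b \in S -> c \in S ->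
  (a ^+ 2 + b ^+ 2 + c ^+ 2 - 2 * (a * b + b * c + c * a)) / (a * b * c) \in S.
  by move=> *; in_subfield.
have lE : l \in E.
  have -> : l = ((b1 / l) ^+ 2 + (b2 / l) ^+ 2 + (b3 / l) ^+ 2 - 2 * (b1 / l * (b2 / l)
      + b2 / l * (b3 / l) + b3 / l * (b1 / l))) / (b1 / l * (b2 / l) * (b3 / l)).
    have -> : b1 / l * (b2 / l) * (b3 / l) = (b1 * b2 * b3) / l ^+ 3 by field.
    have c0 : b1 * b2 * b3 != 0 by rewrite !mulf_neq0.
    rewrite cayley in c0 *; move: (l) l0 => l' l'0.
    by field; rewrite c0 l'0.
  exact: axl.
have sE : s / l \in E by rewrite es rpredD // rpredM.
by split; [rewrite -(divfK l0 b1)|rewrite -(divfK l0 b2)|rewrite -(divfK l0 b3)|rewrite -(divfK l0 s)];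
  rewrite rpredM.
Qed.

(** The normalised coordinates [b1 / u^2], [b2 / v^2], [b3 / w^2] agree at the point, so each of
    them divided by [l] is [t] plus an affine function of [e]. Exchanging [s] with
    [s' = b1 + b2 + b3 - s] changes the sign of [f] up to a term in [K(e)]. *)
Lemma quadric_affine (g : {rmorphism F -> F}) : g l = l -> g s0 = s0 -> g s = s \/ g s = s' ->
  [\/ g (b1 / u ^+ 2) = b1 / u ^+ 2, g (b1 / u ^+ 2) = b2 / v ^+ 2 | g (b1 / u ^+ 2) = b3 / w ^+ 2] ->
  [\/ g (b2 / v ^+ 2) = b1 / u ^+ 2, g (b2 / v ^+ 2) = b2 / v ^+ 2 | g (b2 / v ^+ 2) = b3 / w ^+ 2] ->
  (exists a b, [/\ a \in K, b \in K & g e = a * e + b]) /\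
  (exists a b, [/\ a \in adj K e, b \in adj K e & g f = a * f + b]).
Proof.
move=> gl gs0 gs gb1 gb2; have [e2 e3 es] := quadric_coords.
have h1 : b1 / l = u ^+ 2 * t by rewrite /t; field; rewrite ?l0 ?u0.
have h2 : b2 / l = v ^+ 2 * (t - e) by rewrite -e2; field; rewrite ?l0 ?v0.
have h3 : b3 / l = w ^+ 2 * (t + B) by rewrite -e3; field; rewrite ?l0 ?w0.
have hs : s' / l = b1 / l + b2 / l + b3 / l - s / l by rewrite -!mulrDl -sum_s; field.
have wE : w = - (u + v) by apply/eqP; rewrite -addr_eq0 addrC uvw.
have aff j : [\/ j = b1 / u ^+ 2, j = b2 / v ^+ 2 | j = b3 / w ^+ 2] ->
    exists a b, [/\ a \in K, b \in K & j / l = t + (a * e + b)].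
  case=> ->.
  - by exists 0, 0; split; [exact: rpred0 | exact: rpred0 | rewrite mul0r !addr0].
  - by exists (-1), 0; split; [by rewrite rpredN rpred1 | exact: rpred0 | rewrite e2 mulN1r addr0].
  - exists (v / w), ((u * v * w)^-1 / w); split; [by in_subfield | by in_subfield |].
    by rewrite e3 /B; field; rewrite ?u0 ?v0 ?w0.
have [a1 [c1 [a1K c1K e1]]] : exists a b, [/\ a \in K, b \in K & g (b1 / u ^+ 2) / l = t + (a * e + b)].
  by apply: aff; case: gb1; [constructor 1|constructor 2|constructor 3].
have [a2 [c2 [a2K c2K e2']]] : exists a b, [/\ a \in K, b \in K & g (b2 / v ^+ 2) / l = t + (a * e + b)].
  by apply: aff; case: gb2; [constructor 1|constructor 2|constructor 3].
have ge : g e = (g (b1 / u ^+ 2) - g (b2 / v ^+ 2)) / l by rewrite fmorph_div rmorphB gl.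
have gf : g f = (g s - s0 * g (b1 / u ^+ 2)) / l by rewrite fmorph_div rmorphB (rmorphM g s0) gl gs0.
have s0K : s0 \in K by rewrite /s0 !rpredD ?rpredX // rpredM.
have eA : e \in adj K e by apply: adj_gen.
have KA c : c \in K -> c \in adj K e by apply: adj_base.
split.
  exists (a1 - a2), (c1 - c2); split; [exact: rpredB | exact: rpredB |].
  by rewrite ge mulrBl e1 e2'; ring.
case: gs => gs.
  exists 1, (- s0 * (a1 * e + c1)); split; first exact: rpred1.
    have ax (S : divringClosed F) (a b c d : F) : a \in S -> b \in S -> c \in S -> d \in S ->
      - a * (b * c + d) \in S by move=> *; in_subfield.
    by apply: ax => //; apply: KA.
  by rewrite gf gs mulrBl -mulrA e1 es; ring.
exists (-1), (w ^+ 2 * B - v ^+ 2 * e - s0 * (a1 * e + c1)); split; first by rewrite rpredN rpred1.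
  have BA : B \in adj K e by rewrite /B; move: (e) eA => e' e'A; in_subfield.
  have ax (S : divringClosed F) (a b c d m n i j : F) : a \in S -> b \in S -> c \in S -> d \in S ->
    m \in S -> n \in S -> i \in S -> j \in S ->
    a ^+ 2 * b - c ^+ 2 * d - m * (n * i + j) \in S by move=> *; in_subfield.
  by apply: ax => //; apply: KA.
rewrite gf gs mulrBl -mulrA e1 hs h1 h2 h3 es.
by move: (t) (B) (e) (f) => t' B' e' f'; rewrite /s0 wE; ring.
Qed.
End QuadricSurface.

(** * Three monomials: kernels without 3-cycle *)

Section HexagonalDescent.
Variables (gT : finGroupType) (F : fieldType) (act : gT -> {rmorphism F -> F}).
Variables (G H : {group gT}) (K : divringClosed F).
Hypothesis actG : acts_auto act G.
Hypothesis stabK : forall g s, g \in G -> s \in K -> act g s \in K.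
Hypothesis HK : forall g, reflect (g \in G /\ forall a, a \in K -> act g a = a) (g \in H).
Variables x y : F.
Hypothesis tr_x : ~ alg K x.
Hypothesis tr_y : ~ alg (adj K x) y.
Hypothesis full : forall z, z \in adj (adj K x) y.
Let z := (x * y)^-1.
Hypothesis hexG : forall g, g \in G -> hexagonal x y (act g).

Lemma trans_coef0 (S : divringClosed F) t (s : seq F) : ~ alg S t ->
  all (fun c => c \in S) s -> horner_rec s t = 0 -> forall i, s`_i = 0.
Proof.
move=> tS /allP sS s0 i; rewrite -coef_Poly (alg_root tS (p := Poly s)) ?coef0 //.
  apply/polyOverP => j; rewrite coef_Poly; have [h|h] := ltnP j (size s).
    by apply: sS; rewrite mem_nth.
  by rewrite nth_default ?rpred0.
by rewrite horner_Poly.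
Qed.

(** The constants make these five functions vanish at [x = y = z = 1], so that the relations
    [hex_sum] and [hex_prod] are homogeneous and define a quadric. *)
Let b1 := x + x^-1 - 2.
Let b2 := y + y^-1 - 2.
Let b3 := z + z^-1 - 2.
Let s := x + y + z - 3.
Let s' := x^-1 + y^-1 + z^-1 - 3.

Lemma hex_sum : s + s' = b1 + b2 + b3.
Proof. by rewrite /s /s' /b1 /b2 /b3; ring. Qed.

Lemma hex_prod : s * s' = b1 * b2 + b2 * b3 + b3 * b1.
Proof.
have [x0 y0 _ _] := hex_neq0 tr_x tr_y.
by rewrite /s /s' /b1 /b2 /b3 /z; field; rewrite ?x0 ?y0 ?oner_eq0.
Qed.

Lemma hex_cayley : b1 * b2 * b3 =
  b1 ^+ 2 + b2 ^+ 2 + b3 ^+ 2 - 2 * (b1 * b2 + b2 * b3 + b3 * b1).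
Proof.
have [x0 y0 _ _] := hex_neq0 tr_x tr_y.
by rewrite /b1 /b2 /b3 /z; field; rewrite ?x0 ?y0 ?oner_eq0.
Qed.

(** Times [x y] the relation is a polynomial in [y] over [K(x)]; its vanishing coefficients are in
    turn polynomials in [x] over [K]. *)
Lemma hex_indep_plus a b c : a \in K -> b \in K -> c \in K ->
  a * b1 + b * b2 + c * b3 = 0 -> [/\ a = 0, b = 0 & c = 0].
Proof.
move=> aK bK cK e; have [x0 y0 _ _] := hex_neq0 tr_x tr_y.
have e1 : horner_rec [:: b * x + c; a * (x - 1) ^+ 2 - 2 * (b + c) * x; b * x + c * x ^+ 2] y = 0.
  transitivity ((a * b1 + b * b2 + c * b3) * (x * y)); last by rewrite e mul0r.
  by rewrite /= /b1 /b2 /b3 /z; field; rewrite ?x0 ?y0 ?oner_eq0.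
have h1 := trans_coef0 tr_y _ e1.
have {}h1 : forall i, [:: b * x + c; a * (x - 1) ^+ 2 - 2 * (b + c) * x; b * x + c * x ^+ 2]`_i = 0.
  by apply: h1; rewrite /=; all_in_subfield.
have e2 : horner_rec [:: 0; b; c] x = 0 by rewrite -[RHS](h1 2) /=; ring.
have {}h2 : forall i, [:: 0; b; c]`_i = 0 by apply: (trans_coef0 tr_x _ e2); rewrite /=; all_in_subfield.
have b0 : b = 0 := h2 1%N; have c0 : c = 0 := h2 2.
have e3 : horner_rec [:: a; - 2 * a; a] x = 0 by rewrite -[RHS](h1 1%N) /= b0 c0; ring.
have {}h3 : forall i, [:: a; - 2 * a; a]`_i = 0 by apply: (trans_coef0 tr_x _ e3); rewrite /=; all_in_subfield.
by split=> //; apply: (h3 0).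
Qed.

Lemma hex_indep_minus a b c : a \in K -> b \in K -> c \in K ->
  a * (x - x^-1) + b * (y - y^-1) + c * (z - z^-1) = 0 -> [/\ a = 0, b = 0 & c = 0].
Proof.
move=> aK bK cK e; have [x0 y0 _ _] := hex_neq0 tr_x tr_y.
have e1 : horner_rec [:: - b * x + c; a * (x ^+ 2 - 1); b * x - c * x ^+ 2] y = 0.
  transitivity ((a * (x - x^-1) + b * (y - y^-1) + c * (z - z^-1)) * (x * y)); last by rewrite e mul0r.
  by rewrite /= /z; field; rewrite ?x0 ?y0 ?oner_eq0.
have h1 : forall i, [:: - b * x + c; a * (x ^+ 2 - 1); b * x - c * x ^+ 2]`_i = 0.
  by apply: (trans_coef0 tr_y _ e1); rewrite /=; all_in_subfield.
have e2 : horner_rec [:: 0; b; - c] x = 0 by rewrite -[RHS](h1 2) /=; ring.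
have {}h2 : forall i, [:: 0; b; - c]`_i = 0 by apply: (trans_coef0 tr_x _ e2); rewrite /=; all_in_subfield.
have b0 : b = 0 := h2 1%N; have c0 : c = 0 by rewrite -[c]opprK [- c](h2 2) oppr0.
have e3 : horner_rec [:: - a; 0; a] x = 0 by rewrite -[RHS](h1 1%N) /= ; ring.
have {}h3 : forall i, [:: - a; 0; a]`_i = 0 by apply: (trans_coef0 tr_x _ e3); rewrite /=; all_in_subfield.
by split=> //; apply: (h3 2).
Qed.

Lemma hex_b_neq0 : [/\ b1 != 0, b2 != 0 & b3 != 0].
Proof.
have k0 : 0 \in K := rpred0 K; have k1 : 1 \in K := rpred1 K.
split; apply/eqP => b0.
- have [] := hex_indep_plus k1 k0 k0; first by rewrite b0; ring.
  by move/eqP; rewrite oner_eq0.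
- have [] := hex_indep_plus k0 k1 k0; first by rewrite b0; ring.
  by move=> _ /eqP; rewrite oner_eq0.
- have [] := hex_indep_plus k0 k0 k1; first by rewrite b0; ring.
  by move=> _ _ /eqP; rewrite oner_eq0.
Qed.

Lemma hex_x2 : x - x^-1 != 0.
Proof.
have k0 : 0 \in K := rpred0 K; have k1 : 1 \in K := rpred1 K.
apply/eqP => b0; have [] := hex_indep_minus k1 k0 k0; first by rewrite b0; ring.
by move/eqP; rewrite oner_eq0.
Qed.

(* [x] satisfies a quadratic equation over a field containing the [b_i],
   and then [y] is obtained from two linear equations in [y] and [y^-1]. *)
Lemma hex_generated (S : divringClosed F) : {subset K <= S} -> x \in S ->
  b1 \in S -> b2 \in S -> b3 \in S -> forall t, t \in S.
Proof.
move=> KS xS b1S b2S b3S t; have [x0 y0 _ _] := hex_neq0 tr_x tr_y; have x2 := hex_x2.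
apply: (adj_min (S' := S) _ _ (full t)); first exact: adj_min.
have -> : y = (b3 + 2 - x^-1 * (b2 + 2)) / (x - x^-1).
  apply: (mulIf x2); rewrite divfK // /b2 /b3 /z; field; rewrite ?x0 ?y0 ?oner_eq0 //.
by move: (b2) (b3) b2S b3S => b b' bS b'S; in_subfield.
Qed.

Lemma hex_act g : g \in G ->
  [/\ [\/ [/\ act g b1 = b1, act g b2 = b2 & act g b3 = b3], [/\ act g b1 = b2, act g b2 = b3 & act g b3 = b1]
    | [/\ act g b1 = b3, act g b2 = b1 & act g b3 = b2]] \/
    [\/ [/\ act g b1 = b2, act g b2 = b1 & act g b3 = b3], [/\ act g b1 = b1, act g b2 = b3 & act g b3 = b2]
    | [/\ act g b1 = b3, act g b2 = b2 & act g b3 = b1]] &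
   act g s = s \/ act g s = s'].
Proof.
have mb t : act g (t + t^-1 - 2) = act g t + (act g t)^-1 - 2.
  by rewrite rmorphB rmorph_nat rmorphD fmorphV.
have ms : act g s = act g x + act g y + act g z - 3 by rewrite rmorphB rmorph_nat !rmorphD.
have iv t : t^-1 + t^-1^-1 - 2 = t + t^-1 - 2 :> F by rewrite invrK [t^-1 + t]addrC.
move/hexG; have xyE : x * y = z^-1 by rewrite invrK.
rewrite ms !mb => -[] -> -> ->; rewrite ?iv -?/z ?xyE ?[z^-1 + z]addrC; split;
rewrite /s /s'; try by [left; constructor 1|left; constructor 2|left; constructor 3
  |right; constructor 1|right; constructor 2|right; constructor 3].
all: try by [left; ring | right; ring].
Qed.
Let W t := exists a b c, [/\ a \in K, b \in K, c \in K & t = a * b1 + b * b2 + c * b3].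

Lemma hex_subspace_line v : subspace K (fun t => exists2 c, c \in K & t = c * v).
Proof.
split=> [|_ _ [b bK ->] [c cK ->]|c _ cK [b bK ->]].
- by exists 0; rewrite ?rpred0 ?mul0r.
- by exists (b + c); rewrite ?rpredD ?mulrDl.
- by exists (c * b); rewrite ?rpredM ?mulrA.
Qed.

Lemma hex_subspace_span u v w : subspace K
  (fun t => exists a b c, [/\ a \in K, b \in K, c \in K & t = a * u + b * v + c * w]).
Proof.
split=> [|_ _ [a [b [c [aK bK cK ->]]]] [a' [b' [c' [aK' bK' cK' ->]]]]|d _ dK [a [b [c [aK bK cK ->]]]]].
- by exists 0, 0, 0; rewrite rpred0; split=> //; ring.
- by exists (a + a'), (b + b'), (c + c'); rewrite !rpredD //; split=> //; ring.
- by exists (d * a), (d * b), (d * c); rewrite !rpredM //; split=> //; ring.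
Qed.

(** Here [u], [v], [w] are the [b_i] in some order. The ratios [u / l], [v / l], [w / l] have sum 1
    and satisfy a second linear equation with right-hand side [e], so they lie on a line over
    [K(e)], on which [f] is a coordinate because [B] and [C] differ. Then [cay] recovers [l], and
    [x] is quadratic over [K(e, f)] with conjugate [x^-1] under [h]. *)
Lemma hex_line u v w A B C h : h \in H -> act h x = x^-1 -> act h y = y^-1 ->
  (forall g, g \in G -> [\/ act g u = u, act g u = v | act g u = w]) ->
  (forall g, g \in G -> act g (u + v + w) = u + v + w) ->
  A \in K -> B \in K -> C \in K -> B != C ->
  (forall g, g \in G -> act g (A * u + B * v + C * w) = A * u + B * v + C * w) ->
  [/\ u != 0, v != 0, w != 0 & u + v + w != 0] ->
  u * v * w = u ^+ 2 + v ^+ 2 + w ^+ 2 - 2 * (u * v + v * w + w * u) ->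
  (forall b, b \in [:: b1; b2; b3] -> b \in [:: u; v; w]) ->
  act h u = u -> rational_fixed act G K.
Proof.
move=> hH hx hy gu gl AK BK CK BC fixT [u0 v0 w0 l0] cay bs hu.
have [x0 y0 _ _] := hex_neq0 tr_x tr_y.
have [hG hKa] := HK _ hH; have bc : B - C != 0 by rewrite subr_eq0.
move: gl fixT l0; set l := u + v + w; set T := A * u + B * v + C * w => gl fixT l0.
pose e := T / l; pose f := u / l.
have ve : v / l = (e - A * f - C * (1 - f)) / (B - C).
  rewrite /e /f /T; have -> : 1 = (u + v + w) / l by rewrite divff.
  by move: (l) l0 => l' l'0; field; rewrite ?l'0 ?bc.
have we : w / l = 1 - f - v / l by rewrite /f -(divff l0) -!mulrBl; congr (_ / _); rewrite /l; ring.
have ge g : g \in G -> act g e = e by move=> gG; rewrite /e fmorph_div fixT ?gl.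
have gf g : g \in G -> act g f = act g u / l by move=> gG; rewrite /f fmorph_div gl.
set E := adj (adj K e) f.
have KE c : c \in K -> c \in E by move=> cK; apply/adj_base/adj_base.
have eE : e \in E by apply/adj_base/adj_gen.
have fE : f \in E by apply: adj_gen.
have vE : v / l \in E.
  have ax (S : divringClosed F) (a b c d i : F) : a \in S -> b \in S -> c \in S -> d \in S -> i \in S ->
    (a - b * i - d * (1 - i)) / (c - d) \in S by move=> *; in_subfield.
  by rewrite ve; apply: ax => //; apply: KE.
have wE : w / l \in E by rewrite we !rpredB // rpred1.
have lE : l \in E.
  have -> : l = (f ^+ 2 + (v / l) ^+ 2 + (w / l) ^+ 2 - 2 * (f * (v / l)
      + v / l * (w / l) + w / l * f)) / (f * (v / l) * (w / l)).
    rewrite /f; have -> : u / l * (v / l) * (w / l) = (u * v * w) / l ^+ 3 by field.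
    have c0 : u * v * w != 0 by rewrite !mulf_neq0.
    rewrite cay in c0 *; move: (l) l0 => l' l'0.
    by field; rewrite c0 l'0.
  have ax (S : divringClosed F) (a b c : F) : a \in S -> b \in S -> c \in S ->
    (a ^+ 2 + b ^+ 2 + c ^+ 2 - 2 * (a * b + b * c + c * a)) / (a * b * c) \in S.
    by move=> *; in_subfield.
  exact: ax.
have bE b : b \in [:: b1; b2; b3] -> b \in E.
  by move=> /bs; rewrite !inE => /or3P[]/eqP->;
    [rewrite -(divfK l0 u) | rewrite -(divfK l0 v) | rewrite -(divfK l0 w)]; rewrite rpredM.
have b1E : b1 \in E by apply: bE; rewrite !inE eqxx.
have b2E : b2 \in E by apply: bE; rewrite !inE eqxx orbT.
have b3E : b3 \in E by apply: bE; rewrite !inE eqxx !orbT.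
have k0 (S : divringClosed F) : 0 \in S := rpred0 S; have k1 (S : divringClosed F) : 1 \in S := rpred1 S.
apply: (affine_tower2 actG stabK tr_x tr_y (e := e) (f := f)).
- by move=> g gG; exists 1, 0; rewrite ge // mul1r addr0.
- have eA : e \in adj K e := adj_gen K e.
  have KA c : c \in K -> c \in adj K e by apply: adj_base.
  have [AA BA CA] := And3 (KA _ AK) (KA _ BK) (KA _ CK).
  move=> g gG; rewrite gf //; case: (gu g gG) => ->.
  + by exists 1, 0; rewrite mul1r addr0.
  + exists ((C - A) / (B - C)), ((e - C) / (B - C)); split.
    * by in_subfield.
    * by in_subfield.
    by rewrite ve; field; rewrite ?bc.
  + exists (- 1 - (C - A) / (B - C)), (1 - (e - C) / (B - C)); split.
    * by in_subfield.
    * by in_subfield.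
    by rewrite we ve; field; rewrite ?bc.
move=> t tG; have hE : forall c, c \in E -> act h c = c.
  apply: fix_adj; last by rewrite gf // hu.
  by apply: fix_adj => //; apply: ge.
apply: (@fixed_quadratic _ E (act h) x) => //.
- by rewrite hx eq_sym -subr_eq0 hex_x2.
- by rewrite hx -[x + _](subrK 2) rpredD // rpred_nat.
- by rewrite hx divff.
- apply: hex_generated.
  + by move=> c cK; apply/adj_base/KE.
  + exact: adj_gen.
  + exact: adj_base.
  + exact: adj_base.
  + exact: adj_base.
- exact: tG.
Qed.

(** The invariant form from [fixed_outside] is not a multiple of [b1 + b2 + b3], so two of its
    coefficients differ, as [hex_line] requires. *)
Lemma hex_inversion h : h \in H -> act h x = x^-1 -> act h y = y^-1 ->
  (forall g, g \in H -> act g x = x \/ act g x = x^-1) -> rational_fixed act G K.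
Proof.
move=> hH hx hy Hx; have [x0 y0 _ _] := hex_neq0 tr_x tr_y.
have k0 : 0 \in K := rpred0 K; have k1 : 1 \in K := rpred1 K.
have hb1 g : g \in H -> act g b1 = b1.
  by move=> /Hx gx; rewrite rmorphB rmorph_nat rmorphD fmorphV; case: gx => ->; rewrite // invrK [_^-1 + x]addrC.
have [||||T [[A [B [C [AK BK CK TE]]]] nT TG]] := @fixed_outside _ _ act G H K actG stabK HK _ _ b1
    (hex_subspace_line (b1 + b2 + b3)) (hex_subspace_span b1 b2 b3).
- move=> g _ gG [a [b [c [aK bK cK ->]]]]; rewrite !rmorphD !(rmorphM (act g)).
  have [aK' bK' cK'] := And3 (stabK gG aK) (stabK gG bK) (stabK gG cK).
  have [[][] [-> -> ->] _] := hex_act gG.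
  + by exists (act g a), (act g b), (act g c); split=> //; ring.
  + by exists (act g c), (act g a), (act g b); split=> //; ring.
  + by exists (act g b), (act g c), (act g a); split=> //; ring.
  + by exists (act g b), (act g a), (act g c); split=> //; ring.
  + by exists (act g a), (act g c), (act g b); split=> //; ring.
  + by exists (act g c), (act g b), (act g a); split=> //; ring.
- exact: hb1.
- by exists 1, 0, 0; split=> //; ring.
- move=> [c cK e].
  have [] := @hex_indep_plus (1 - c) (- c) (- c); rewrite ?rpredB ?rpredN //.
    by transitivity (b1 - c * (b1 + b2 + b3)); [ring | rewrite -e subrr].
  move=> /eqP; rewrite subr_eq0 => /eqP <- /eqP; by rewrite oppr_eq0 oner_eq0.
rewrite {}TE in nT TG.
have lG g : g \in G -> act g (b1 + b2 + b3) = b1 + b2 + b3.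
  move=> /hex_act[[][] [e1 e2 e3] _];
  rewrite (rmorphD _ (b1 + b2)) (rmorphD _ b1) e1 e2 e3; ring.
have l0 : b1 + b2 + b3 != 0.
  apply/eqP => e; have [] := @hex_indep_plus 1 1 1 k1 k1 k1; first by rewrite -e; ring.
  by move/eqP; rewrite oner_eq0.
have [b10 b20 b30] := hex_b_neq0.
(* If [B = C], then [A] differs from [C], and exchanging [b1] with [b2] restores the hypothesis of
   [hex_line]. *)
have [BC|BC] := eqVneq B C; last first.
  apply: (hex_line hH hx hy (u := b1) (v := b2) (w := b3) _ lG AK BK CK BC TG _ hex_cayley) => //.
  - by move=> g /hex_act[[][] [e1 e2 e3] _]; rewrite e1; by [constructor 1|constructor 2|constructor 3].
  - exact: hb1.
have neAC : A != C.
  apply/eqP => neAC; apply: nT; exists C => //; rewrite neAC BC; ring.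
have swp : b2 + b1 + b3 = b1 + b2 + b3 by rewrite [b2 + b1]addrC.
have hb2 : act h b2 = b2.
  by rewrite rmorphB rmorph_nat rmorphD fmorphV hy invrK [_^-1 + y]addrC.
apply: (hex_line hH hx hy (u := b2) (v := b1) (w := b3) (A := B) (B := A) (C := C)) => //.
- by move=> g /hex_act[[][] [e1 e2 e3] _]; rewrite e2; by [constructor 1|constructor 2|constructor 3].
- by move=> g gG; rewrite swp lG.
- by move=> g gG; rewrite [B * b2 + A * b1]addrC TG.
- by rewrite swp.
- by rewrite [b2 * b1]mulrC hex_cayley; ring.
- by move=> b; rewrite !inE orbCA.
Qed.
(** The coefficients of an invariant form in [x - x^-1], [y - y^-1], [z - z^-1] are permuted by [G]
    like the [b_i], up to the common sign with which [G] acts on these differences. They are not all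
    equal, as the form is chosen outside the multiples of the sum. *)
Lemma hex_twisted : (forall h, h \in H -> h = 1%g) -> exists A B C,
  [/\ A \in K, B \in K, C \in K, ~ [/\ A = B & B = C] &
   forall g, g \in G -> exists2 c, c = 1 \/ c = -1 &
     [\/ [/\ [/\ act g b1 = b1, act g b2 = b2 & act g b3 = b3] &
             [/\ act g A = c * A, act g B = c * B & act g C = c * C]],
         [/\ [/\ act g b1 = b2, act g b2 = b3 & act g b3 = b1] &
             [/\ act g A = c * B, act g B = c * C & act g C = c * A]] |
         [/\ [/\ act g b1 = b3, act g b2 = b1 & act g b3 = b2] &
             [/\ act g A = c * C, act g B = c * A & act g C = c * B]]] \/
     [\/ [/\ [/\ act g b1 = b2, act g b2 = b1 & act g b3 = b3] &
             [/\ act g A = c * B, act g B = c * A & act g C = c * C]],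
         [/\ [/\ act g b1 = b1, act g b2 = b3 & act g b3 = b2] &
             [/\ act g A = c * A, act g B = c * C & act g C = c * B]] |
         [/\ [/\ act g b1 = b3, act g b2 = b2 & act g b3 = b1] &
             [/\ act g A = c * C, act g B = c * B & act g C = c * A]]]].
Proof.
move=> H1; have [k0 k1] : 0 \in K /\ 1 \in K by rewrite rpred0 rpred1.
pose d1 := x - x^-1; pose d2 := y - y^-1; pose d3 := z - z^-1.
have md g t : act g (t - t^-1) = act g t - (act g t)^-1 by rewrite rmorphB fmorphV.
have iv (t : F) : t^-1 - t^-1^-1 = - (t - t^-1) by rewrite invrK opprB.
have gd g : g \in G -> exists2 c, c = 1 \/ c = -1 &
     [\/ [/\ [/\ act g b1 = b1, act g b2 = b2 & act g b3 = b3] &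
             [/\ act g d1 = c * d1, act g d2 = c * d2 & act g d3 = c * d3]],
         [/\ [/\ act g b1 = b2, act g b2 = b3 & act g b3 = b1] &
             [/\ act g d1 = c * d2, act g d2 = c * d3 & act g d3 = c * d1]] |
         [/\ [/\ act g b1 = b3, act g b2 = b1 & act g b3 = b2] &
             [/\ act g d1 = c * d3, act g d2 = c * d1 & act g d3 = c * d2]]] \/
     [\/ [/\ [/\ act g b1 = b2, act g b2 = b1 & act g b3 = b3] &
             [/\ act g d1 = c * d2, act g d2 = c * d1 & act g d3 = c * d3]],
         [/\ [/\ act g b1 = b1, act g b2 = b3 & act g b3 = b2] &
             [/\ act g d1 = c * d1, act g d2 = c * d3 & act g d3 = c * d2]] |
         [/\ [/\ act g b1 = b3, act g b2 = b2 & act g b3 = b1] &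
             [/\ act g d1 = c * d3, act g d2 = c * d2 & act g d3 = c * d1]]].
  have mb t : act g (t + t^-1 - 2) = act g t + (act g t)^-1 - 2.
    by rewrite rmorphB rmorph_nat rmorphD fmorphV.
  have ib t : t^-1 + t^-1^-1 - 2 = t + t^-1 - 2 :> F by rewrite invrK [t^-1 + t]addrC.
  have iz : z^-1 + z^-1^-1 - 2 = b3 by rewrite ib.
  have jz : z^-1 - z^-1^-1 = - d3 by rewrite iv.
  move/hexG; rewrite !mb !md -/z => -[] -> -> ->; rewrite ?iz ?jz ?(ib x) ?(ib y) ?(iv x) ?(iv y);
  [exists 1|exists 1|exists 1|exists 1|exists 1|exists 1|exists (-1)|exists (-1)|exists (-1)|exists (-1)|exists (-1)|exists (-1)];
  try (by auto); rewrite ?mul1r ?mulN1r;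
  by [left; constructor 1|left; constructor 2|left; constructor 3
     |right; constructor 1|right; constructor 2|right; constructor 3].
have [||||T [[A [B [C [AK BK CK TE]]]] nT TG]] := @fixed_outside _ _ act G H K actG stabK HK _ _ d1
    (hex_subspace_line (d1 + d2 + d3)) (hex_subspace_span d1 d2 d3).
- move=> g _ gG [a [b [c [aK bK cK ->]]]].
  rewrite (rmorphD _ (a * d1 + b * d2)) (rmorphD _ (a * d1)) !(rmorphM (act g)).
  have [aK' bK' cK'] := And3 (stabK gG aK) (stabK gG bK) (stabK gG cK).
  have [e e1 h] := gd g gG.
  have eK : e \in K by case: e1 => ->; rewrite ?rpredN.
  case: h => -[] [_ [-> -> ->]].
  + by exists (act g a * e), (act g b * e), (act g c * e); rewrite !rpredM //; split=> //; ring.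
  + by exists (act g c * e), (act g a * e), (act g b * e); rewrite !rpredM //; split=> //; ring.
  + by exists (act g b * e), (act g c * e), (act g a * e); rewrite !rpredM //; split=> //; ring.
  + by exists (act g b * e), (act g a * e), (act g c * e); rewrite !rpredM //; split=> //; ring.
  + by exists (act g a * e), (act g c * e), (act g b * e); rewrite !rpredM //; split=> //; ring.
  + by exists (act g c * e), (act g b * e), (act g a * e); rewrite !rpredM //; split=> //; ring.
- by move=> h /H1 ->; case: actG.
- by exists 1, 0, 0; split=> //; ring.
- move=> [c cK e].
  have [] := @hex_indep_minus (1 - c) (- c) (- c); rewrite ?rpredB ?rpredN //.
    by transitivity (d1 - c * (d1 + d2 + d3)); [rewrite /d1 /d2 /d3; ring | rewrite -e subrr].
  move=> /eqP; rewrite subr_eq0 => /eqP <- /eqP; by rewrite oppr_eq0 oner_eq0.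
exists A, B, C; split=> //.
  by move=> [AB BC]; apply: nT; exists C => //; rewrite TE AB BC; ring.
have ind a b c : a \in K -> b \in K -> c \in K ->
    a * d1 + b * d2 + c * d3 = T -> [/\ a = A, b = B & c = C].
  move=> aK bK cK e; have [||||/eqP ea /eqP eb /eqP ec] := @hex_indep_minus (a - A) (b - B) (c - C).
  - exact: rpredB.
  - exact: rpredB.
  - exact: rpredB.
  - by transitivity (T - T); [rewrite -{1}e TE /d1 /d2 /d3; ring | rewrite subrr].
  by move: ea eb ec; rewrite !subr_eq0 => /eqP-> /eqP-> /eqP.
move=> g gG; have [e e1 h] := gd g gG; exists e => //.
have ee : e * e = 1 by case: e1 => ->; ring.
have eK : e \in K by case: e1 => ->; rewrite ?rpredN.
have [aK' bK' cK'] := And3 (stabK gG AK) (stabK gG BK) (stabK gG CK).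
have := TG g gG; rewrite {1}TE.
rewrite (rmorphD _ (A * d1 + B * d2)) (rmorphD _ (A * d1)) !(rmorphM (act g)).
have sol a b : a * e = b -> a = e * b by move=> <-; rewrite mulrCA ee mulr1.
case: h => -[] [hb [-> -> ->]] e0.
- have [||||/sol h1 /sol h2 /sol h3] := ind (act g A * e) (act g B * e) (act g C * e); try exact: rpredM.
    by rewrite -e0; ring.
  by left; constructor 1.
- have [||||/sol h1 /sol h2 /sol h3] := ind (act g C * e) (act g A * e) (act g B * e); try exact: rpredM.
    by rewrite -e0; ring.
  by left; constructor 2.
- have [||||/sol h1 /sol h2 /sol h3] := ind (act g B * e) (act g C * e) (act g A * e); try exact: rpredM.
    by rewrite -e0; ring.
  by left; constructor 3.
- have [||||/sol h1 /sol h2 /sol h3] := ind (act g B * e) (act g A * e) (act g C * e); try exact: rpredM.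
    by rewrite -e0; ring.
  by right; constructor 1.
- have [||||/sol h1 /sol h2 /sol h3] := ind (act g A * e) (act g C * e) (act g B * e); try exact: rpredM.
    by rewrite -e0; ring.
  by right; constructor 2.
- have [||||/sol h1 /sol h2 /sol h3] := ind (act g C * e) (act g B * e) (act g A * e); try exact: rpredM.
    by rewrite -e0; ring.
  by right; constructor 3.
Qed.

(** The differences [u], [v], [w] of the coefficients have sum 0 and are permuted up to a common
    sign, so [(u^2 : v^2 : w^2 : s0)] is a point of the quadric that moves along with the
    coordinates. *)
Lemma hex_faithful c : (forall h, h \in H -> h = 1%g) -> c \in G ->
  act c x = y -> act c y = z -> rational_fixed act G K.
Proof.
move=> H1 cG cx cy; have [A [B [C [AK BK CK neABC gABC]]]] := hex_twisted H1.
have [b10 b20 b30] := hex_b_neq0.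
have mb t : act c (t + t^-1 - 2) = act c t + (act c t)^-1 - 2.
  by rewrite rmorphB rmorph_nat rmorphD fmorphV.
have cz : act c z = x.
  have [x0 y0 _ _] := hex_neq0 tr_x tr_y.
  by rewrite /z fmorphV rmorphM cx cy /z; field; rewrite ?x0 ?y0 ?oner_eq0.
pose u := B - C; pose v := C - A; pose w := A - B.
have [uK vK wK] : [/\ u \in K, v \in K & w \in K] by rewrite !rpredB.
have uvw : u + v + w = 0 by rewrite /u /v /w; ring.
pose s0 := u ^+ 2 + u * v + v ^+ 2.
have gu g : g \in G -> exists2 d, d = 1 \/ d = -1 &
  [\/ [/\ [/\ act g b1 = b1, act g b2 = b2 & act g b3 = b3] &
          [/\ act g u = d * u, act g v = d * v & act g w = d * w]],
      [/\ [/\ act g b1 = b2, act g b2 = b3 & act g b3 = b1] &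
          [/\ act g u = d * v, act g v = d * w & act g w = d * u]] |
      [/\ [/\ act g b1 = b3, act g b2 = b1 & act g b3 = b2] &
          [/\ act g u = d * w, act g v = d * u & act g w = d * v]]] \/
  [\/ [/\ [/\ act g b1 = b2, act g b2 = b1 & act g b3 = b3] &
          [/\ act g u = d * v, act g v = d * u & act g w = d * w]],
      [/\ [/\ act g b1 = b1, act g b2 = b3 & act g b3 = b2] &
          [/\ act g u = d * u, act g v = d * w & act g w = d * v]] |
      [/\ [/\ act g b1 = b3, act g b2 = b2 & act g b3 = b1] &
          [/\ act g u = d * w, act g v = d * v & act g w = d * u]]].
  move=> /gABC[d d1 h]; case: h => -[] [hb [hA hB hC]].
  + exists d => //; left; constructor 1; split=> //.
    by rewrite !(rmorphB (act g)) hA hB hC /u /v /w; split; ring.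
  + exists d => //; left; constructor 2; split=> //.
    by rewrite !(rmorphB (act g)) hA hB hC /u /v /w; split; ring.
  + exists d => //; left; constructor 3; split=> //.
    by rewrite !(rmorphB (act g)) hA hB hC /u /v /w; split; ring.
  + exists (- d); first by case: d1 => ->; rewrite ?opprK; auto.
    right; constructor 1; split=> //.
    by rewrite !(rmorphB (act g)) hA hB hC /u /v /w; split; ring.
  + exists (- d); first by case: d1 => ->; rewrite ?opprK; auto.
    right; constructor 2; split=> //.
    by rewrite !(rmorphB (act g)) hA hB hC /u /v /w; split; ring.
  + exists (- d); first by case: d1 => ->; rewrite ?opprK; auto.
    right; constructor 3; split=> //.
    by rewrite !(rmorphB (act g)) hA hB hC /u /v /w; split; ring.
(* The 3-cycle carries each difference to the next one up to sign, so a zero among them would force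
   [A = B = C]. *)
have [cu cv cw] : [/\ u = 0 -> v = 0, v = 0 -> w = 0 & w = 0 -> u = 0].
  have [k0 k1] : 0 \in K /\ 1 \in K by rewrite rpred0 rpred1.
  have k2 : -1 \in K by rewrite rpredN.
  have [n12 n13] : b1 <> b2 /\ b1 <> b3.
    split=> e; [have [] := hex_indep_plus k1 k2 k0|have [] := hex_indep_plus k1 k0 k2];
    try (by rewrite e; ring); by move/eqP; rewrite oner_eq0.
  have n23 : b2 <> b3.
    move=> e; have [] := hex_indep_plus k0 k1 k2; first by rewrite e; ring.
    by move=> _ /eqP; rewrite oner_eq0.
  have hb1 : act c b1 = b2 by rewrite mb cx.
  have hb2 : act c b2 = b3 by rewrite mb cy.
  have [d d1 h] := gu c cG.
  have d0 : d != 0 by case: d1 => ->; rewrite ?oppr_eq0 oner_eq0.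
  have [e1 e2 e3] : [/\ act c u = d * v, act c v = d * w & act c w = d * u].
    by case: h => -[] [[]]; rewrite hb1 hb2 => E1 E2 E3 []; try (by split);
      first [case: n12; congruence | case: n13; congruence | case: n23; congruence].
  split=> e; [move: e1|move: e2|move: e3]; rewrite e rmorph0 => /esym/eqP;
  by rewrite mulf_eq0 (negPf d0) => /eqP.
have [u0 v0 w0] : [/\ u != 0, v != 0 & w != 0].
  split; apply/eqP => e; apply: neABC; rewrite /u /v /w in cu cv cw e.
  - have /eqP := cv (cu e); have /eqP := e; rewrite !subr_eq0 => /eqP-> /eqP; done.
  - have /eqP := cv e; have /eqP := cw (cv e); rewrite !subr_eq0 => /eqP-> /eqP; done.
  - have /eqP := cw e; have /eqP := e; rewrite !subr_eq0 => /eqP-> /eqP; done.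
have s0E : s0 = v ^+ 2 + v * w + w ^+ 2 /\ s0 = w ^+ 2 + w * u + u ^+ 2.
  by rewrite /s0 /u /v /w; split; ring.
pose l := v * w * b1 + u * w * b2 + u * v * b3.
have l0 : l != 0.
  have [k1 k2 k3] : [/\ v * w \in K, u * w \in K & u * v \in K] by rewrite !rpredM.
  apply/eqP => l0; have [/eqP] := hex_indep_plus k1 k2 k3 l0.
  by rewrite mulf_eq0 (negPf v0) (negPf w0).
have gl g : g \in G -> act g l = l.
  move=> /gu[d d1 h]; rewrite /l (rmorphD _ (v * w * b1 + _)) (rmorphD _ (v * w * b1)).
  rewrite !(rmorphM (act g)); have dd : d * d = 1 by case: d1 => ->; ring.
  case: h => -[] [[-> -> ->] [-> -> ->]]; rewrite -[RHS]mul1r -dd; ring.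
have gs0 g : g \in G -> act g s0 = s0.
  have [s01 s02] := s0E.
  move=> /gu[d d1 h]; have dd : d ^+ 2 = 1 by case: d1 => ->; ring.
  have -> : act g s0 = act g u ^+ 2 + act g u * act g v + act g v ^+ 2.
    rewrite /s0 (rmorphD (act g) (u ^+ 2 + u * v)) (rmorphD (act g) (u ^+ 2)).
    by rewrite (rmorphM (act g) u v) !rmorphXn.
  case: h => -[] [_ [-> -> _]]; rewrite -[RHS]mul1r -dd ?exprMn;
   [rewrite /s0|rewrite s01|rewrite s02|rewrite /s0|rewrite s02|rewrite s01]; ring.
have gb g : g \in G ->
  [\/ act g (b1 / u ^+ 2) = b1 / u ^+ 2, act g (b1 / u ^+ 2) = b2 / v ^+ 2 | act g (b1 / u ^+ 2) = b3 / w ^+ 2] /\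
  [\/ act g (b2 / v ^+ 2) = b1 / u ^+ 2, act g (b2 / v ^+ 2) = b2 / v ^+ 2 | act g (b2 / v ^+ 2) = b3 / w ^+ 2].
  move=> /gu[d d1 h]; have dd : d ^+ 2 = 1 by case: d1 => ->; ring.
  rewrite !fmorph_div !rmorphXn; case: h => -[] [[-> -> _] [-> -> _]]; rewrite !exprMn dd !mul1r; split;
  by [constructor 1|constructor 2|constructor 3].
have aff g (gG : g \in G) := quadric_affine hex_sum uK vK wK uvw u0 v0 w0 l0 (gl g gG) (gs0 g gG)
  (hex_act gG).2 (gb g gG).1 (gb g gG).2.
have gen := quadric_generated hex_sum hex_prod hex_cayley uK vK wK uvw u0 v0 w0 b10 b20 b30 l0.
apply: (affine_tower2 actG stabK tr_x tr_y (e := (b1 / u ^+ 2 - b2 / v ^+ 2) / l)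
  (f := (s - s0 * (b1 / u ^+ 2)) / l)).
- by move=> g /aff[].
- by move=> g /aff[].
move=> t _; case: gen; set E := adj (adj K _) _ => b1E b2E b3E sE.
have KE a : a \in K -> a \in E by move=> aK; apply/adj_base/adj_base.
apply: hex_generated => //.
have [x0 y0 z0 _] := hex_neq0 tr_x tr_y.
have den0 : s + 3 - 1 - (b1 + 2) != 0.
  have -> : s + 3 - 1 - (b1 + 2) = (y - 1) * (z^-1 - 1) / z^-1.
    by rewrite /s /b1 /z; field; rewrite ?x0 ?y0 ?oner_eq0.
  have y1 : y - 1 != 0.
    by rewrite subr_eq0; apply/eqP => e; move/eqP: b20; apply; rewrite /b2 e invr1; ring.
  have z1 : z^-1 - 1 != 0.
    by rewrite subr_eq0; apply/eqP => e; move/eqP: b30; apply; rewrite /b3 e -[z]invrK e invr1; ring.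
  by rewrite mulf_neq0 ?invr_eq0 // mulf_neq0.
(* From [xyz = 1] follows [x (y - 1) (1 - z) = y^-1 + z^-1 - 1 - x]; both the factor of [x] on the
   left and the right-hand side are expressed through the [b_i] and [s]. *)
have -> : x = (b2 + 2 + (b3 + 2) - 1 - (s + 3)) / (s + 3 - 1 - (b1 + 2)).
  apply: (mulIf den0); rewrite divfK // /b1 /b2 /b3 /s /z; field; rewrite ?x0 ?y0 ?oner_eq0 //.
have ax (S : divringClosed F) (a b d i : F) : a \in S -> b \in S -> d \in S -> i \in S ->
  (b + 2 + (d + 2) - 1 - (i + 3)) / (i + 3 - 1 - (a + 2)) \in S by move=> *; in_subfield.
exact: ax.
Qed.
End HexagonalDescent.

Section HexagonalOutcome.
Variables (gT : finGroupType) (F : fieldType) (act : gT -> {rmorphism F -> F}).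
Variables (G H : {group gT}) (K : divringClosed F).
Hypothesis actG : acts_auto act G.
Hypothesis stabK : forall g s, g \in G -> s \in K -> act g s \in K.
Hypothesis HK : forall g, reflect (g \in G /\ forall a, a \in K -> act g a = a) (g \in H).
Hypothesis faithful : forall g, g \in G -> (forall z, act g z = z) -> g = 1%g.

Lemma kernel_conj g h : g \in G -> h \in H -> (g * h * g^-1)%g \in H.
Proof.
case: (actG) => a1 aM gG /HK[hG hK]; apply/HK; split=> [|a aK].
  by rewrite !groupM ?groupV.
by rewrite !aM ?groupM ?groupV // hK ?stabK ?groupV // (actK actG).
Qed.

Variables x y : F.
Hypothesis tr_x : ~ alg K x.
Hypothesis tr_y : ~ alg (adj K x) y.
Hypothesis full : forall z, z \in adj (adj K x) y.
Let z := (x * y)^-1.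
Hypothesis hexG : forall g, g \in G -> hexagonal x y (act g).

(** If [H] contained a transposition, up to inversion, its commutator with [c] would be a 3-cycle in
    [H], which is normal in [G]. So [H] contains a 3-cycle or acts by the identity and the common
    inversion only. *)
Lemma hex_outcome c : c \in G -> act c x = y -> act c y = z -> rational_fixed act G K.
Proof.
case: (actG) => a1 aM cG cx cy; have [x0 y0 z0 _] := hex_neq0 tr_x tr_y.
have cz : act c z = x.
  by rewrite /z fmorphV rmorphM cx cy /z; field; rewrite ?x0 ?y0 ?oner_eq0.
have cVG : c^-1%g \in G by rewrite groupV.
have ix : act c^-1 y = x by rewrite -cx (actVK actG).
have iy : act c^-1 z = y by rewrite -cy (actVK actG).
have iz : act c^-1 x = z by rewrite -[in LHS]cz (actVK actG).
have [[h [hH hx hy]]|no3] := classic (exists h, [/\ h \in H, act h x = y & act h y = z]).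
  exact: (hex_three_cycle actG stabK HK tr_x tr_y full hexG hH hx hy).
have HG h : h \in H -> h \in G by case/HK.
have sq h : h \in H -> act h x = z -> act h y = x -> act h z = y -> False.
  move=> hH hx hy hz; apply: no3; exists (h * h)%g.
  by rewrite !aM ?HG // groupM // hx hz hy hx.
have sqV h : h \in H -> act h x = z^-1 -> act h y = x^-1 -> act h z = y^-1 -> False.
  move=> hH hx hy hz; apply: no3; exists (h * h)%g.
  by rewrite !aM ?HG // groupM // hx hy (fmorphV (act h) z) (fmorphV (act h) x) hz hx !invrK.
have com h : h \in H -> (c * h * c^-1 * h^-1)%g \in H.
  by move=> hH; rewrite groupM ?groupV // kernel_conj.
have Hinv h t t' : h \in H -> act h t = t' -> act h^-1 t' = t.
  by move=> hH <-; rewrite (actVK actG) // HG.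
have HinvV h t t' : h \in H -> act h t = t'^-1 -> act h^-1 t' = t^-1.
  by move=> hH e; rewrite -[t']invrK -e -fmorphV (actVK actG) // HG.
have comE h t : h \in H -> act (c * h * c^-1 * h^-1) t = act c (act h (act c^-1 (act h^-1 t))).
  by move=> /HG hG; rewrite !aM ?groupM ?groupV.
have fV1 t : act c^-1 t^-1 = (act c^-1 t)^-1 by rewrite fmorphV.
have fV2 h t : act h t^-1 = (act h t)^-1 by rewrite fmorphV.
have tri h : h \in H ->
    [\/ [/\ act h x = x, act h y = y & act h z = z] |
        [/\ act h x = x^-1, act h y = y^-1 & act h z = z^-1]].
  move=> hH; case: (hexG (HG _ hH)); rewrite -/z => hx hy hz.
  - by constructor 1.
  - by case: no3; exists h.
  - by case: (sq h).
  - by case: (sq _ (com _ hH)); rewrite comE // ?(Hinv _ _ _ hH hx) ?(Hinv _ _ _ hH hy) ?(Hinv _ _ _ hH hz)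
      ?ix ?iy ?iz ?hx ?hy ?hz ?cx ?cy ?cz.
  - by case: (sq _ (com _ hH)); rewrite comE // ?(Hinv _ _ _ hH hx) ?(Hinv _ _ _ hH hy) ?(Hinv _ _ _ hH hz)
      ?ix ?iy ?iz ?hx ?hy ?hz ?cx ?cy ?cz.
  - by case: (sq _ (com _ hH)); rewrite comE // ?(Hinv _ _ _ hH hx) ?(Hinv _ _ _ hH hy) ?(Hinv _ _ _ hH hz)
      ?ix ?iy ?iz ?hx ?hy ?hz ?cx ?cy ?cz.
  - by constructor 2.
  - case: (sq (h * h)%g); rewrite ?groupM // aM ?HG //.
    + by rewrite hx (fmorphV (act h) y) hy invrK.
    + by rewrite hy (fmorphV (act h) z) hz invrK.
    + by rewrite hz (fmorphV (act h) x) hx invrK.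
  - by case: (sqV h).
  - by case: (sq _ (com _ hH)); rewrite comE // ?(HinvV _ _ _ hH hx) ?(HinvV _ _ _ hH hy) ?(HinvV _ _ _ hH hz)
      fV1 ?ix ?iy ?iz fV2 ?hx ?hy ?hz ?invrK ?cx ?cy ?cz.
  - by case: (sq _ (com _ hH)); rewrite comE // ?(HinvV _ _ _ hH hx) ?(HinvV _ _ _ hH hy) ?(HinvV _ _ _ hH hz)
      fV1 ?ix ?iy ?iz fV2 ?hx ?hy ?hz ?invrK ?cx ?cy ?cz.
  - by case: (sq _ (com _ hH)); rewrite comE // ?(HinvV _ _ _ hH hx) ?(HinvV _ _ _ hH hy) ?(HinvV _ _ _ hH hz)
      fV1 ?ix ?iy ?iz fV2 ?hx ?hy ?hz ?invrK ?cx ?cy ?cz.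
have [[h [hH hx hy]]|noV] := classic (exists h, [/\ h \in H, act h x = x^-1 & act h y = y^-1]).
  apply: (hex_inversion actG stabK HK tr_x tr_y full hexG hH hx hy).
  by move=> g /tri[] [-> _ _]; auto.
apply: (hex_faithful actG stabK HK tr_x tr_y full hexG _ cG cx cy).
move=> h hH; have [[hx hy _]|[hx hy _]] := tri h hH; last by case: noV; exists h.
apply: faithful; first exact: HG.
have hK : forall a, a \in K -> act h a = a by case/HK: (hH).
by move=> t; apply: (fix_adj _ hy) (full t); apply: fix_adj hx.
Qed.
End HexagonalOutcome.

(** * Monomial coordinates *)

Section ReducedForms.
Implicit Types a b c m n : int.

Definition signed_perm m1 n1 m2 n2 :=
  ((m1 = 1 \/ m1 = -1) /\ n1 = 0 /\ m2 = 0 /\ (n2 = 1 \/ n2 = -1)) \/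
  (m1 = 0 /\ (n1 = 1 \/ n1 = -1) /\ (m2 = 1 \/ m2 = -1) /\ n2 = 0).

(** The automorphisms of the hexagonal lattice: up to the sign [e] they permute the exponent vectors
    [(1, 0)], [(0, 1)], [(-1, -1)] of [x], [y], [(x y)^-1]. *)
Definition hexagonal_mx m1 n1 m2 n2 := exists2 e : int, e = 1 \/ e = -1 &
  (m1, n1, m2, n2) \in [:: (e, 0, 0, e); (0, e, - e, - e); (- e, - e, e, 0);
                          (0, e, e, 0); (e, 0, - e, - e); (- e, - e, 0, e)].

(** With [Q] the value of the form, [4 a Q = (2 a m + b n)^2 + (4 a c - b^2) n^2] and [b^2 <= a c],
    so a value at most [c] forces [3 n^2 <= 4]. *)
Lemma reduced_form_bound a b c m n : 0 < a -> a <= c -> - a <= b -> b <= 0 ->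
  a * m ^+ 2 + b * m * n + c * n ^+ 2 <= c -> -1 <= n /\ n <= 1.
Proof.
move=> a0 ac b1 b2 h.
have h1 : 4 * a * (a * m ^+ 2 + b * m * n + c * n ^+ 2) =
  (2 * a * m + b * n) ^+ 2 + (4 * a * c - b ^+ 2) * n ^+ 2 by ring.
have h2 : 0 <= (2 * a * m + b * n) ^+ 2 by apply: sqr_ge0.
have h3 : 3 * (a * c) <= 4 * a * c - b ^+ 2 by nia.
have h4 : 3 * (a * c) * n ^+ 2 <= 4 * (a * c).
  have h5 : 4 * a * (a * m ^+ 2 + b * m * n + c * n ^+ 2) <= 4 * a * c by nia.
  have h6 : 0 <= n ^+ 2 by apply: sqr_ge0.
  move: h5; rewrite h1 => h5; nia.
have ac0 : 0 < a * c by nia.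
have n2 : n ^+ 2 <= 1 by nia.
by split; nia.
Qed.

Lemma reduced_form_small a b m n : 0 < a -> - a <= b -> b <= 0 ->
  n = -1 \/ n = 1 -> a * m ^+ 2 + b * m * n <= 0 -> -1 <= m /\ m <= 1.
Proof.
move=> a0 b1 b2.
have pos i : 1 <= i -> 0 < a * i ^+ 2 by move=> i1; rewrite mulr_gt0 // exprn_gt0 //; lia.
have neg i : 2 <= i -> 0 < a * i ^+ 2 - a * i.
  by move=> i2; rewrite expr2 -mulrBr mulr_gt0 // -[X in _ - X]mulr1 -mulrBr mulr_gt0; lia.
have key i : a * i ^+ 2 - b * i <= 0 -> -1 <= i /\ i <= 0.
  move=> h; split; rewrite leNgt; apply/negP => hi.
    have p1 : 0 < a * i ^+ 2 - a * (- i) by rewrite -sqrrN; apply: neg; lia.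
    have p2 : 0 <= a * (- i) + b * (- i) by rewrite -mulrDl mulr_ge0; lia.
    move: h p1 p2; rewrite !mulrN; move: (a * i ^+ 2) (a * i) (b * i); clear; lia.
  have p1 : 0 < a * i ^+ 2 by apply: pos; lia.
  have p2 : 0 <= (- b) * i by rewrite mulr_ge0; lia.
  move: h p1 p2; rewrite mulNr; move: (a * i ^+ 2) (b * i); clear; lia.
move=> [] -> h.
  by have := key m; move: h; rewrite mulrN1 => h /(_ h); clear; lia.
by have := key (- m); move: h; rewrite sqrrN mulrN opprK mulr1 => h /(_ h); clear; lia.
Qed.

(** The values of the form at [(m1, n1)] and [(m2, n2)] bound all entries by 1, and the finitely
    many remaining matrices are checked one by one. *)
Lemma reduced_form_auts a b c m1 n1 m2 n2 : 0 < a -> a <= c -> - a <= b -> b <= 0 ->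
  m1 * n2 - m2 * n1 = 1 \/ m1 * n2 - m2 * n1 = -1 ->
  a * m1 ^+ 2 + b * m1 * n1 + c * n1 ^+ 2 = a ->
  a * m2 ^+ 2 + b * m2 * n2 + c * n2 ^+ 2 = c ->
  2 * a * m1 * m2 + b * (m1 * n2 + m2 * n1) + 2 * c * n1 * n2 = b ->
  (- a < b -> signed_perm m1 n1 m2 n2) /\ (b = - a -> hexagonal_mx m1 n1 m2 n2).
Proof.
move=> a0 ac b1 b2 det e1 e2 e3.
have [n1a n1b] : -1 <= n1 /\ n1 <= 1.
  by apply: (@reduced_form_bound a b c m1 n1) => //; rewrite e1.
have [n2a n2b] : -1 <= n2 /\ n2 <= 1.
  by apply: (@reduced_form_bound a b c m2 n2) => //; rewrite e2.
have c1 : n1 = -1 \/ n1 = 0 \/ n1 = 1 by lia.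
have c2 : n2 = -1 \/ n2 = 0 \/ n2 = 1 by lia.
have small := reduced_form_small a0 b1 b2.
have [m1a m1b] : -1 <= m1 /\ m1 <= 1.
  case: c1 => [h|[h|h]].
  - by apply: (small m1 n1); [lia | move: e1; rewrite h => e1; nia].
  - have : m1 ^+ 2 == 1.
      apply/eqP/(@mulfI _ a); first by rewrite gt_eqF.
      by rewrite -[RHS]/(a * 1) mulr1 -[RHS]e1 h; ring.
    by rewrite sqrf_eq1 => /orP[]/eqP->.
  - by apply: (small m1 n1); [lia | move: e1; rewrite h => e1; nia].
have [m2a m2b] : -1 <= m2 /\ m2 <= 1.
  case: c2 => [h|[h|h]].
  - by apply: (small m2 n2); [lia | move: e2; rewrite h => e2; nia].
  - by move: det; rewrite h => det; split; nia.
  - by apply: (small m2 n2); [lia | move: e2; rewrite h => e2; nia].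
have d1 : m1 = -1 \/ m1 = 0 \/ m1 = 1 by lia.
have d2 : m2 = -1 \/ m2 = 0 \/ m2 = 1 by lia.
move: det e1 e2 e3; case: d1 => [->|[->|->]]; case: c1 => [->|[->|->]];
case: d2 => [->|[->|->]]; case: c2 => [->|[->|->]] => det e1 e2 e3; try (exfalso; lia);
split=> hb; try (exfalso; lia); rewrite /signed_perm; try lia;
by first [exists 1; [by left | by []] | exists (-1); [by right | by []]].
Qed.
End ReducedForms.

Section ReducedBasis.
Variables a b c : int.
Let Q m n := a * m ^+ 2 + b * m * n + c * n ^+ 2.
Hypothesis Qpos : forall m n, m ^+ 2 + n ^+ 2 <= Q m n.
Let polar (p r q s : int) := 2 * a * p * q + b * (p * s + q * r) + 2 * c * r * s.

(** Among the bases of determinant 1 or -1 take one with minimal sum of values. Replacing one vector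
    by the sum or difference of both cannot lower it, which bounds the polar form by both values;
    order and sign are then adjusted. *)
Lemma reduced_basis : exists p r q s : int, [/\ p * s - q * r = 1 \/ p * s - q * r = -1,
  0 < Q p r, Q p r <= Q q s, - Q p r <= polar p r q s & polar p r q s <= 0].
Proof.
pose unim (p r q s : int) := p * s - q * r = 1 \/ p * s - q * r = -1.
have Q0 m n : 0 <= Q m n.
  by apply: le_trans (Qpos m n); rewrite addr_ge0 ?sqr_ge0.
have Qd p r q s : Q (p + q) (r + s) = Q p r + Q q s + polar p r q s by rewrite /Q /polar; ring.
have Qd' p r q s : Q (p - q) (r - s) = Q p r + Q q s - polar p r q s by rewrite /Q /polar; ring.
pose P n := cbool (exists p r q s, unim p r q s /\ Q p r + Q q s = n%:Z).
have exP : exists n, P n.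
  exists (absz (Q 1 0 + Q 0 1)); apply/cboolP; exists 1, 0, 0, 1; split; first by left.
  by rewrite gez0_abs // addr_ge0.
have [N /cboolP[p [r [q [s [det QN]]]]] minN] := ex_minnP exP.
have {}minN p' r' q' s' : unim p' r' q' s' -> Q p r + Q q s <= Q p' r' + Q q' s'.
  move=> u; have e : Posz (absz (Q p' r' + Q q' s')) = Q p' r' + Q q' s'.
    by rewrite gez0_abs // addr_ge0.
  have : leq N (absz (Q p' r' + Q q' s')).
    by apply: minN; apply/cboolP; exists p', r', q', s'.
  by move=> h; rewrite QN -e; move: h; move: (absz _) => j; clear; lia.
have h1 : - Q p r <= polar p r q s.
  have : unim p r (p + q) (r + s) by move: det; rewrite /unim; clear; lia.
  by move=> /minN; rewrite Qd; move: (Q p r) (Q q s) (polar p r q s); clear; lia.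
have h2 : polar p r q s <= Q p r.
  have : unim p r (p - q) (r - s) by move: det; rewrite /unim; clear; lia.
  by move=> /minN; rewrite Qd'; move: (Q p r) (Q q s) (polar p r q s); clear; lia.
have h3 : - Q q s <= polar p r q s.
  have : unim (p + q) (r + s) q s by move: det; rewrite /unim; clear; lia.
  by move=> /minN; rewrite Qd; move: (Q p r) (Q q s) (polar p r q s); clear; lia.
have h4 : polar p r q s <= Q q s.
  have : unim (p - q) (r - s) q s by move: det; rewrite /unim; clear; lia.
  by move=> /minN; rewrite Qd'; move: (Q p r) (Q q s) (polar p r q s); clear; lia.
have pos m n : m != 0 \/ n != 0 -> 0 < Q m n.
  move=> h; apply: lt_le_trans (Qpos m n).
  rewrite lt_neqAle addr_ge0 ?sqr_ge0 // andbT eq_sym paddr_eq0 ?sqr_ge0 // !sqrf_eq0.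
  by apply/negP => /andP[/eqP e1 /eqP e2]; case: h => /eqP.
have p1 : 0 < Q p r.
  apply: pos; apply: NNPP => h; move: det.
  have [-> ->] : p = 0 /\ r = 0 by split; apply/eqP/negPn/negP => ?; apply: h; auto.
  by rewrite /unim mul0r mulr0 subrr => -[].
have p2 : 0 < Q q s.
  apply: pos; apply: NNPP => h; move: det.
  have [-> ->] : q = 0 /\ s = 0 by split; apply/eqP/negPn/negP => ?; apply: h; auto.
  by rewrite /unim mul0r mulr0 subrr => -[].
have Qn m n : Q (- m) (- n) = Q m n by rewrite /Q; ring.
have pn p' r' q' s' : polar p' r' (- q') (- s') = - polar p' r' q' s' by rewrite /polar; ring.
have pc p' r' q' s' : polar p' r' q' s' = polar q' s' p' r' by rewrite /polar; ring.
have [le|lt] := leP (Q p r) (Q q s); have [b0|b0] := leP (polar p r q s) 0.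
- by exists p, r, q, s.
- exists p, r, (- q), (- s); rewrite pn Qn; split=> //; last by rewrite oppr_le0 ltW.
    by move: det; rewrite /unim; clear; lia.
  by rewrite lerN2.
- exists q, s, p, r; rewrite pc; split=> //; last exact: ltW.
  by move: det; rewrite /unim; clear; lia.
- exists q, s, (- p), (- r); rewrite pn Qn pc; split=> //; last by rewrite oppr_le0 ltW.
  + by move: det; rewrite /unim; clear; lia.
  + exact: ltW.
  + by rewrite lerN2.
Qed.
End ReducedBasis.

Definition signed_swap (F : fieldType) (x y : F) (f : F -> F) : Prop :=
  ((f x = x \/ f x = x^-1) /\ (f y = y \/ f y = y^-1)) \/
  ((f x = y \/ f x = y^-1) /\ (f y = x \/ f y = x^-1)).

Section MonomialCoordinates.
Variables (gT : finGroupType) (F : fieldType) (act : gT -> {rmorphism F -> F}).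
Variables (G : {group gT}) (K : divringClosed F) (x y : F).
Hypothesis actG : acts_auto act G.
Hypothesis tr_x : ~ alg K x.
Hypothesis tr_y : ~ alg (adj K x) y.
Hypothesis monomial : forall g, g \in G -> exists a b c d : int,
  act g x = x ^ a * y ^ c /\ act g y = x ^ b * y ^ d.

Let E (m n : int) : F := x ^ m * y ^ n.

Lemma mono_neq0 : x != 0 /\ y != 0.
Proof.
by split; apply/eqP => e; [apply: tr_x | apply: tr_y]; apply: alg_id; rewrite e rpred0.
Qed.

Lemma rpredXz (S : divringClosed F) z (n : int) : z \in S -> z ^ n \in S.
Proof. by case: n => n zS; rewrite ?NegzE -?exprnN ?rpredV rpredX. Qed.

Lemma mono_neq m n : E m n != 0.
Proof. by have [x0 y0] := mono_neq0; rewrite mulf_neq0 ?expfz_neq0. Qed.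

Lemma monoM m n m' n' : E m n * E m' n' = E (m + m') (n + n').
Proof. by have [x0 y0] := mono_neq0; rewrite /E !expfzDr // mulrACA. Qed.

Lemma monoX m n k : E m n ^ k = E (m * k) (n * k).
Proof. by rewrite /E exprzMl ?unitfE ?expfz_neq0 ?(mono_neq0.1) ?(mono_neq0.2) // !exprz_exp. Qed.

Lemma mono_root (S : divringClosed F) t (n : int) : n != 0 -> t ^ n \in S -> alg S t.
Proof.
wlog : n / 0 < n.
  move=> h n0 tS; have [n1|n1] := ltP 0 n; first exact: (h n).
  apply: (h (- n)); rewrite ?oppr_eq0 // ?oppr_gt0 ?lt_neqAle ?n0 //.
  by rewrite -invr_expz rpredV.
case: n => // n n0 _ tS; exists ('X^n - (t ^+ n)%:P); split.
- by rewrite rpredB ?polyOverXn ?polyOverC.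
- by rewrite -size_poly_eq0 size_XnsubC.
- by rewrite /root !hornerE subrr.
Qed.

Lemma mono_inj m n m' n' : E m n = E m' n' -> m = m' /\ n = n'.
Proof.
have [x0 y0] := mono_neq0; move=> e.
have e1 : E (m - m') (n - n') = 1.
  by apply: (mulIf (mono_neq m' n')); rewrite monoM !subrK e mul1r.
have n0 : n - n' = 0.
  apply/eqP/negPn/negP => h; apply: tr_y; apply: (mono_root h).
  have -> : y ^ (n - n') = (x ^ (m - m'))^-1.
    by apply: (mulfI (expfz_neq0 (m - m') x0)); rewrite divff ?expfz_neq0.
  by rewrite rpredV rpredXz // adj_gen.
move: e1; rewrite /E n0 expr0z mulr1 => e1.
split; apply/eqP; rewrite -subr_eq0; last by rewrite n0.
by apply/negPn/negP => h; apply: tr_x; apply: (mono_root h); rewrite e1 rpred1.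
Qed.

Lemma mono_matrix : exists M : gT -> int * int * int * int, forall g, g \in G ->
  let: (a, b, c, d) := M g in forall m n, act g (E m n) = E (a * m + b * n) (c * m + d * n).
Proof.
have h g : exists M : int * int * int * int, g \in G ->
    let: (a, b, c, d) := M in forall m n, act g (E m n) = E (a * m + b * n) (c * m + d * n).
  have [gG|gG] := boolP (g \in G); last by exists (0, 0, 0, 0).
  have [a [b [c [d [gx gy]]]]] := monomial gG; exists (a, b, c, d) => _ m n.
  by rewrite /E rmorphM !fmorphXz gx gy -!/(E _ _) !monoX monoM.
by have [M hM] := fin_all_exists h; exists M.
Qed.

Lemma lattice_normal_form : exists X Y,
  [/\ forall S : divringClosed F, X \in adj (adj S x) y /\ Y \in adj (adj S x) y,
      forall S : divringClosed F, x \in adj (adj S X) Y /\ y \in adj (adj S X) Y &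
      (forall g, g \in G -> signed_swap X Y (act g)) \/
      (forall g, g \in G -> hexagonal X Y (act g))].
Proof.
case: (actG) => a1 aM.
have [M hM] := mono_matrix.
pose a g := (M g).1.1.1; pose b g := (M g).1.1.2; pose c g := (M g).1.2; pose d g := (M g).2.
have {}hM g m n : g \in G -> act g (E m n) = E (a g * m + b g * n) (c g * m + d g * n).
  by move=> gG; have := hM g gG; rewrite /a /b /c /d; case: (M g) => [[[? ?] ?] ?].
have M1 : [/\ a 1%g = 1, b 1%g = 0, c 1%g = 0 & d 1%g = 1].
  have := hM 1%g 1 0 (group1 G); rewrite a1 !mulr0 !addr0 !mulr1 => /mono_inj[<- <-].
  by have := hM 1%g 0 1 (group1 G); rewrite a1 !mulr0 !add0r !mulr1 => /mono_inj[<- <-].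
have MM g h : g \in G -> h \in G ->
    [/\ a (g * h)%g = a g * a h + b g * c h, b (g * h)%g = a g * b h + b g * d h,
        c (g * h)%g = c g * a h + d g * c h & d (g * h)%g = c g * b h + d g * d h].
  move=> gG hG; have gh : (g * h)%g \in G by rewrite groupM.
  have := hM (g * h)%g 1 0 gh; rewrite aM // !hM // !mulr0 !addr0 !mulr1 => /mono_inj[<- <-].
  by have := hM (g * h)%g 0 1 gh; rewrite aM // !hM // !mulr0 !add0r !mulr1 => /mono_inj[<- <-].
have Mdet g : g \in G -> a g * d g - b g * c g = 1 \/ a g * d g - b g * c g = -1.
  move=> gG; have [e1 e2 e3 e4] := MM g g^-1%g gG (groupVr gG).
  rewrite mulgV in e1 e2 e3 e4; case: M1 e1 e2 e3 e4 => -> -> -> -> e1 e2 e3 e4.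
  set u := a g * d g - b g * c g; pose v := a g^-1%g * d g^-1%g - b g^-1%g * c g^-1%g.
  have uv : u * v = 1.
    transitivity ((1 * 1 : int) - 0 * 0); last by rewrite mulr1 mulr0 subr0.
    by rewrite {1}e1 {1}e4 {1}e2 {1}e3 /u /v; ring.
  have : u \is a GRing.unit by apply/unitrPr; exists v.
  by rewrite qualifE /= => /orP[]/eqP; auto.
(* The coefficients of the sum over [G] of the transforms of [m^2 + n^2]; the term of the identity
   gives [Qpos]. *)
pose A := \sum_(g in G) (a g ^+ 2 + c g ^+ 2).
pose B := \sum_(g in G) (2 * (a g * b g + c g * d g)).
pose C := \sum_(g in G) (b g ^+ 2 + d g ^+ 2).
pose Q m n := A * m ^+ 2 + B * m * n + C * n ^+ 2.
have QE m n : Q m n = \sum_(g in G) ((a g * m + b g * n) ^+ 2 + (c g * m + d g * n) ^+ 2).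
  rewrite /Q /A /B /C !mulr_suml -!big_split /=; apply: eq_bigr => g _; ring.
have Qpos m n : m ^+ 2 + n ^+ 2 <= Q m n.
  rewrite QE (bigD1 1%g) //=; case: M1 => -> -> -> ->; rewrite !mul1r !mul0r addr0 add0r.
  by rewrite lerDl sumr_ge0 // => g _; rewrite addr_ge0 ?sqr_ge0.
have Qinv h m n : h \in G -> Q (a h * m + b h * n) (c h * m + d h * n) = Q m n.
  move=> hG; rewrite !QE [RHS](reindex_inj (mulIg h)) /=.
  apply: eq_big => [g|g gG]; first by rewrite groupMr.
  by have [-> -> -> ->] := MM g h gG hG; ring.
have [p [r [q [s [det a0 ac b1 b2]]]]] := reduced_basis Qpos.
set pol := 2 * A * p * q + B * (p * s + q * r) + 2 * C * r * s in b1 b2.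
pose ep := p * s - q * r; have ep2 : ep * ep = 1 by rewrite /ep; case: det => ->.
pose X := E p r; pose Y := E q s; exists X, Y.
have XY m n : X ^ m * Y ^ n = E (p * m + q * n) (r * m + s * n).
  by rewrite /X /Y !monoX monoM.
split.
- by move=> S; split; rewrite rpredM ?rpredXz ?adj_gen // adj_base ?adj_gen.
- move=> S; have inS m n : X ^ m * Y ^ n \in adj (adj S X) Y.
    by rewrite rpredM ?rpredXz ?adj_gen // adj_base ?adj_gen.
  split.
    have <- : X ^ (ep * s) * Y ^ (- ep * r) = x; last exact: inS.
    have -> : X ^ (ep * s) * Y ^ (- ep * r) = E (ep * ep) 0 by rewrite XY; congr E; rewrite /ep; ring.
    by rewrite ep2 /E expr1z expr0z mulr1.
  have <- : X ^ (- ep * q) * Y ^ (ep * p) = y; last exact: inS.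
  have -> : X ^ (- ep * q) * Y ^ (ep * p) = E 0 (ep * ep) by rewrite XY; congr E; rewrite /ep; ring.
  by rewrite ep2 /E expr1z expr0z mul1r.
have gXY g : g \in G -> exists m1 n1 m2 n2,
   [/\ act g X = X ^ m1 * Y ^ n1, act g Y = X ^ m2 * Y ^ n2 &
     (- Q p r < pol -> signed_perm m1 n1 m2 n2) /\ (pol = - Q p r -> hexagonal_mx m1 n1 m2 n2)].
  move=> gG; pose v1 := a g * p + b g * r; pose w1 := c g * p + d g * r.
  pose v2 := a g * q + b g * s; pose w2 := c g * q + d g * s.
  (* Coordinates of the image vectors in the new basis by Cramer's rule; the determinant [ep] is its
     own inverse. *)
  pose m1 := ep * (v1 * s - w1 * q); pose n1 := ep * (p * w1 - r * v1).
  pose m2 := ep * (v2 * s - w2 * q); pose n2 := ep * (p * w2 - r * v2).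
  have e1 : p * m1 + q * n1 = v1.
    by transitivity (ep * ep * v1); [rewrite /m1 /n1 /ep; ring | rewrite ep2 mul1r].
  have e2 : r * m1 + s * n1 = w1.
    by transitivity (ep * ep * w1); [rewrite /m1 /n1 /ep; ring | rewrite ep2 mul1r].
  have e3 : p * m2 + q * n2 = v2.
    by transitivity (ep * ep * v2); [rewrite /m2 /n2 /ep; ring | rewrite ep2 mul1r].
  have e4 : r * m2 + s * n2 = w2.
    by transitivity (ep * ep * w2); [rewrite /m2 /n2 /ep; ring | rewrite ep2 mul1r].
  exists m1, n1, m2, n2; rewrite !XY e1 e2 e3 e4 /X /Y !hM //; split=> //.
  have Q1 : Q v1 w1 = Q p r by rewrite Qinv.
  have Q2 : Q v2 w2 = Q q s by rewrite Qinv.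
  have Q3 : Q (v1 + v2) (w1 + w2) = Q (p + q) (r + s) by rewrite -(Qinv g (p + q)) //; congr Q; rewrite /v1 /v2 /w1 /w2; ring.
  apply: (@reduced_form_auts (Q p r) pol (Q q s)) => //.
  - have -> : m1 * n2 - m2 * n1 = ep * ep * ((a g * d g - b g * c g) * (ep * ep)).
      by rewrite /m1 /m2 /n1 /n2 /v1 /v2 /w1 /w2 /ep; ring.
    by rewrite ep2 mul1r mulr1; apply: Mdet.
  - by rewrite -[RHS]Q1 -e1 -e2 /Q /pol; ring.
  - by rewrite -[RHS]Q2 -e3 -e4 /Q /pol; ring.
  - transitivity (Q (v1 + v2) (w1 + w2) - Q v1 w1 - Q v2 w2).
      by rewrite -e1 -e2 -e3 -e4 /Q /pol; ring.
    by rewrite Q1 Q2 Q3 /Q /pol; ring.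
have [X0 Y0] : X != 0 /\ Y != 0 by split; apply: mono_neq.
(* The boundary case of the reduction inequalities is the hexagonal one. *)
have [lt|le] := ltP (- Q p r) pol.
  left=> g /gXY[m1 [n1 [m2 [n2 [gX gY [/(_ lt) h _]]]]]].
  rewrite /signed_swap gX gY; case: h => [[h1 [-> [-> h2]]]|[-> [h1 [h2 ->]]]]; [left|right];
  rewrite !expr0z !mulr1 !mul1r.
    by case: h1 => ->; case: h2 => ->; rewrite ?expr1z ?exprN1; auto.
  by case: h1 => ->; case: h2 => ->; rewrite ?expr1z ?exprN1; auto.
have eqb : pol = - Q p r by apply/le_anti; rewrite le b1.
right=> g gG; have [m1 [n1 [m2 [n2 [gX gY [_ /(_ eqb) h]]]]]] := gXY g gG.
have gZ : act g (X * Y)^-1 = (X ^ m1 * Y ^ n1 * (X ^ m2 * Y ^ n2))^-1.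
  by rewrite fmorphV rmorphM gX gY.
have expr (t : F) : (t ^ (1 : int) = t) * (t ^ (0 : int) = 1) * (t ^ (-1 : int) = t^-1) * (t ^ (- -1 : int) = t).
  by rewrite opprK expr1z expr0z exprN1.
move: h gX gY gZ X0 Y0; move: (X) (Y) => X' Y' [e e1]; rewrite !inE => /or4P[|||/or3P[]] /eqP[-> -> -> ->];
case: e1 => ->; rewrite !expr ?mulr1 ?mul1r ?expr => gX gY gZ X0 Y0;
[constructor 1|constructor 7|constructor 2|constructor 8|constructor 3|constructor 9|
 constructor 4|constructor 10|constructor 5|constructor 11|constructor 6|constructor 12];
rewrite ?gX ?gY ?gZ // ?(invfM, invrK) //; by field; rewrite ?mulf_neq0 ?invr_eq0 ?X0 ?Y0 ?oner_eq0.
Qed.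
End MonomialCoordinates.

Lemma frac_quotient (R : idomainType) (z : {fraction R}) :
  exists a b : R, b != 0 /\ z = tofrac a / tofrac b.
Proof.
elim/quotW: z => r; exists \n_r, \d_r; split; first exact: denom_ratioP.
have d0 := denom_ratioP r.
have -> : (tofrac \d_r)^-1 = \pi_{fraction R}%qT (Ratio 1 \d_r).
  unlock FracField.tofrac; rewrite -[LHS]FracField.pi_inv /FracField.invf.
  by rewrite !numden_Ratio ?oner_neq0.
unlock FracField.tofrac; rewrite -[RHS]FracField.pi_mul /FracField.mulf.
by rewrite !numden_Ratio ?oner_neq0 // mulr1 mul1r Ratio_numden.
Qed.

(** * The rational function field *)

Section ImageField.
Variables (R F : fieldType) (f : {rmorphism R -> F}).
(** The copies of [K] and [k] inside [RF K] are of this form. *)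
Definition image_field : {pred F} := fun z => cbool (exists a, z = f a).

Lemma image_fieldP z : reflect (exists a, z = f a) (z \in image_field).
Proof. exact: cboolP. Qed.

Lemma image_field_closed : divring_closed image_field.
Proof.
split=> [|_ _ /image_fieldP[a ->] /image_fieldP[b ->]|_ _ /image_fieldP[a ->] /image_fieldP[b ->]];
  apply/image_fieldP.
- by exists 1; rewrite rmorph1.
- by exists (a - b); rewrite rmorphB.
- by exists (a / b); rewrite fmorph_div.
Qed.
HB.instance Definition _ := GRing.isDivringClosed.Build F image_field image_field_closed.

Lemma image_field_poly (p : {poly F}) : p \is a polyOver image_field ->
  exists p0 : {poly R}, p = map_poly f p0.
Proof.
move=> /polyOverP pS.
have [a ha] := choice (fun i a => p`_i = f a) (fun i => image_fieldP _ (pS i)).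
exists (\poly_(i < size p) a i); apply/polyP => i; rewrite coef_map coef_poly.
by case: ltnP => h /=; [rewrite ha | rewrite nth_default // rmorph0].
Qed.
End ImageField.

Lemma quotients_closed (R : comNzRingType) (F : fieldType) (f : {rmorphism R -> F}) (S : {pred F}) :
  (forall z, reflect (exists p q, f q != 0 /\ z = f p / f q) (z \in S)) -> divring_closed S.
Proof.
move=> SP; split=> [|_ _ /SP[p [q [q0 ->]]] /SP[p' [q' [q0' ->]]]|
  _ _ /SP[p [q [q0 ->]]] /SP[p' [q' [q0' ->]]]]; apply/SP.
- by exists 1, 1; rewrite !rmorph1 divr1 oner_eq0.
- exists (p * q' - p' * q), (q * q'); rewrite rmorphB !rmorphM mulf_neq0 //; split=> //.
  by field; rewrite q0 q0'.
- have [p0|p0] := eqVneq (f p') 0.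
    by exists 0, 1; rewrite rmorph0 rmorph1 p0 oner_eq0; split=> //; rewrite mul0r invr0 mulr0 mul0r.
  exists (p * q'), (q * p'); rewrite !rmorphM mulf_neq0 //; split=> //.
  by field; rewrite q0 q0' p0.
Qed.

Section RationalFunctionField.
Variables (k : fieldType) (K : fieldExtType k).
Local Notation RF := (RF K).

Lemma cK_zmod : zmod_morphism (@cK k K).
Proof. by move=> a b; rewrite /cK !rmorphB. Qed.
Lemma cK_monoid : monoid_morphism (@cK k K).
Proof. by split=> [|a b]; rewrite /cK ?rmorph1 // !rmorphM. Qed.
HB.instance Definition _ := GRing.isZmodMorphism.Build K RF (@cK k K) cK_zmod.
HB.instance Definition _ := GRing.isMonoidMorphism.Build K RF (@cK k K) cK_monoid.

Lemma ck_zmod : zmod_morphism (@ck k K).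
Proof. by move=> a b; rewrite /ck scalerBl rmorphB. Qed.
Lemma ck_monoid : monoid_morphism (@ck k K).
Proof. by split=> [|a b]; rewrite /ck ?scale1r ?rmorph1 // -rmorphM -scalerAl mul1r scalerA. Qed.
HB.instance Definition _ := GRing.isZmodMorphism.Build k RF (@ck k K) ck_zmod.
HB.instance Definition _ := GRing.isMonoidMorphism.Build k RF (@ck k K) ck_monoid.

Definition cKf : {rmorphism K -> RF} := @cK k K.
Definition ckf : {rmorphism k -> RF} := @ck k K.
Local Notation Kf := (image_field cKf).
Local Notation kf := (image_field ckf).

Lemma horner_xF (p : {poly K}) : (map_poly cKf p).[xF K] = tofrac p%:P.
Proof.
have -> : map_poly cKf p = map_poly (@FracField.tofrac {poly {poly K}} \o polyC : {poly K} -> RF) (map_poly polyC p).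
  by rewrite -map_poly_comp; apply: eq_map_poly => a.
rewrite (_ : xF K = (@FracField.tofrac {poly {poly K}} \o polyC : {poly K} -> RF) 'X) //.
by rewrite horner_map /= -/(comp_poly 'X p) comp_polyXr.
Qed.

Lemma horner_yF (P : nat -> {poly K}) n :
  tofrac (\poly_(i < n) P i) = \sum_(i < n) tofrac (P i)%:P * yF K ^+ i :> RF.
Proof.
rewrite poly_def rmorph_sum; apply: eq_bigr => i _.
by rewrite -mul_polyC rmorphM rmorphXn.
Qed.

Lemma tr_xF : ~ alg Kf (xF K).
Proof.
move=> [_ [/image_field_poly[p ->] p0 /rootP]]; rewrite horner_xF => /eqP.
by rewrite tofrac_eq0 polyC_eq0 -(map_poly_eq0 cKf) (negPf p0).
Qed.

(** With denominators cleared, a relation of [yF K] becomes an element of [{poly {poly K}}] that is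
    zero in the fraction field. *)
Lemma tr_yF : ~ alg (adj Kf (xF K)) (yF K).
Proof.
move=> [p [/clear_denominators[q [P [qS q0 PS qP]]] p0 /rootP py]].
have [P0 hP0] := choice (fun i p0 => P i = map_poly cKf p0) (fun i => image_field_poly (PS i)).
have e : tofrac (\poly_(i < size p) P0 i) = 0 :> RF.
  rewrite horner_yF; transitivity (q.[xF K] * p.[yF K]); last by rewrite py mulr0.
  rewrite (horner_coef p) mulr_sumr; apply: eq_bigr => i _.
  by rewrite mulrA qP hP0 horner_xF.
move/eqP: e; rewrite tofrac_eq0 => /eqP e.
move/negP: p0; apply; apply/eqP/polyP => i; rewrite coef0.
have [h|h] := ltnP i (size p); last by rewrite nth_default.
have := congr1 (fun r : {poly {poly K}} => r`_i) e; rewrite coef_poly h coef0 => e0.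
by apply: (mulfI q0); rewrite mulr0 qP hP0 e0 rmorph0 horner0.
Qed.

Lemma full_RF z : z \in adj (adj Kf (xF K)) (yF K).
Proof.
have h (a : {poly {poly K}}) : tofrac a \in adj (adj Kf (xF K)) (yF K).
  rewrite -[a]coefK horner_yF; apply: rpred_sum => i _.
  apply: rpredM; last by apply: rpredX; apply: adj_gen.
  apply: adj_base; rewrite -horner_xF; apply: horner_adj.
  by apply/polyOverP => j; rewrite coef_map; apply/image_fieldP; exists (a`_i)`_j.
by have [a [b [_ ->]]] := frac_quotient z; apply: rpred_div.
Qed.

Lemma kvalC m (t : 'I_m -> RF) c : kval t c%:MP = ck K c.
Proof. exact: mmapC. Qed.

Lemma kvalX m (t : 'I_m -> RF) i : kval t 'X_i = t i.
Proof. by rewrite /kval mmapX mmap1U. Qed.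

Lemma kval1 m (t : 'I_m -> RF) : kval t 1 = 1.
Proof. exact: (rmorph1 (mmap ckf t : {rmorphism _ -> _})). Qed.

Definition kgen m (t : 'I_m -> RF) : {pred RF} := fun z => cbool (in_kgen t z).

Lemma kgenP m (t : 'I_m -> RF) z : reflect (in_kgen t z) (z \in kgen t).
Proof. exact: cboolP. Qed.

Lemma kgen_closed m (t : 'I_m -> RF) : divring_closed (kgen t).
Proof. by apply: (@quotients_closed _ _ (mmap ckf t : {rmorphism _ -> _})) => z; apply: kgenP. Qed.
HB.instance Definition _ m (t : 'I_m -> RF) :=
  GRing.isDivringClosed.Build RF (kgen t) (kgen_closed t).

Lemma in_kgen2 u v z : in_kgen (pair2 u v) z <-> z \in adj (adj kf u) v.
Proof.
split=> [[p [q [q0 ->]]]|].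
  have h (r : {mpoly k[2]}) : kval (pair2 u v) r \in adj (adj kf u) v.
    rewrite /kval /mmap; apply: rpred_sum => m _; apply: rpredM.
      by do 2!apply: adj_base; apply/image_fieldP; exists (r@_m).
    rewrite /mmap1; apply: rpred_prod => i _; apply: rpredX; rewrite /pair2.
    by case: ifP => _; [apply/adj_base/adj_gen | apply: adj_gen].
  by apply: rpred_div.
move=> zA; apply/kgenP; move: z zA; apply: adj_min; last first.
  apply/kgenP; exists 'X_ord_max, 1; rewrite kvalX kval1.
  by rewrite oner_eq0 divr1.
apply: adj_min => [_ /image_fieldP[c ->]|]; apply/kgenP.
  exists c%:MP, 1; rewrite kvalC kval1.
  by rewrite oner_eq0 divr1.
exists 'X_ord0, 1; rewrite kvalX kval1.
by rewrite oner_eq0 divr1.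
Qed.

Lemma alg_indep2 u v : ~ alg kf u -> ~ alg (adj kf u) v -> alg_indep (pair2 u v).
Proof.
move=> tu tv p p0; have c0 m : ck K p@_m \in kf by apply/image_fieldP; exists p@_m.
(* [p] with its first variable specialised to [u], as a polynomial in the second; [R j] below is its
   coefficient of degree [j], as a polynomial in the first variable. *)
pose P := \sum_(m <- msupp p) (ck K p@_m * u ^+ (m ord0)) *: 'X^(m ord_max).
have PE : P = 0.
  apply: (alg_root tv).
    apply: rpred_sum => m _; apply: polyOverZ; last exact: polyOverXn.
    by apply: rpredM; [apply: adj_base | apply: rpredX; apply: adj_gen].
  rewrite -[RHS]p0 /kval /mmap horner_sum; apply: eq_bigr => m _.
  rewrite hornerZ hornerXn /mmap1 big_ord_recl big_ord1 -mulrA /pair2 /=.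
  by congr (_ * (_ * v ^+ m _)); apply: val_inj.
pose R j := \sum_(m <- msupp p | m ord_max == j) ck K p@_m *: 'X^(m ord0).
have RE j : R j = 0.
  apply: (alg_root tu).
    by apply: rpred_sum => m _; apply: polyOverZ => //; apply: polyOverXn.
  have := congr1 (fun r : {poly RF} => r`_j) PE; rewrite coef0 coef_sum => e.
  rewrite -[RHS]e horner_sum big_mkcond; apply: eq_bigr => m _.
  by rewrite coefZ coefXn hornerZ hornerXn eq_sym; case: eqP; rewrite ?mulr1 ?mulr0.
apply/mpolyP => m; rewrite mcoeff0; apply/eqP; rewrite -(fmorph_eq0 ckf) /=.
have [ms|/memN_msupp_eq0 ->] := boolP (m \in msupp p); last by rewrite rmorph0.
have := congr1 (fun r : {poly RF} => r`_(m ord0)) (RE (m ord_max)).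
rewrite coef0 coef_sum => e; apply/eqP; rewrite -[RHS]e big_mkcond (bigD1_seq m) ?msupp_uniq //=.
rewrite eqxx coefZ coefXn eqxx mulr1 big1_seq ?addr0 // => m' /andP[ne _].
case: eqP => // e1; rewrite coefZ coefXn; case: eqP => e2; rewrite ?mulr0 //.
case/eqP: ne; apply/mnmP => i; have [->|->] : i = ord0 \/ i = ord_max; rewrite ?e1 ?e2 //.
by case: i => [[|[|]]] // h; [left|right]; apply: val_inj.
Qed.

End RationalFunctionField.

(** * Quaternion algebras and unirationality *)

Section QuaternionAlgebra.
Variables (k : fieldType) (a b : k).

(** Coordinates in the basis [1], [i], [j], [ij] with [i^2 = a], [j^2 = b], [ji = - ij]; row vectors
    bring the vector space structure and the dimension along. *)
Definition quaternion : Type := 'rV[k]_4.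
HB.instance Definition _ := Vector.on quaternion.

Let i0 : 'I_4 := inord 0.
Let i1 : 'I_4 := inord 1.
Let i2 : 'I_4 := inord 2.
Let i3 : 'I_4 := inord 3.

Definition quat_of (x0 x1 x2 x3 : k) : quaternion :=
  \row_j nth 0 [:: x0; x1; x2; x3] j.

Lemma quat_ofE x0 x1 x2 x3 : let x := quat_of x0 x1 x2 x3 in
  [/\ x ord0 i0 = x0, x ord0 i1 = x1, x ord0 i2 = x2 & x ord0 i3 = x3].
Proof. by split; rewrite mxE inordK. Qed.

Lemma quat_eta (x : quaternion) : x = quat_of (x ord0 i0) (x ord0 i1) (x ord0 i2) (x ord0 i3).
Proof.
apply/rowP => j; rewrite mxE.
by case: j => [[|[|[|[|]]]]] // h; congr (x _ _); apply: val_inj; rewrite /= inordK.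
Qed.

Definition quat_mul (x y : quaternion) : quaternion :=
  let x0 := x ord0 i0 in let x1 := x ord0 i1 in let x2 := x ord0 i2 in let x3 := x ord0 i3 in
  let y0 := y ord0 i0 in let y1 := y ord0 i1 in let y2 := y ord0 i2 in let y3 := y ord0 i3 in
  quat_of (x0 * y0 + a * x1 * y1 + b * x2 * y2 - a * b * x3 * y3)
          (x0 * y1 + x1 * y0 - b * x2 * y3 + b * x3 * y2)
          (x0 * y2 + x2 * y0 + a * x1 * y3 - a * x3 * y1)
          (x0 * y3 + x3 * y0 + x1 * y2 - x2 * y1).

Lemma quat_mul_of x0 x1 x2 x3 y0 y1 y2 y3 :
  quat_mul (quat_of x0 x1 x2 x3) (quat_of y0 y1 y2 y3) =
  quat_of (x0 * y0 + a * x1 * y1 + b * x2 * y2 - a * b * x3 * y3)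
          (x0 * y1 + x1 * y0 - b * x2 * y3 + b * x3 * y2)
          (x0 * y2 + x2 * y0 + a * x1 * y3 - a * x3 * y1)
          (x0 * y3 + x3 * y0 + x1 * y2 - x2 * y1).
Proof.
rewrite /quat_mul; have [-> -> -> ->] := quat_ofE x0 x1 x2 x3.
by have [-> -> -> ->] := quat_ofE y0 y1 y2 y3.
Qed.

Lemma quat_add_of x0 x1 x2 x3 y0 y1 y2 y3 :
  quat_of x0 x1 x2 x3 + quat_of y0 y1 y2 y3 = quat_of (x0 + y0) (x1 + y1) (x2 + y2) (x3 + y3).
Proof. by apply/rowP => -[[|[|[|[|]]]]] // h; rewrite !mxE. Qed.

Lemma quat_scale_of c x0 x1 x2 x3 :
  c *: quat_of x0 x1 x2 x3 = quat_of (c * x0) (c * x1) (c * x2) (c * x3).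
Proof. by apply/rowP => -[[|[|[|[|]]]]] // h; rewrite !mxE. Qed.

Lemma quat_ext x0 x1 x2 x3 y0 y1 y2 y3 : x0 = y0 -> x1 = y1 -> x2 = y2 -> x3 = y3 ->
  quat_of x0 x1 x2 x3 = quat_of y0 y1 y2 y3.
Proof. by move=> -> -> -> ->. Qed.

Definition quat_one : quaternion := quat_of 1 0 0 0.

Lemma quat_mulA : associative quat_mul.
Proof.
move=> x y z; rewrite (quat_eta x) (quat_eta y) (quat_eta z) !quat_mul_of.
by apply: quat_ext; ring.
Qed.

Lemma quat_mul1l : left_id quat_one quat_mul.
Proof. by move=> x; rewrite (quat_eta x) quat_mul_of; apply: quat_ext; ring. Qed.

Lemma quat_mul1r : right_id quat_one quat_mul.
Proof. by move=> x; rewrite (quat_eta x) quat_mul_of; apply: quat_ext; ring. Qed.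

Lemma quat_mulDl : left_distributive quat_mul +%R.
Proof.
move=> x y z; rewrite (quat_eta x) (quat_eta y) (quat_eta z) !(quat_mul_of, quat_add_of).
by apply: quat_ext; ring.
Qed.

Lemma quat_mulDr : right_distributive quat_mul +%R.
Proof.
move=> x y z; rewrite (quat_eta x) (quat_eta y) (quat_eta z) !(quat_mul_of, quat_add_of).
by apply: quat_ext; ring.
Qed.

Lemma quat_one_neq0 : quat_one != 0.
Proof.
apply/eqP => /rowP/(_ ord0); rewrite !mxE /= => /eqP; by rewrite oner_eq0.
Qed.

HB.instance Definition _ := GRing.Zmodule_isNzRing.Build quaternion
  quat_mulA quat_mul1l quat_mul1r quat_mulDl quat_mulDr quat_one_neq0.

Lemma quat_scalerAl (c : k) (x y : quaternion) : c *: (x * y) = c *: x * y.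
Proof.
rewrite (quat_eta x) (quat_eta y) /GRing.mul /= !(quat_mul_of, quat_scale_of).
by apply: quat_ext; ring.
Qed.

Lemma quat_scalerAr (c : k) (x y : quaternion) : c *: (x * y) = x * (c *: y).
Proof.
rewrite (quat_eta x) (quat_eta y) /GRing.mul /= !(quat_mul_of, quat_scale_of).
by apply: quat_ext; ring.
Qed.

HB.instance Definition _ := GRing.Lmodule_isLalgebra.Build k quaternion quat_scalerAl.
HB.instance Definition _ := GRing.Lalgebra_isAlgebra.Build k quaternion quat_scalerAr.
HB.instance Definition _ := Algebra_isFalgebra.Build k quaternion.

Lemma quaternionM_of x0 x1 x2 x3 y0 y1 y2 y3 :
  quat_of x0 x1 x2 x3 * quat_of y0 y1 y2 y3 =
  quat_of (x0 * y0 + a * x1 * y1 + b * x2 * y2 - a * b * x3 * y3)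
          (x0 * y1 + x1 * y0 - b * x2 * y3 + b * x3 * y2)
          (x0 * y2 + x2 * y0 + a * x1 * y3 - a * x3 * y1)
          (x0 * y3 + x3 * y0 + x1 * y2 - x2 * y1).
Proof. exact: quat_mul_of. Qed.

Lemma quat_inj x0 x1 x2 x3 y0 y1 y2 y3 : quat_of x0 x1 x2 x3 = quat_of y0 y1 y2 y3 ->
  [/\ x0 = y0, x1 = y1, x2 = y2 & x3 = y3].
Proof.
move=> e; have h i := congr1 (fun q : quaternion => q ord0 i) e.
move: (h i0) (h i1) (h i2) (h i3); have [-> -> -> ->] := quat_ofE x0 x1 x2 x3.
by have [-> -> -> ->] := quat_ofE y0 y1 y2 y3.
Qed.

Lemma nonsquare_norm0 (p q : k) : nonsquare a -> p ^+ 2 - a * q ^+ 2 = 0 -> p = 0 /\ q = 0.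
Proof.
move=> na /eqP; rewrite subr_eq0 => /eqP e; have [q0|q0] := eqVneq q 0.
  by move/eqP: e; rewrite q0 expr0n mulr0 sqrf_eq0 => /eqP.
by case/negP: (na (p / q)); apply/eqP; rewrite -expr2 expr_div_n e mulfK // expf_neq0.
Qed.

(** If the reduced norm of a nonzero element vanished, [b] would be a quotient of two norms from
    [k(sqrt a)], hence a norm. *)
Lemma quaternion_division : 1 + 1 != 0 :> k -> nonsquare a -> b != 0 ->
  (forall p q, p ^+ 2 - a * q ^+ 2 <> b) -> Br_nontrivial k.
Proof.
move=> k2 na b0 nb; have a0 : a != 0 by have := na 0; rewrite mul0r eq_sym.
exists quaternion; split.
- move=> z z0; pose z0' := z ord0 i0; pose z1 := z ord0 i1; pose z2 := z ord0 i2; pose z3 := z ord0 i3.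
  have zE : z = quat_of z0' z1 z2 z3 by apply: quat_eta.
  pose N := (z0' ^+ 2 - a * z1 ^+ 2) - b * (z2 ^+ 2 - a * z3 ^+ 2).
  have N0 : N != 0.
    apply/eqP => /eqP; rewrite subr_eq0 => /eqP e.
    have [n0|n0] := eqVneq (z2 ^+ 2 - a * z3 ^+ 2) 0.
      have [e2 e3] := nonsquare_norm0 na n0.
      move: e; rewrite n0 mulr0 => /(nonsquare_norm0 na)[e0 e1].
      by case/eqP: z0; rewrite zE e0 e1 e2 e3; apply/rowP => -[[|[|[|[|]]]]] // h; rewrite !mxE.
    (* The coordinates of the quotient of [z0' + z1 sqrt a] by [z2 + z3 sqrt a]. *)
    apply: (nb ((z0' * z2 - a * z1 * z3) / (z2 ^+ 2 - a * z3 ^+ 2))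
               ((z1 * z2 - z0' * z3) / (z2 ^+ 2 - a * z3 ^+ 2))).
    have id : (z0' * z2 - a * z1 * z3) ^+ 2 - a * (z1 * z2 - z0' * z3) ^+ 2 =
      (z0' ^+ 2 - a * z1 ^+ 2) * (z2 ^+ 2 - a * z3 ^+ 2) by ring.
    have gen (P Q n : k) : n != 0 -> (P / n) ^+ 2 - a * (Q / n) ^+ 2 = (P ^+ 2 - a * Q ^+ 2) / n ^+ 2.
      by move=> nn; field.
    by rewrite gen // id e; move: (z2 ^+ 2 - _) n0 => n nn; field.
  apply/unitrP; exists (quat_of (z0' / N) (- z1 / N) (- z2 / N) (- z3 / N)).
  rewrite zE !quaternionM_of -/quat_one.
  by split; (rewrite -[RHS]/quat_one; apply: quat_ext; rewrite /N; field; move: N0; rewrite /N).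
- move=> z zC; exists (z ord0 i0).
  pose z0 := z ord0 i0; pose z1 := z ord0 i1; pose z2 := z ord0 i2; pose z3 := z ord0 i3.
  have zE : z = quat_of z0 z1 z2 z3 by apply: quat_eta.
  have dbl (t L R : k) : L = R -> t + t = R - L -> t = 0.
    move=> -> /eqP; rewrite subrr -[t]mul1r -mulrDl mulf_eq0 (negPf k2) mul1r => /eqP //.
  (* Commuting with [i] makes twice the coordinates of [j] and [ij] vanish, and commuting with [j]
     twice that of [i]. *)
  have [e2 e3] : z2 = 0 /\ z3 = 0.
    have := zC (quat_of 0 1 0 0); rewrite zE !quaternionM_of => /quat_inj[_ _ h2 h3]; split.
      by apply: (dbl _ _ _ h3); ring.
    by apply: (mulfI a0); rewrite mulr0; apply: (dbl _ _ _ h2); ring.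
  have e1 : z1 = 0.
    have := zC (quat_of 0 0 1 0); rewrite zE !quaternionM_of => /quat_inj[_ _ _ h].
    by apply: (dbl _ _ _ (esym h)); ring.
  rewrite [LHS]zE e1 e2 e3 -[1]/quat_one quat_scale_of.
  by apply: quat_ext; rewrite ?mulr1 ?mulr0.
- by rewrite dimvf /dim.
Qed.
End QuaternionAlgebra.

Section QuaternionSplitting.
Variables (k : fieldType) (a c : k).
Hypothesis k2 : 1 + 1 != 0 :> k.
Hypothesis na : nonsquare a.

Lemma mx22_eq (M N : 'M[k]_2) : M ord0 ord0 = N ord0 ord0 -> M ord0 ord_max = N ord0 ord_max ->
  M ord_max ord0 = N ord_max ord0 -> M ord_max ord_max = N ord_max ord_max -> M = N.
Proof.
move=> h1 h2 h3 h4; apply/matrixP => i j.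
have [ei ej] : (i = ord0 \/ i = ord_max) /\ (j = ord0 \/ j = ord_max).
  by split; [case: i | case: j] => -[|[|]] // h; [left|right|left|right]; apply: val_inj.
by case: ei => ->; case: ej => ->.
Qed.

Lemma mx22_mul (M N : 'M[k]_2) i j :
  (M *m N) i j = M i ord0 * N ord0 j + M i ord_max * N ord_max j.
Proof.
by rewrite mxE big_ord_recl big_ord1; congr (_ + M i _ * N _ j); apply: val_inj.
Qed.

Lemma quat_split_norm : quat_split a c -> exists p q, p ^+ 2 - a * q ^+ 2 = c.
Proof.
move=> [U [V [UU VV UV _]]].
have e A B i j : A = B :> 'M[k]_2 -> A i j = B i j by move=> ->.
have u1 := e _ _ ord0 ord0 UU; have u2 := e _ _ ord_max ord0 UU.
have v1 := e _ _ ord0 ord0 VV; have uv1 := e _ _ ord0 ord0 UV.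
rewrite [RHS]mxE !mx22_mul in uv1; rewrite !mx22_mul !mxE /= ?mulr1n ?mulr0n in u1 u2 v1.
move: (U ord0 ord0) (U ord0 ord_max) (U ord_max ord0) (U ord_max ord_max)
  (V ord0 ord0) (V ord0 ord_max) (V ord_max ord0) (V ord_max ord_max) u1 u2 v1 uv1.
move=> u11 u12 u21 u22 v11 v12 v21 v22 u1 u2 v1 uv1.
have u21n : u21 != 0.
  by apply/eqP => u0; have := na u11; rewrite -u1 u0 mulr0 addr0 eqxx.
have u22E : u22 = - u11.
  by apply/eqP; rewrite -addr_eq0; move/eqP: u2; rewrite [u21 * u11]mulrC -mulrDl mulf_eq0 (negPf u21n) orbF addrC.
(* With these witnesses [V e1 = p e1 + q U e1] for the first basis vector [e1]. Applying [V] once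
   more, with [V U = - U V], gives [c = p^2 - a q^2]. *)
exists (v11 - v21 / u21 * u11), (v21 / u21).
have u12E : u12 = (a - u11 * u11) / u21 by rewrite -u1 addrAC subrr add0r mulfK.
have uv1' : u12 * v21 = - (v11 * u11 + v12 * u21) - u11 * v11 by rewrite -uv1 addrAC subrr add0r.
have v12E : v12 = - (2 * u11 * v11 + u12 * v21) / u21.
  by rewrite uv1'; field.
rewrite -v1 v12E u12E; field; exact: u21n.
Qed.

(** On [k(sqrt a)] with basis [1], [sqrt a], take for [U] the multiplication by [sqrt a] and for [V]
    the conjugation followed by multiplication by [p + q sqrt a]. *)
Lemma norm_quat_split p q : c != 0 -> p ^+ 2 - a * q ^+ 2 = c -> quat_split a c.
Proof.
move=> c0 pq; have a0 : a != 0 by have := na 0; rewrite mul0r eq_sym.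
pose mx (x y z t : k) : 'M[k]_2 := \matrix_(i, j) if i == ord0 then (if j == ord0 then x else y)
  else (if j == ord0 then z else t).
exists (mx 0 a 1 0), (mx p (- (q * a)) q (- p)); split.
- by apply: mx22_eq; rewrite mx22_mul !mxE /= ?mulr1n ?mulr0n; ring.
- by apply: mx22_eq; rewrite mx22_mul !mxE /= ?mulr1n ?mulr0n -?pq; ring.
- by apply: mx22_eq; rewrite [RHS]mxE !mx22_mul !mxE /=; ring.
have -> : mx 0 a 1 0 *m mx p (- (q * a)) q (- p) = mx (a * q) (- (a * p)) p (- (q * a)).
  by apply: mx22_eq; rewrite mx22_mul !mxE /=; ring.
move=> c0' c1 c2 c3 /matrixP e.
have := e ord0 ord0; have := e ord0 ord_max; have := e ord_max ord0; have := e ord_max ord_max.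
rewrite !mxE /= ?mulr1n ?mulr0n => e4 e3 e2 e1.
have dbl (t L R : k) : L = 0 -> R = 0 -> t + t = L + R -> t = 0.
  move=> -> -> /eqP; rewrite addr0 -[t]mul1r -mulrDl mulf_eq0 (negPf k2) mul1r => /eqP //.
have c00 : c0' = 0 by apply: (dbl _ _ _ e1 e4); ring.
have c11 : c1 = 0.
  have e3' : a * (c0' * 0 + c1 * 1 + c2 * q + c3 * p) = 0 by rewrite e3 mulr0.
  by apply: (mulfI a0); rewrite mulr0; apply: (dbl _ _ _ e2 e3'); ring.
have f1 : c2 * p + c3 * a * q = 0 by rewrite -e1 c00 c11; ring.
have f2 : c2 * q + c3 * p = 0 by rewrite -e3 c00 c11; ring.
have c20 : c2 = 0.
  apply: (mulfI c0); rewrite mulr0 -pq.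
  by transitivity (p * (c2 * p + c3 * a * q) - a * q * (c2 * q + c3 * p)); [ring | rewrite f1 f2; ring].
have c30 : c3 = 0.
  apply: (mulfI c0); rewrite mulr0 -pq.
  by transitivity (p * (c2 * q + c3 * p) - q * (c2 * p + c3 * a * q)); [ring | rewrite f1 f2; ring].
by [].
Qed.
End QuaternionSplitting.

(** At twice the largest leading monomial [M] of [P], [Q], [R], the relation is one between the
    squares of their coefficients at [M]. Anisotropy makes all three zero, although one of them
    should be a leading coefficient. *)
Lemma mpoly_anisotropic (k : fieldType) m (d e : k) (P Q R : {mpoly k[m]}) :
  (forall x y z, x ^+ 2 = d * y ^+ 2 + e * z ^+ 2 -> [/\ x = 0, y = 0 & z = 0]) ->
  P * P = d *: (Q * Q) + e *: (R * R) -> R = 0.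
Proof.
move=> aniso PQR; apply/eqP/negPn/negP => R0.
pose M := Order.max (mlead P) (Order.max (mlead Q) (mlead R)).
have [lP lQ lR] : [/\ (mlead P <= M)%O, (mlead Q <= M)%O & (mlead R <= M)%O].
  by rewrite /M !le_max !lexx !orbT.
have sq (p : {mpoly k[m]}) : (mlead p <= M)%O -> (p * p)@_(M + M)%MM = p@_M ^+ 2.
  by move=> lp; rewrite mleadcMW.
have := congr1 (fun p : {mpoly k[m]} => p@_(M + M)%MM) PQR.
rewrite mcoeffD !mcoeffZ !sq // => /aniso[zP zQ zR].
have lt (p : {mpoly k[m]}) : (mlead p <= M)%O -> p@_M = 0 -> p != 0 -> (mlead p < M)%O.
  move=> lp z p0; rewrite lt_neqAle lp andbT; apply/eqP => e0.
  by move: z; rewrite -e0 => /eqP; rewrite mleadc_eq0 (negPf p0).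
have Rlt := lt R lR zR R0.
(* The zero polynomial also has a leading monomial, the least one; this case is excluded because the
   leading monomial of [R] is strictly below [M]. *)
have zero (p : {mpoly k[m]}) : mlead p = M -> p@_M = 0 -> False.
  move=> pM z; have p0 : p = 0 by apply/eqP; rewrite -mleadc_eq0 pM z.
  by move: Rlt; rewrite -pM p0 mlead0 ltNge le0m.
have : M = mlead P \/ M = mlead Q \/ M = mlead R.
  by rewrite /M; case: (leP (mlead P)) => _; auto; case: (leP (mlead Q)) => _; auto.
case=> [/esym/zero /(_ zP)|[/esym/zero /(_ zQ)|e0]] //.
by move: Rlt; rewrite -e0 ltxx.
Qed.

Lemma quotient_add (E : fieldType) (p q p' q' p2 q2 : E) : q != 0 -> q' != 0 -> q2 != 0 ->
  p2 * (q * q') = (p * q' + p' * q) * q2 -> p2 / q2 = p / q + p' / q'.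
Proof.
move=> q0 q0' q20 e; have qq : q * q' != 0 by rewrite mulf_neq0.
by apply: (mulIf q20); apply: (mulIf qq); rewrite divfK // e; field; rewrite q0 q0'.
Qed.

Lemma quotient_mul (E : fieldType) (p q p' q' p2 q2 : E) : q != 0 -> q' != 0 -> q2 != 0 ->
  p2 * (q * q') = (p * p') * q2 -> p2 / q2 = (p / q) * (p' / q').
Proof.
move=> q0 q0' q20 e; have qq : q * q' != 0 by rewrite mulf_neq0.
by apply: (mulIf q20); apply: (mulIf qq); rewrite divfK // e; field; rewrite q0 q0'.
Qed.

(** Numerators and denominators are chosen arbitrarily; their fraction does not depend on the choice
    because [f] is injective. Outside [L] the chosen pair is a dummy. *)
Lemma fraction_section (R : idomainType) (F : fieldType) (f : {rmorphism R -> F}) (L : F -> Prop) :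
  (forall p, f p = 0 -> p = 0) -> (forall z, L z -> exists p q, f q != 0 /\ z = f p / f q) ->
  exists phi : F -> {fraction R},
    [/\ forall z w, L z -> L w -> L (z + w) -> phi (z + w) = phi z + phi w,
        forall z w, L z -> L w -> L (z * w) -> phi (z * w) = phi z * phi w,
        forall c, L (f c) -> phi (f c) = tofrac c &
        forall z w, L z -> L w -> phi z = phi w -> z = w].
Proof.
move=> f0 Lf.
have fi p q : f p = f q -> p = q.
  by move=> e; apply/eqP; rewrite -subr_eq0; apply/eqP/f0; rewrite rmorphB e subrr.
have h z : exists pq : R * R, L z -> f pq.2 != 0 /\ z = f pq.1 / f pq.2.
  have [/Lf[p [q h]]|nL] := classic (L z); first by exists (p, q).
  by exists (0, 0).
have [g hg] := choice _ h.
have nz p : f p != 0 -> tofrac p != 0 :> {fraction R}.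
  by apply: contraNneq => /eqP; rewrite tofrac_eq0 => /eqP ->; rewrite rmorph0.
exists (fun z => tofrac (g z).1 / tofrac (g z).2); split.
- move=> z w /hg[z0 zE] /hg[w0 wE] /hg[s0 sE].
  move: (g z) (g w) (g (z + w)) z0 zE w0 wE s0 sE => [p q] [p' q'] [p2 q2] /= q0 zE q0' wE q20 sE.
  have e : p2 * (q * q') = (p * q' + p' * q) * q2.
    apply: fi; rewrite !(rmorphM, rmorphD); apply: (mulIf (invr_neq0 q20)).
    rewrite mulrAC -sE zE wE; field; by rewrite q0 q0' q20.
  have := congr1 (@FracField.tofrac R) e; rewrite !(rmorphM, rmorphD) => e'.
  exact: (quotient_add (nz _ q0) (nz _ q0') (nz _ q20)).
- move=> z w /hg[z0 zE] /hg[w0 wE] /hg[s0 sE].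
  move: (g z) (g w) (g (z * w)) z0 zE w0 wE s0 sE => [p q] [p' q'] [p2 q2] /= q0 zE q0' wE q20 sE.
  have e : p2 * (q * q') = (p * p') * q2.
    apply: fi; rewrite !(rmorphM, rmorphD); apply: (mulIf (invr_neq0 q20)).
    rewrite mulrAC -sE zE wE; field; by rewrite q0 q0' q20.
  have := congr1 (@FracField.tofrac R) e; rewrite !(rmorphM, rmorphD) => e'.
  exact: (quotient_mul (nz _ q0) (nz _ q0') (nz _ q20)).
- move=> c /hg[]; move: (g (f c)) => [p q] /= q0 cE.
  have e : p = c * q by apply: fi; rewrite rmorphM cE divfK.
  by rewrite e rmorphM mulfK ?nz.
- move=> z w /hg[z0 zE] /hg[w0 wE].
  move: (g z) (g w) z0 zE w0 wE => [p q] [p' q'] /= q0 zE q0' wE /eqP.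
  rewrite eqr_div ?nz // -!rmorphM tofrac_eq => /eqP e.
  rewrite zE wE; apply/eqP; rewrite eqr_div // -!rmorphM e; by [].
Qed.

Lemma conic_clear (E : fieldType) (p s q t a d : E) : s != 0 -> t != 0 ->
  p / s * (p / s) = a * (q / t * (q / t)) + d ->
  p * t * (p * t) = a * (q * s * (q * s)) + d * (s * t * (s * t)).
Proof.
move=> s0 t0 e; transitivity (p / s * (p / s) * (s * t) ^+ 2); first by field.
by rewrite e; field.
Qed.

Section Unirationality.
Variables (k : fieldType) (K : fieldExtType k).
Local Notation RF := (RF K).

Lemma k_rational_unirational (L : RF -> Prop) : k_rational L ->
  (forall z w, L z -> L w -> L (z + w)) -> (forall z w, L z -> L w -> L (z * w)) ->
  (forall c, L (ck K c)) -> k_unirational L.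
Proof.
move=> [m [t [ind Lt]]] LD LM Lc; exists m.
have [] := @fraction_section _ _ (mmap (ckf K) t : {rmorphism {mpoly k[m]} -> RF}) L.
- exact: ind.
- by move=> z /Lt.
move=> phi [phiD phiM phic phiI]; exists phi; split.
  by move=> z w Lz Lw; apply: phiD => //; apply: LD.
split; first by move=> z w Lz Lw; apply: phiM => //; apply: LM.
split=> // c; have Lk : L (kval t c%:MP) by rewrite kvalC.
by rewrite -(kvalC t); apply: phic.
Qed.

Lemma unirational_norm (L : RF -> Prop) (A B : RF) (a b : k) :
  1 + 1 != 0 :> k -> nonsquare a -> b != 0 ->
  (forall z w, L z -> L w -> L (z + w)) -> (forall z w, L z -> L w -> L (z * w)) ->
  (forall c, L (ck K c)) -> L A -> L B ->
  B * B = ck K a * (A * A) + ck K (4 * a * b) -> k_unirational L ->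
  exists p q, p ^+ 2 - a * q ^+ 2 = - b.
Proof.
move=> k2 na b0 LD LM Lc LA LB AB [m [phi [phiD [phiM [phic _]]]]].
apply: NNPP => nn; have a0 : a != 0 by have := na 0; rewrite mul0r eq_sym.
have four : 4 = (1 + 1) ^+ 2 :> k by ring.
have aniso x y z : x ^+ 2 = a * y ^+ 2 + 4 * a * b * z ^+ 2 -> [/\ x = 0, y = 0 & z = 0].
  move=> e; have [z0|z0] := eqVneq z 0.
    have [//|-> ->//] := @nonsquare_norm0 k a x y na.
    by apply/eqP; rewrite subr_eq0 e z0; apply/eqP; ring.
  (* Division of [- 4 a b z^2 = a y^2 - x^2] by [4 a z^2] gives these coordinates. *)
  case: nn; exists (y / ((1 + 1) * z)), (x / (a * ((1 + 1) * z))).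
  have zz : (1 + 1) * z != 0 by rewrite mulf_neq0.
  move: e; rewrite four (_ : _ + _ = a * y ^+ 2 + a * b * ((1 + 1) * z) ^+ 2); last by ring.
  move: ((1 + 1) * z) zz => z' zz e.
  transitivity ((a * y ^+ 2 - x ^+ 2) / (a * z' ^+ 2)); first by field; rewrite a0 zz.
  by rewrite e; field; rewrite a0 zz.
have e : phi B * phi B = tofrac (a%:MP) * (phi A * phi A) + tofrac ((4 * a * b)%:MP) :> {fraction {mpoly k[m]}}.
  have LAA := LM _ _ LA LA; have LaA := LM _ _ (Lc a) LAA.
  by rewrite -(phiM _ _ LB LB) AB (phiD _ _ LaA (Lc _)) (phiM _ _ (Lc a) LAA) (phiM _ _ LA LA) !phic.
have [P [S [S0 EB]]] := frac_quotient (phi B).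
have [Q [T [T0 EA]]] := frac_quotient (phi A).
have e2 : (P * T) * (P * T) = a *: ((Q * S) * (Q * S)) + (4 * a * b) *: ((S * T) * (S * T)).
  apply/eqP; rewrite -tofrac_eq; apply/eqP; rewrite -!mul_mpolyC.
  move: e; rewrite EB EA; move: (mpolyC m a) (mpolyC m (4 * a * b)) => c1 c2 e.
  rewrite !(rmorphD, rmorphM) /=; move: e.
  have nz (p : {mpoly k[m]}) : p != 0 -> tofrac p != 0 :> {fraction {mpoly k[m]}}.
    by rewrite tofrac_eq0.
  exact: (conic_clear (nz _ S0) (nz _ T0)).
have := mpoly_anisotropic aniso e2.
by apply/eqP; rewrite mulf_neq0.
Qed.
End Unirationality.

(** * The exceptional quotients *)

Section SmallGroups.
Variables (rT : finGroupType) (Q : {group rT}).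
Local Open Scope group_scope.

Lemma order_four (s : rT) : s ^+ 4 = 1 -> s ^+ 2 != 1 -> #[s] = 4%N.
Proof.
move=> s4 s2; have d4 : (#[s] %| 4)%N by rewrite order_dvdn s4.
have : #[s] \in divisors 4 by rewrite -dvdn_divisors.
rewrite !inE => /or3P[] /eqP o //; case/negP: s2; rewrite -order_dvdn o //.
Qed.

Lemma cyclic_Zp4 : cyclic (Zp 4).
Proof.
apply/cyclicP; exists (Zp1 : 'Z_4); apply/setP=> x.
by rewrite /Zp /= inE; apply/esym/cycleP; exists x; rewrite Zp_expg; case: x => -[|[|[|[|x]]]] //= lx; apply/val_inj.
Qed.

Lemma cyclic4_isog (s : rT) : s ^+ 4 = 1 -> s ^+ 2 != 1 -> <[s]> = Q -> Q \isog Zp 4.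
Proof.
move=> s4 s2 sQ; have oQ : #|Q| = 4%N by rewrite -sQ -/(order s) order_four.
have cQ : cyclic Q by rewrite -sQ cycle_cyclic.
by rewrite isog_cyclic_card // cyclic_Zp4 oQ card_Zp.
Qed.

Lemma isog_cyclic4 : Q \isog Zp 4 -> exists s : rT, [/\ s ^+ 4 = 1, s ^+ 2 != 1 & <[s]> = Q].
Proof.
move=> iso; have oQ : #|Q| = 4%N by rewrite (card_isog iso) card_Zp.
have /cyclicP[s sQ] : cyclic Q by rewrite (isog_cyclic iso) cyclic_Zp4.
have os : #[s] = 4%N by rewrite /order -sQ.
have s4 : (#[s] %| 4)%N by rewrite os.
by exists s; split=> //; [apply/eqP; rewrite -order_dvdn | rewrite -order_dvdn os].
Qed.

Lemma dihedral8_isog (s t : rT) : s ^+ 4 = 1 -> s ^+ 2 != 1 -> t ^+ 2 = 1 -> s ^ t = s^-1 ->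
  <[s]> <*> <[t]> = Q -> Q \isog 'D_8.
Proof.
move=> s4 s2 t2 st Qst; have o4 := order_four s4 s2.
have ts : t \notin <[s]>.
  apply/negP => /cycleP[i ti]; case/negP: s2; rewrite expgS expg1 -eq_invg_mul -st conjgE.
  by rewrite (_ : s * t = t * s) ?mulKg // ti; apply: commuteX.
have hom : Q \homg 'D_8.
  rewrite (@Grp_dihedral 4 isT); apply/existsP; exists (s, t) => /=.
  by rewrite !xpair_eqE -Qst s4 t2 st !eqxx.
rewrite isogEcard hom (@card_dihedral 4 isT) /=.
have sQ : <[s]> \subset Q by rewrite -Qst joing_subl.
have tQ : t \in Q by rewrite -Qst (subsetP (joing_subr _ _)) ?cycle_id.
have : (#|<[s]>| %| #|Q|)%N by rewrite cardSg.
have lt : (#[s] < #|Q|)%N.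
  apply: proper_card; apply/properP; split=> //; by exists t.
rewrite -/(order s) o4 => /dvdnP[m mQ]; rewrite o4 mQ in lt *.
by case: m lt mQ => [|[|m]] // _ _; rewrite !mulSn leq_addr.
Qed.

Lemma isog_dihedral8 : Q \isog 'D_8 -> exists s t : rT,
  [/\ s ^+ 4 = 1, s ^+ 2 != 1, t ^+ 2 = 1, s ^ t = s^-1 & <[s]> <*> <[t]> = Q].
Proof.
move=> iso; have oQ : #|Q| = 8%N by rewrite (card_isog iso) (@card_dihedral 4 isT).
have := isog_hom iso; rewrite (@Grp_dihedral 4 isT) => /existsP[[s t]] /= /eqP[Qst s4 t2 st].
exists s, t; split=> //; apply/negP => /eqP s2.
(* If [s^2 = 1], then [s] and [t] commute and generate at most 4 elements. *)
have cst : commute t s.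
  have st' : s ^ t = s by rewrite st; apply/eqP; rewrite eq_invg_mul -expg2 s2.
  by rewrite /commute -{1}st' -conjgC.
have : (#|Q| <= #[s] * #[t])%N.
  rewrite -Qst cent_joinEl; last by rewrite cent_cycle cycle_subG; apply/cent1P.
  by rewrite /order mul_cardG leq_pmulr ?cardG_gt0.
have os : (#[s] <= 2)%N by rewrite dvdn_leq // order_dvdn s2.
have ot : (#[t] <= 2)%N by rewrite dvdn_leq // order_dvdn t2.
by rewrite oQ leqNgt (leq_ltn_trans (leq_mul os ot)).
Qed.
End SmallGroups.

(** * Changes of coordinates *)

Section SameField.
Variable F : fieldType.
Implicit Types (S K : divringClosed F) (x y X Y z : F).

(** Quantified over all subfields [S], so that a change of coordinates applies to [K(x, y)] and
    [k(x, y)] at once. *)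
Definition same_field x y X Y := forall S,
  [/\ X \in adj (adj S x) y, Y \in adj (adj S x) y,
      x \in adj (adj S X) Y & y \in adj (adj S X) Y].

Lemma adj2_sub S S' x y : {subset S <= S'} -> x \in S' -> y \in S' ->
  {subset adj (adj S x) y <= S'}.
Proof. by move=> sS xS yS; apply: adj_min => //; apply: adj_min. Qed.

Lemma adj2_base S x y : {subset S <= adj (adj S x) y}.
Proof. by move=> z zS; do 2!apply: adj_base. Qed.

Lemma adj2_gen1 S x y : x \in adj (adj S x) y.
Proof. by apply: adj_base; apply: adj_gen. Qed.

Lemma same_fieldP x y X Y S z : same_field x y X Y ->
  (z \in adj (adj S x) y) = (z \in adj (adj S X) Y).
Proof.
move=> /(_ S)[a b c d].
by apply/idP/idP; apply: adj2_sub => //; apply: adj2_base.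
Qed.

Lemma same_field_trans x y X Y X' Y' :
  same_field x y X Y -> same_field X Y X' Y' -> same_field x y X' Y'.
Proof.
move=> h h' S; have [a b c d] := h S; have [a' b' c' d'] := h' S.
by split; rewrite ?(same_fieldP _ _ h) -?(same_fieldP _ _ h').
Qed.

Lemma same_field_tr K x y X Y : same_field x y X Y ->
  ~ alg K x -> ~ alg (adj K x) y -> ~ alg K X /\ ~ alg (adj K X) Y.
Proof.
move=> /(_ K)[_ _ xK yK] trx try.
by apply: (exchange trx try); apply: alg_id.
Qed.

Lemma same_field_fixed K x y X Y (f : {rmorphism F -> F}) : same_field x y X Y ->
  (forall s, s \in K -> f s = s) ->
  (f x = x /\ f y = y) <-> (f X = X /\ f Y = Y).
Proof.
move=> /(_ K)[a b c d] fK; split=> -[e e'].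
  by split; apply: (@fix_adj F (adj K x) f y) => //; apply: fix_adj.
by split; apply: (@fix_adj F (adj K X) f Y) => //; apply: fix_adj.
Qed.

Lemma same_field_rotate x y : x != 0 -> y != 0 -> same_field x y y (x * y)^-1.
Proof.
move=> x0 y0 S; split.
- by apply: adj_gen.
- by rewrite rpredV; apply: rpredM; [apply: adj2_gen1 | apply: adj_gen].
- have e : x = y^-1 * ((x * y)^-1)^-1 by rewrite invrK mulrC mulfK.
  by rewrite [X in X \in _]e; apply: rpredM; rewrite rpredV; [apply: adj2_gen1 | apply: adj_gen].
- by apply: adj2_gen1.
Qed.

Lemma cayley_neq0 S x : 1 + 1 != 0 :> F -> ~ alg S x -> x != 0 /\ 1 + x != 0.
Proof.
move=> n2 trx; split; apply/eqP => e; apply: trx; apply: alg_id.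
  by rewrite e rpred0.
by rewrite (_ : x = -1) ?rpredN ?rpred1 //; apply/eqP; rewrite -subr_eq0 opprK addrC e.
Qed.

Definition cayley x := (1 - x) / (1 + x).

Lemma cayleyK x : 1 + 1 != 0 :> F -> 1 + x != 0 -> x = cayley (cayley x).
Proof.
move=> n2 x1; have x2 : 1 + x + (1 - x) != 0 by rewrite (_ : 1 + x + (1 - x) = 1 + 1) //; ring.
by rewrite /cayley; field; rewrite ?x1 ?x2.
Qed.

Lemma cayleyV x : x != 0 -> 1 + x != 0 -> cayley x^-1 = - cayley x.
Proof.
by move=> x0 x1; rewrite /cayley; field; rewrite x0 x1 ?(addrC x) ?x1.
Qed.

Lemma cayley_in S x : x \in S -> cayley x \in S.
Proof. by move=> xS; rewrite /cayley rpred_div // ?rpredB ?rpredD ?rpred1. Qed.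

Lemma rmorph_cayley (f : {rmorphism F -> F}) x : f (cayley x) = cayley (f x).
Proof. by rewrite /cayley fmorph_div rmorphB rmorphD rmorph1. Qed.

Lemma same_field_cayley x y : 1 + 1 != 0 :> F -> 1 + x != 0 -> 1 + y != 0 ->
  same_field x y (cayley x) (cayley y).
Proof.
move=> n2 x1 y1 S; split.
- by apply/cayley_in/adj2_gen1.
- by apply/cayley_in/adj_gen.
- by rewrite {1}[x]cayleyK //; apply/cayley_in/adj2_gen1.
- by rewrite {1}[y]cayleyK //; apply/cayley_in/adj_gen.
Qed.

Definition signed_perm2 X Y (f : F -> F) :=
  ((f X = X \/ f X = - X) /\ (f Y = Y \/ f Y = - Y)) \/
  ((f X = Y \/ f X = - Y) /\ (f Y = X \/ f Y = - X)).

Lemma signed_cayley x y (f : {rmorphism F -> F}) : x != 0 -> 1 + x != 0 -> y != 0 -> 1 + y != 0 ->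
  signed_swap x y f -> signed_perm2 (cayley x) (cayley y) f.
Proof.
move=> x0 x1 y0 y1; rewrite /signed_perm2 !rmorph_cayley.
by case=> -[[|] -> [|] ->]; rewrite ?cayleyV //; [left|left|left|left|right|right|right|right];
   split; auto.
Qed.
End SameField.

Section NoThreeCycle.
Variables (gT : finGroupType) (F : fieldType) (act : gT -> {rmorphism F -> F}).
Variables (G : {group gT}) (K : divringClosed F).
Hypothesis actG : acts_auto act G.
Variables x y : F.
Hypothesis tr_x : ~ alg K x.
Hypothesis tr_y : ~ alg (adj K x) y.
Hypothesis hexG : forall g, g \in G -> hexagonal x y (act g).

(* A group of signed permutations of x, y, (xy)^-1 without 3-cycle contains at
   most one transposition up to inversion. *)
Lemma hex_signed_swap : (forall c, c \in G -> ~ (act c x = y /\ act c y = (x * y)^-1)) ->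
  exists X Y, same_field x y X Y /\ forall g, g \in G -> signed_swap X Y (act g).
Proof.
have [x0 y0 z0 _] := hex_neq0 tr_x tr_y.
have actM g h z : g \in G -> h \in G -> act (g * h)%g z = act g (act h z) by case: actG => _; apply.
have [z zE] : exists z, z = (x * y)^-1 by exists (x * y)^-1.
rewrite -zE in z0 *; move=> no3.
have no3' g : g \in G -> ~ [/\ act g x = z, act g y = x & act g z = y].
  move=> gG [a b c]; apply: (no3 (g * g)%g); first by rewrite groupM.
  by rewrite !actM // a b c.
have no g : g \in G -> [/\ ~ [/\ act g x = y, act g y = z & act g z = x],
    ~ [/\ act g x = z, act g y = x & act g z = y],
    ~ [/\ act g x = y^-1, act g y = z^-1 & act g z = x^-1] &
    ~ [/\ act g x = z^-1, act g y = x^-1 & act g z = y^-1]].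
  move=> gG; have ggG : (g * g)%g \in G by rewrite groupM.
  split; first by move=> [a b _]; apply: (no3 g).
  - exact: no3'.
  - by move=> [a b c]; apply: (no3' _ ggG); rewrite !actM // a b c !fmorphV a b c !invrK.
  - by move=> [a b c]; apply: (no3 _ ggG); rewrite !actM // a b !fmorphV a c !invrK.
pose flip a b c g := (act g a = a /\ act g b = c /\ act g c = b) \/
                     (act g a = a^-1 /\ act g b = c^-1 /\ act g c = b^-1).
have cases g : g \in G -> [\/ (act g x = x /\ act g y = y /\ act g z = z) \/ (act g x = x^-1 /\ act g y = y^-1 /\ act g z = z^-1),
   flip z x y g, flip x y z g | flip y x z g].
  move=> gG; have [n1 n2 n3 n4] := no g gG.
  have := hexG gG; rewrite /flip; case; rewrite -zE => a b c.
  - by constructor 1; left.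
  - by case: n1.
  - by case: n2.
  - by constructor 2; left.
  - by constructor 3; left.
  - by constructor 4; left.
  - by constructor 1; right.
  - by case: n3.
  - by case: n4.
  - by constructor 2; right.
  - by constructor 3; right.
  - by constructor 4; right.
(* The product of two different transpositions is a 3-cycle, up to a common inversion. *)
have two g h : g \in G -> h \in G -> (flip z x y g /\ flip x y z h) \/ (flip z x y g /\ flip y x z h) \/
    (flip x y z g /\ flip y x z h) -> False.
  move=> gG hG; have [] := no (g * h)%g; first by rewrite groupM.
  rewrite !actM // => n1 n2 n3 n4.
  by case=> [[[|] [a [b c]] [|] [a' [b' c']]]|[[[|] [a [b c]] [|] [a' [b' c']]]|[[|] [a [b c]] [|] [a' [b' c']]]]];
   rewrite ?a' ?b' ?c' ?fmorphV ?a ?b ?c ?invrK in n1 n2 n3 n4;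
   solve [case: n1; split=> // | case: n2; split=> // | case: n3; split=> // | case: n4; split=> //].
have [[g [gG fg]]|nz] := classic (exists g, g \in G /\ flip z x y g).
  exists x, y; split=> [S|h hG].
    by split; [apply: adj2_gen1 | apply: adj_gen | apply: adj2_gen1 | apply: adj_gen].
  case: (cases h hG) => [[|] [a [b c]]|[|] [a [b c]]|e|e]; rewrite /signed_swap ?a ?b; try by auto 6.
    by case: (two g h); auto.
  by case: (two g h); auto.
have r1 : same_field x y y z by rewrite zE; apply: same_field_rotate.
have r2 : same_field x y z x.
  have e : x = (y * z)^-1 by rewrite zE invfM invrK mulrC mulfK.
  by apply: same_field_trans r1 _; rewrite [X in same_field _ _ _ X]e; apply: same_field_rotate.
have [[g [gG fg]]|nx] := classic (exists g, g \in G /\ flip x y z g).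
  exists y, z; split=> // h hG.
  case: (cases h hG) => [[|] [a [b c]]|e|[|] [a [b c]]|e]; rewrite /signed_swap ?b ?c; try by auto 6.
    by case: nz; exists h.
  by case: (two g h); auto.
exists z, x; split=> // h hG.
case: (cases h hG) => [[|] [a [b c]]|e|e|[|] [a [b c]]]; rewrite /signed_swap ?b ?c ?a; try by auto 6.
  by case: nz; exists h.
by case: nx; exists h.
Qed.
End NoThreeCycle.

(** * Signed permutations modulo [N] *)

Section Turns.
Variables (gT : finGroupType) (F : fieldType) (act : gT -> {rmorphism F -> F}).
Variables (G H N : {group gT}) (K : divringClosed F).
Hypothesis actG : acts_auto act G.
Hypothesis stabK : forall g s, g \in G -> s \in K -> act g s \in K.
Hypothesis HK : forall g, reflect (g \in G /\ forall a, a \in K -> act g a = a) (g \in H).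
Hypothesis faithful : forall g, g \in G -> (forall z, act g z = z) -> g = 1%g.
Variables X Y : F.
Hypothesis NP : forall g, reflect (g \in G /\ (act g X = X /\ act g Y = Y)) (g \in N).
Hypothesis char_n2 : 1 + 1 != 0 :> F.
Hypothesis tr_X : ~ alg K X.
Hypothesis tr_Y : ~ alg (adj K X) Y.
Hypothesis full : forall z, z \in adj (adj K X) Y.
Hypothesis d4 : forall g, g \in G -> signed_perm2 X Y (act g).
Local Notation w := (X / Y).

(* [kind p q g] says that g sends X / Y to (-1)^q (X / Y)^(+-1), with sign - iff p. *)
Definition kind p q g := exists e : bool,
  act g X = (-1) ^+ e * (if p then Y else X) /\ act g Y = (-1) ^+ (e (+) q) * (if p then X else Y).

Let actM g h z : g \in G -> h \in G -> act (g * h)%g z = act g (act h z).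
Proof. by case: actG => _; apply. Qed.
Let X0 : X != 0. Proof. by case: (d4_nz tr_X tr_Y). Qed.
Let Y0 : Y != 0. Proof. by case: (d4_nz tr_X tr_Y). Qed.

Let sgn (i j : bool) (z : F) : (-1) ^+ i * ((-1) ^+ j * z) = (-1) ^+ (i (+) j) * z.
Proof. by rewrite mulrA signr_addb. Qed.

Lemma kind_ex g : g \in G -> exists p q, kind p q g.
Proof.
rewrite /kind => /d4; case=> [[[a|a] [b|b]]|[[a|a] [b|b]]].
- by exists false, false, false; rewrite a b !mul1r.
- by exists false, true, false; rewrite a b !mul1r mulN1r.
- by exists false, true, true; rewrite a b mul1r mulN1r.
- by exists false, false, true; rewrite a b !mulN1r.
- by exists true, false, false; rewrite a b !mul1r.
- by exists true, true, false; rewrite a b !mul1r mulN1r.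
- by exists true, true, true; rewrite a b mul1r mulN1r.
- by exists true, false, true; rewrite a b !mulN1r.
Qed.

Lemma kind_act p q g : kind p q g -> act g w = (-1) ^+ q * (if p then w^-1 else w).
Proof.
case=> e [a b]; rewrite fmorph_div a b.
by case: p q e {a b} => [] [] []; rewrite /= ?expr0 ?expr1 ?mul1r ?mulN1r; field; rewrite ?oppr_eq0 ?X0 ?Y0.
Qed.

Lemma kindM p q p' q' g h : g \in G -> h \in G -> kind p q g -> kind p' q' h ->
  kind (p (+) p') (q (+) q') (g * h)%g.
Proof.
move=> gG hG [e [a b]] [e' [a' b']]; rewrite /kind !actM // a' b' !rmorphM !rmorph_sign.
exists (e' (+) e (+) (p' && q)); case: p' {a' b'}; rewrite ?a ?b; case: p {a b} => /=; rewrite !sgn.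
all: by case: e e' q q' => [] [] [] [].
Qed.

Let w_sign c d : c \in K -> d \in K -> c * X = d * Y -> c = 0.
Proof.
move=> cK dK e; apply: NNPP => /eqP c0; apply: tr_Y.
have [d0|d0] := eqVneq d 0.
  by case/eqP: c0; apply/eqP; move/eqP: e; rewrite d0 mul0r mulf_eq0 (negbTE X0) orbF.
apply: alg_id; have -> : Y = d^-1 * (c * X) by rewrite e mulKf.
by rewrite rpredM ?rpredV ?rpredM ?adj_gen //; apply: adj_base.
Qed.

Let sign_inj (i j : bool) : (-1) ^+ i = (-1) ^+ j :> F -> i = j.
Proof.
have ne : 1 != -1 :> F by rewrite -subr_eq0 opprK.
by case: i j => [] [] //=; rewrite ?expr0 ?expr1 => /eqP; rewrite ?(negbTE ne) // eq_sym (negbTE ne).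
Qed.

Lemma kind_uniq p q p' q' g : kind p q g -> kind p' q' g -> p = p' /\ q = q'.
Proof.
have sK (i : bool) : (-1) ^+ i \in K by rewrite rpredX // rpredN rpred1.
have s0 (i : bool) : (-1) ^+ i != 0 :> F by rewrite signr_eq0.
move=> [e [a b]] [e' [a' b']]; have pp : p = p'.
  case: p p' {b b'} a a' => [] [] // -> E.
    by case/eqP: (s0 e'); apply: (w_sign (sK _) (sK e)); rewrite E.
  by case/eqP: (s0 e); apply: (w_sign (sK _) (sK e')); rewrite E.
split=> //; rewrite -{}pp {p'} in a' b'.
have ee : e = e'.
  by move: a'; rewrite a => /mulIf E; apply: sign_inj; apply: E; case: (p).
move: b'; rewrite b => /mulIf E; have /sign_inj : (-1) ^+ (e (+) q) = (-1) ^+ (e' (+) q') :> F.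
  by apply: E; case: (p).
by rewrite ee => /addbI.
Qed.

Lemma norm_N : G \subset 'N(N)%g.
Proof.
apply/subsetP => g gG; rewrite inE; apply/subsetP => _ /imsetP[n /NP[nG [nX nY]] ->].
have fx z : act n (act g z) = act g z -> act (n ^ g)%g z = z.
  by move=> e; rewrite conjgE !actM ?groupV ?groupM // e (actVK actG).
have [p [q [e [a b]]]] := kind_ex gG.
apply/NP; rewrite groupJ //; do 2!split=> //; apply: fx; rewrite ?a ?b rmorphM rmorph_sign;
by case: (p); rewrite ?nX ?nY.
Qed.
Let nN g : g \in G -> g \in 'N(N)%g. Proof. exact: (subsetP norm_N). Qed.
Let NG n : n \in N -> n \in G. Proof. by case/NP. Qed.

Lemma coset_eq g h : g \in G -> h \in G ->
  (coset N g = coset N h) <-> (act g X = act h X /\ act g Y = act h Y).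
Proof.
move=> gG hG; split=> [/rcoset_kercosetP|[eX eY]].
  move=> /(_ (nN gG) (nN hG)); rewrite norm_rlcoset ?nN // => /lcosetP[n nN' ->].
  by have /NP[nG [nX nY]] := nN'; rewrite !actM // nX nY.
apply/rcoset_kercosetP; rewrite ?nN // norm_rlcoset ?nN //; apply/lcosetP; exists (h^-1 * g)%g.
  by apply/NP; rewrite groupM ?groupV // !actM ?groupV // eX eY !(actVK actG).
by rewrite mulKVg.
Qed.

Lemma cosetM g h : g \in G -> h \in G -> coset N (g * h)%g = (coset N g * coset N h)%g.
Proof. by move=> gG hG; rewrite morphM ?nN. Qed.

Lemma kind1 : kind false false 1%g.
Proof. by have [a1 _] := actG; exists false; rewrite !a1 !mul1r. Qed.

(** So the elements of order 4 modulo [N] are those of kind [(true, true)], the quarter turns. *)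
Lemma kind_square p q g : g \in G -> kind p q g ->
  act (g * g)%g X = (-1) ^+ (p && q) * X /\ act (g * g)%g Y = (-1) ^+ (p && q) * Y.
Proof.
move=> gG [e [a b]]; rewrite !actM // a b !rmorphM !rmorph_sign.
by case: p a b => /= a b; rewrite ?a ?b !sgn; case: e q {a b} => [] [].
Qed.

Lemma kind_square_N p q g : g \in G -> kind p q g -> ((g * g)%g \in N) = ~~ (p && q).
Proof.
move=> gG /(kind_square gG)[a b]; apply/NP/idP => [[_ []]|/negbTE E].
  by rewrite a -{2}[X]mul1r => /(mulIf X0)/(@sign_inj _ false) ->.
by rewrite groupM // a b E !mul1r.
Qed.

Lemma kind_fourth g : g \in G -> (g * g * (g * g))%g \in N.
Proof.
move=> gG; have [p [q /(kind_square gG)[a b]]] := kind_ex gG; apply/NP.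
have e z : act (g * g * (g * g))%g z = act (g * g)%g (act (g * g)%g z) by rewrite actM ?groupM.
rewrite !groupM // !e; split=> //.
by rewrite ?a ?b !rmorphM !rmorph_sign ?a ?b !mulrA -!signr_addb addbb !mul1r.
Qed.

Lemma capHN : H :&: N = 1%g.
Proof.
apply/trivgP/subsetP => h; rewrite inE => /andP[/HK[hG hK] /NP[_ [hX hY]]].
apply/set1P/faithful => // z; apply: (@fix_adj F (adj K X) _ Y) => //.
exact: fix_adj.
Qed.

Lemma card_HN : #|(H * N / N)%g| = #|H|.
Proof.
rewrite quotientMidr -(card_isog (quotient_isog _ _)) //; last by rewrite setIC capHN.
by apply: subset_trans norm_N; apply/subsetP => h /HK[].
Qed.

Let coset2 g : g \in G -> (coset N g ^+ 2 = coset N (g * g))%g.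
Proof. by move=> gG; rewrite expgS expg1 cosetM. Qed.
Let coset4 g : g \in G -> (coset N g ^+ 4 = 1)%g.
Proof.
move=> gG; rewrite (expgM _ 2 2) !expgS !expg0 !mulg1 -!cosetM ?groupM //.
by rewrite coset_id // kind_fourth.
Qed.
Let coset_mem g : g \in G -> coset N g \in (G / N)%g.
Proof. by move=> gG; rewrite mem_quotient. Qed.
Let coset_ex c : c \in (G / N)%g -> exists2 g, g \in G & c = coset N g.
Proof. by case/morphimP => g _ gG ->; exists g. Qed.

Lemma coset_sq_eq1 p q g : g \in G -> kind p q g -> (coset N g ^+ 2 == 1)%g = ~~ (p && q).
Proof.
move=> gG /(kind_square_N gG) <-; rewrite coset2 //.
by apply/eqP/idP => [/coset_idr|/coset_id//]; apply; rewrite nN ?groupM.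
Qed.

(** A kind [(p, p)] determines the action on [X] and [Y] up to a common sign, and this sign is the
    action of [s^2]. *)
Lemma rotation_coset s p g : s \in G -> kind true true s -> g \in G -> kind p p g ->
  coset N g \in <[coset N s]>%g.
Proof.
move=> sG ks gG [e [a b]]; have [sX sY] := kind_square sG ks.
have [f [c d]] := ks.
have cyc i : (coset N s ^+ i)%g \in <[coset N s]>%g by rewrite mem_cycle.
case: p a b => /= a b; [have [ef|ef] := eqVneq e f | case: e a b => a b].
- suff -> : coset N g = coset N s by rewrite cycle_id.
  by apply/coset_eq => //; rewrite a b c d ef.
- suff -> : coset N g = (coset N s ^+ 3)%g by [].
  rewrite expgS coset2 // -cosetM ?groupM //; apply/coset_eq; rewrite ?groupM //.
  have e3 z : act (s * (s * s))%g z = act s (act (s * s)%g z) by rewrite actM ?groupM.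
  rewrite !e3 sX sY !(rmorphM (act s)) !(rmorph_sign (act s)) a b c d !sgn.
  by case: e f {a b c d ks} ef => [] [].
- suff -> : coset N g = (coset N s ^+ 2)%g by [].
  by rewrite coset2 //; apply/coset_eq; rewrite ?groupM // a b sX sY.
- rewrite coset_id ?group1 //; apply/NP; by rewrite a b !mul1r.
Qed.

Lemma turn_quotient s : s \in G -> kind true true s ->
  (forall g p q, g \in G -> kind p q g -> p = q) -> (G / N)%g \isog Zp 4.
Proof.
move=> sG ks rot; apply: (@cyclic4_isog _ _ (coset N s)).
- exact: coset4.
- by rewrite (coset_sq_eq1 sG ks).
apply/eqP; rewrite eqEsubset cycle_subG coset_mem //; apply/subsetP => _ /coset_ex[g gG ->].
have [p [q kg]] := kind_ex gG; apply: (rotation_coset sG ks gG (p := p)).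
by move: (kg); rewrite -(rot _ _ _ gG kg).
Qed.

(** Elements whose kind has unequal entries are the reflections of the dihedral group. *)
Lemma turn_flip_coset s t p : s \in G -> kind true true s -> t \in G -> kind p (~~ p) t ->
  (coset N s * coset N t * coset N s = coset N t)%g.
Proof.
move=> sG [f [c d]] tG [e [a b]]; rewrite -!cosetM ?groupM //; apply/coset_eq; rewrite ?groupM //.
rewrite !actM ?groupM // c d !rmorphM !rmorph_sign /= a b !rmorphM !rmorph_sign.
by case: p {a b}; rewrite /= ?c ?d !sgn; case: e f {c d} => [] [].
Qed.

Lemma turn_flip_quotient s t p : s \in G -> kind true true s -> t \in G -> kind p (~~ p) t ->
  (G / N)%g \isog 'D_8.
Proof.
move=> sG ks tG kt; apply: (@dihedral8_isog _ _ (coset N s) (coset N t)).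
- exact: coset4.
- by rewrite (coset_sq_eq1 sG ks).
- by apply/eqP; rewrite (coset_sq_eq1 tG kt); case: (p).
- have e := turn_flip_coset sG ks tG kt.
  by rewrite conjgE -{1}e !invMg -!mulgA mulKg mulVg mulg1.
apply/eqP; rewrite eqEsubset join_subG !cycle_subG !coset_mem //=.
apply/subsetP => _ /coset_ex[g gG ->].
have sj : coset N s \in (<[coset N s]> <*> <[coset N t]>)%G by rewrite mem_gen // inE cycle_id.
have tj : coset N t \in (<[coset N s]> <*> <[coset N t]>)%G by rewrite mem_gen // inE cycle_id orbT.
have rot r g' : g' \in G -> kind r r g' -> coset N g' \in (<[coset N s]> <*> <[coset N t]>)%G.
  by move=> g'G kg'; apply: (subsetP _ _ (rotation_coset sG ks g'G kg')); rewrite cycle_subG.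
have [p' [q' kg]] := kind_ex gG; have [pq|pq] := eqVneq p' q'.
  by apply: rot gG _; rewrite {1}pq in kg; exact: kg.
have := kindM gG tG kg kt; rewrite (_ : q' (+) ~~ p = p' (+) p); last by case: p' q' p pq {kg kt} => [] [] [].
by move=> /(rot _ _ (groupM gG tG)); rewrite cosetM // groupMr.
Qed.

Lemma cyclic_turn : (G / N)%g \isog Zp 4 ->
  exists s, [/\ s \in G, kind true true s & <[coset N s]>%g = (G / N)%g].
Proof.
case/isog_cyclic4 => c [_ c2 cG]; have cQ : c \in (G / N)%g by rewrite -cG cycle_id.
have [s sG E] := coset_ex cQ; rewrite E in c2 cG; exists s; split=> //.
by have [p [q ks]] := kind_ex sG; move: c2 (ks); rewrite (coset_sq_eq1 sG ks) negbK => /andP[-> ->].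
Qed.

(** The second generator of ['D_8] is a reflection, since a rotation would commute with [s]. If its
    kind is [(true, false)], it is replaced by its product with [s]. *)
Lemma dihedral_turn : (G / N)%g \isog 'D_8 ->
  exists s t, [/\ s \in G, t \in G, kind true true s, kind false true t &
    <<[set coset N s; coset N t]>>%g = (G / N)%g].
Proof.
case/isog_dihedral8 => c [d [_ c2 d2 cd gen]].
have [s sG E] : exists2 g, g \in G & c = coset N g.
  by apply: coset_ex; rewrite -gen mem_gen // inE cycle_id.
have [t tG E'] : exists2 g, g \in G & d = coset N g.
  by apply: coset_ex; rewrite -gen mem_gen // inE cycle_id orbT.
have ks : kind true true s.
  have [p [q ks]] := kind_ex sG; rewrite E in c2.
  by move: c2 (ks); rewrite (coset_sq_eq1 sG ks) negbK => /andP[-> ->].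
have [p [q kt]] := kind_ex tG.
have pq : q = ~~ p.
  apply/eqP; rewrite -[q == _]negbK; apply/negP => /eqP/eqP pq.
  have {}pq : q = p by case: p q pq {kt} => [] [].
  rewrite pq in kt; have := rotation_coset sG ks tG kt; rewrite -E -E' => /cycleP[i di].
  case/eqP: c2; apply/eqP; rewrite expgS expg1 -eq_invg_mul -cd conjgE.
  by rewrite (_ : c * d = d * c)%g ?mulKg // di; apply: commuteX.
rewrite pq {q pq} in kt.
have genE : <<[set c; d]>>%g = (G / N)%g.
  by rewrite -gen joing_idl joing_idr.
case: p kt => kt; last by exists s, t; rewrite -E -E'.
exists s, (s * t)%g; rewrite groupM //; split=> //.
  exact: (kindM sG tG ks kt).
rewrite cosetM // -E -E' -genE; apply/eqP; rewrite eqEsubset !gen_subG !subUset !sub1set.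
have mc (a b : coset_of N) : a \in <<[set a; b]>>%g /\ b \in <<[set a; b]>>%g.
  by split; apply: mem_gen; rewrite !inE eqxx ?orbT.
have [[c1 d1] [c2' d2']] := (mc c d, mc c (c * d)%g).
apply/andP; split; apply/andP; split=> //; first by rewrite groupM.
by rewrite -[X in X \in _](mulKg c d) groupM // groupV.
Qed.
End Turns.

Section Exceptional.
Variables (gT : finGroupType) (F : fieldType) (act : gT -> {rmorphism F -> F}).
Variables (G H N : {group gT}) (K : divringClosed F).
Hypothesis actG : acts_auto act G.
Hypothesis stabK : forall g s, g \in G -> s \in K -> act g s \in K.
Hypothesis HK : forall g, reflect (g \in G /\ forall a, a \in K -> act g a = a) (g \in H).
Hypothesis faithful : forall g, g \in G -> (forall z, act g z = z) -> g = 1%g.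
Variables X Y : F.
Hypothesis NP : forall g, reflect (g \in G /\ (act g X = X /\ act g Y = Y)) (g \in N).
Hypothesis char_n2 : 1 + 1 != 0 :> F.
Hypothesis tr_X : ~ alg K X.
Hypothesis tr_Y : ~ alg (adj K X) Y.
Hypothesis full : forall z, z \in adj (adj K X) Y.
Hypothesis d4 : forall g, g \in G -> signed_perm2 X Y (act g).
Local Notation w := (X / Y).
Local Notation kind := (kind act X Y).
Let actM g h z : g \in G -> h \in G -> act (g * h)%g z = act g (act h z).
Proof. by case: actG => _; apply. Qed.
Let X0 : X != 0. Proof. by case: (d4_nz tr_X tr_Y). Qed.
Let Y0 : Y != 0. Proof. by case: (d4_nz tr_X tr_Y). Qed.
Let uniq p q p' q' g : kind p q g -> kind p' q' g -> p = p' /\ q = q'.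
Proof. exact: (kind_uniq char_n2 tr_X tr_Y). Qed.
Let HG h : h \in H -> h \in G. Proof. by case/HK. Qed.

Let half_turn_unique h0 h : h0 \in H -> h \in H -> act h0 X = - X -> act h0 Y = - Y ->
  kind false false h -> h = 1%g \/ h = h0.
Proof.
move=> h0H hH hX hY [e [a b]].
have HN1 g : g \in H -> g \in N -> g = 1%g.
  move=> gH gN; apply/set1gP.
  by rewrite -(capHN HK faithful NP full) // inE gH.
case: e a b => /= a b.
  right; apply/eqP; rewrite eq_sym eq_mulVg1; apply/eqP/HN1; first by rewrite groupM ?groupV.
  apply/NP; rewrite groupM ?groupV ?HG // !actM ?groupV ?HG // a b !mulN1r -hX -hY.
  by rewrite !(actVK actG) ?HG.
by left; apply: HN1 => //; apply/NP; rewrite HG // a b !mul1r.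
Qed.

(** As [H] is normal of order 2, its generator [h0] commutes with [s]. A reflection does not commute
    with [s] modulo [N], and a quarter turn has nontrivial square, so [h0] acts by a scalar; it is
    not 1 because [H] meets [N] trivially. *)
Lemma kernel_half_turn s : #|H| = 2%N -> s \in G -> kind true true s ->
  (exists h0, [/\ h0 \in H, act h0 X = - X & act h0 Y = - Y]) /\ forall h, h \in H -> kind false false h.
Proof.
move=> oH sG ks.
have /trivgPn[h0 h0H h01] : H :!=: 1%g by rewrite trivg_card1 oH.
have two h : h \in H -> h = 1%g \/ h = h0.
  have <- : [set 1%g; h0] = H.
    by apply/eqP; rewrite eqEcard subUset !sub1set group1 h0H oH cards2 eq_sym h01.
  by rewrite !inE => /orP[] /eqP; auto.
have h0G := HG h0H; have [p [q kh]] := kind_ex d4 h0G.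
have hh : (h0 * h0)%g = 1%g.
  case: (two (h0 * h0)%g) => //; first by rewrite groupM.
  by move/(congr1 (mulg h0^-1)); rewrite mulKg mulVg => e; rewrite e eqxx in h01.
have sh : (s * h0 = h0 * s)%g.
  case: (two (s * h0 * s^-1)%g); first exact: (kernel_conj actG stabK HK).
    by move/(congr1 (mulg^~ s)); rewrite mulgKV mul1g -{2}[s]mulg1 => /mulgI e; rewrite e eqxx in h01.
  by move/(congr1 (mulg^~ s)); rewrite mulgKV.
have pq : p = q.
  apply/eqP; rewrite -[_ == _]negbK; apply/negP => pq.
  have kh' : kind p (~~ p) h0 by move: (kh); rewrite (_ : ~~ p = q) //; case: p q pq {kh} => [] [].
  have := turn_flip_coset actG NP d4 sG ks h0G kh'.
  rewrite -(cosetM actG NP d4) // sh (cosetM actG NP d4) // -mulgA => /(congr1 (mulg (coset N h0)^-1)).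
  rewrite mulKg mulVg => e; have := coset_sq_eq1 actG NP char_n2 tr_X tr_Y d4 sG ks.
  by rewrite expgS expg1 e eqxx.
rewrite -{}pq {q} in kh.
have kff : kind false false h0.
  have := kind_square_N actG NP char_n2 tr_X tr_Y h0G kh; rewrite hh group1 andbb.
  by case: p kh.
split=> [|h /two[] -> //]; last exact: (kind1 actG).
have [e [a b]] := kff; exists h0; case: e a b => /= a b; rewrite ?mulN1r in a b; first by split.
case/eqP: h01; apply/set1gP; rewrite -(capHN HK faithful NP full) inE h0H.
by apply/NP; rewrite a b !mul1r.
Qed.

Lemma ratio_square (q : bool) : w * w != (-1) ^+ q.
Proof.
apply/eqP => ww; pose r : {poly F} := 'X^2 - ((-1) ^+ q * (X * X))%:P.
have /negP[] : r != 0 by rewrite monic_neq0 ?monicXnsubC.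
apply/eqP/(alg_root tr_Y).
  rewrite rpredB ?rpredX ?polyOverX ?polyOverC // rpredM ?rpredX ?rpredN ?rpred1 //.
  by rewrite rpredM ?adj_gen.
rewrite hornerD hornerN hornerXn hornerC; have -> : X * X = (-1) ^+ q * (Y * Y) by rewrite -ww; field.
by rewrite mulrA -signr_addb addbb mul1r expr2 subrr.
Qed.

(** An element fixing [w] acts by a scalar, since [w] differs from [- w] and [w^2] from 1 and -1. *)
Lemma card_kernel h0 : h0 \in H -> act h0 X = - X -> act h0 Y = - Y ->
  (forall h, h \in H -> act h w = w) -> #|H| = 2%N.
Proof.
move=> h0H hX hY hw.
have kff h : h \in H -> kind false false h.
  move=> hH; have [p [q kh]] := kind_ex d4 (HG hH); suff [ep eq] : p = false /\ q = false by rewrite ep eq in kh.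
  have := kind_act tr_X tr_Y kh; rewrite hw //.
  case: p {kh}; last first.
    case: q => //; rewrite expr1 mulN1r => e; have [/negP[]] := d4_ratio_neq char_n2 tr_X tr_Y.
    by apply/eqP.
  move=> e; case/eqP: (ratio_square q).
  by rewrite {1}e mulfVK // mulf_neq0 ?invr_eq0.
apply/eqP; suff <- : [set 1%g; h0] = H.
  rewrite cards2 (_ : 1%g != h0) //; apply/eqP => e.
  have [a1 _] := actG; move: hX; rewrite -e a1 => /eqP; rewrite -subr_eq0 opprK.
  by rewrite -[X]mul1r -mulrDl mulf_eq0 (negbTE X0) (negbTE char_n2).
apply/setP=> h; rewrite !inE; apply/orP/idP => [[] /eqP -> //|hH].
by have [] := half_turn_unique h0H hH hX hY (kff h hH) => ->; auto.
Qed.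
End Exceptional.

(** * Square roots in [K] and the norm equation *)

Section HalfTurn.
Variables (gT : finGroupType) (F : fieldType) (act : gT -> {rmorphism F -> F}).
Variables (G H N : {group gT}) (K : divringClosed F).
Hypothesis actG : acts_auto act G.
Hypothesis stabK : forall g s, g \in G -> s \in K -> act g s \in K.
Hypothesis HK : forall g, reflect (g \in G /\ forall a, a \in K -> act g a = a) (g \in H).
Variables X Y : F.
Hypothesis NP : forall g, reflect (g \in G /\ (act g X = X /\ act g Y = Y)) (g \in N).
Hypothesis char_n2 : 1 + 1 != 0 :> F.
Hypothesis tr_X : ~ alg K X.
Hypothesis tr_Y : ~ alg (adj K X) Y.
Hypothesis full : forall z, z \in adj (adj K X) Y.
Hypothesis d4 : forall g, g \in G -> signed_perm2 X Y (act g).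
Local Notation w := (X / Y).
Local Notation kind := (kind act X Y).
Variable h0 : gT.
Hypothesis h0H : h0 \in H.
Hypothesis h0X : act h0 X = - X.
Hypothesis h0Y : act h0 Y = - Y.
Hypothesis kindH : forall h, h \in H -> kind false false h.
Hypothesis oH : #|H| = 2%N.
Let actM g h z : g \in G -> h \in G -> act (g * h)%g z = act g (act h z).
Proof. by case: actG => _; apply. Qed.
Let X0 : X != 0. Proof. by case: (d4_nz tr_X tr_Y). Qed.
Let Y0 : Y != 0. Proof. by case: (d4_nz tr_X tr_Y). Qed.
Let uniq p q p' q' g : kind p q g -> kind p' q' g -> p = p' /\ q = q'.
Proof. exact: (kind_uniq char_n2 tr_X tr_Y). Qed.
Let HG h : h \in H -> h \in G. Proof. by case/HK. Qed.
Let kindM p q p' q' g h : g \in G -> h \in G -> kind p q g -> kind p' q' h ->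
  kind (p (+) p') (q (+) q') (g * h)%g.
Proof. exact: (kindM actG). Qed.

Lemma kindV p q g : g \in G -> kind p q g -> kind p q g^-1%g.
Proof.
move=> gG kg; have [p' [q' kg']] := kind_ex d4 (groupVr gG).
have := kindM gG (groupVr gG) kg kg'; rewrite mulgV => k1.
have [e e'] := uniq k1 (kind1 actG X Y).
suff [-> ->] : p = p' /\ q = q' by [].
by case: p p' q q' e e' {kg kg' k1} => [] [] [] [].
Qed.

(* Elements of K fixed by N only see the image of g in G / HN, that is, its kind. *)
Lemma kind_act_KN p q g g' al : g \in G -> g' \in G -> kind p q g -> kind p q g' -> al \in K ->
  (forall n, n \in N -> act n al = al) -> act g al = act g' al.
Proof.
move=> gG g'G kg kg' alK alN; have g'V := groupVr g'G.
have dG : (g'^-1 * g)%g \in G by rewrite groupM.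
suff e : act (g'^-1 * g)%g al = al by rewrite -{2}e actM // (actK actG).
have := kindM g'V gG (kindV g'G kg') kg; rewrite !addbb => -[e [a b]].
have h0G := HG h0H; have /HK[_ h0K] := h0H.
case: e a b => /= a b.
  have : (h0 * (g'^-1 * g))%g \in N.
    have e z : act (h0 * (g'^-1 * g))%g z = act h0 (act (g'^-1 * g)%g z) by rewrite actM.
    by apply/NP; rewrite groupM // !e a b !mulN1r !rmorphN h0X h0Y !opprK.
  by move/alN; rewrite actM // h0K // stabK.
by apply: alN; apply/NP; rewrite a b !mul1r.
Qed.

Let linD (a b p q p' q' : bool) : ((p (+) p') && a) (+) ((q (+) q') && b) =
  ((p && a) (+) (q && b)) (+) ((p' && a) (+) (q' && b)).
Proof. by case: a b p q p' q' => [] [] [] [] [] []. Qed.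

(** The elements whose kind is annihilated by the character [(a, b)] form a subgroup [A] of index 2
    containing [H] and [N]. Artin's theorem gives [al] in [K] fixed by [A] and moved by [s], and
    [al - act s al] is the eigenvector. It applies because [#|A :&: H|] is 2, which is nonzero in
    [F]. *)
Lemma anti_fixed (a b : bool) s p q : s \in G -> kind p q s -> (p && a) (+) (q && b) ->
  exists e, [/\ e \in K, e != 0 & forall g p q, g \in G -> kind p q g ->
     act g e = (-1) ^+ ((p && a) (+) (q && b)) * e].
Proof.
move=> sG ks ls.
pose lin g := exists p q, kind p q g /\ (p && a) (+) (q && b) = false.
pose A := [set g in G | cbool (lin g)].
have AP g : reflect (g \in G /\ lin g) (g \in A) by rewrite inE; apply: (iffP andP) => -[? /cboolP].
have gA : group_set A.
  apply/group_setP; split.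
    by apply/AP; split=> //; exists false, false; split=> //; apply: (kind1 actG).
  move=> g h /AP[gG [p1 [q1 [k1 l1]]]] /AP[hG [p2 [q2 [k2 l2]]]].
  apply/AP; rewrite groupM //; split=> //; exists (p1 (+) p2), (q1 (+) q2).
  split; first exact: kindM.
  by rewrite linD l1 l2.
have NA : N \subset A.
  apply/subsetP => n /NP[nG [nX nY]]; apply/AP; split=> //; exists false, false; split=> //.
  by exists false; rewrite nX nY !mul1r.
have HA : H \subset A.
  apply/subsetP => h hH; apply/AP; rewrite HG //; split=> //; exists false, false; split=> //.
  exact: kindH.
have sA : s \notin A.
  apply/AP => -[_ [p' [q' [ks' l']]]]; have [e e'] := uniq ks ks'.
  by rewrite e e' l' in ls.
have := @moved_fixed_elt gT F act G H K actG stabK HK (Group gA) s _ sG.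
case.
- by apply/subsetP => g /AP[].
- by rewrite (setIidPr HA) oH mulr2n.
- move=> g h gA' hH; apply: contraNneq sA => ->.
  by apply: (@groupM _ (Group gA)) => //; apply: (subsetP HA).
move=> al [alK alA sal]; have sM g : g \in A -> act g al = al by apply: alA.
have alN n : n \in N -> act n al = al by move=> nN; apply/sM/(subsetP NA).
have outA g : g \in G -> g \notin A -> exists p q, kind p q g /\ (p && a) (+) (q && b) = true.
  move=> gG gA'; have [p' [q' kg]] := kind_ex d4 gG; exists p', q'; split=> //.
  by apply/idP; apply: contraNT gA' => /negbTE l'; apply/AP; split=> //; exists p', q'.
have out2 g g' : g \in G -> g' \in G -> g \notin A -> g' \notin A -> (g * g')%g \in A.
  move=> gG g'G /(outA _ gG)[p1 [q1 [k1 l1]]] /(outA _ g'G)[p2 [q2 [k2 l2]]].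
  apply/AP; rewrite groupM //; split=> //; exists (p1 (+) p2), (q1 (+) q2); split; first exact: kindM.
  by rewrite linD l1 l2.
have same g : g \in G -> g \notin A -> act g al = act s al.
  move=> gG gA'; have e := sM _ (out2 _ _ sG gG sA gA'); have e' := sM _ (out2 _ _ sG sG sA sA).
  by rewrite !actM // in e e'; apply: (fmorph_inj (act s)); rewrite e e'.
exists (al - act s al); split; first by rewrite rpredB ?stabK.
  by rewrite subr_eq0 eq_sym.
move=> g p' q' gG kg; have [gA'|gA'] := boolP (g \in A).
  have /AP[_ [p2 [q2 [kg' l2]]]] := gA'; have [-> ->] := uniq kg kg'; rewrite l2 mul1r rmorphB (sM g) //.
  congr (_ - _); rewrite -(actM _ gG sG) -[in RHS](sM g gA') -(actM _ sG gG).
  apply: (@kind_act_KN (p' (+) p) (q' (+) q)); rewrite ?groupM //; first exact: kindM.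
  by rewrite addbC [q' (+) q]addbC; apply: kindM.
have [p2 [q2 [kg' l2]]] := outA g gG gA'; have [-> ->] := uniq kg kg'.
by rewrite l2 mulN1r rmorphB opprB (same g) // -actM // (sM (g * s)%g) // out2.
Qed.

Section Roots.
Variables sa sb : F.
Hypothesis saK : sa \in K.
Hypothesis sbK : sb \in K.
Hypothesis sa0 : sa != 0.
Hypothesis sb0 : sb != 0.
Hypothesis sa_act : forall g p q, g \in G -> kind p q g -> act g sa = (-1) ^+ p * sa.
Hypothesis sb_act : forall g p q, g \in G -> kind p q g -> act g sb = (-1) ^+ (p (+) q) * sb.
Let w0 : w != 0. Proof. by rewrite mulf_neq0 ?invr_eq0. Qed.
Let w_act p q g : kind p q g -> act g w = (-1) ^+ q * (if p then w^-1 else w).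
Proof. exact: (kind_act tr_X tr_Y). Qed.

Lemma roots_fixed : sa * sa \in fixp act K G /\ sb * sb \in fixp act K G.
Proof.
split; apply/fixpP; (split; first by rewrite rpredM) => g gG; have [p [q kg]] := kind_ex d4 gG.
  by rewrite rmorphM (sa_act gG kg); case: (p); rewrite /= ?expr1 ?expr0 ?mulN1r ?mul1r ?mulrNN.
by rewrite rmorphM (sb_act gG kg); case: (p (+) q); rewrite /= ?expr1 ?expr0 ?mulN1r ?mul1r ?mulrNN.
Qed.

(** For [v0 = (r1 + r2 sa) / sb] the norm equation says [v0^-1 = - (r1 - r2 sa) / sb], so the signs
    on [sa] and [sb] act on [v0] as the kinds act on [w]. *)
Lemma norm_rational r1 r2 : r1 \in fixp act K G -> r2 \in fixp act K G ->
  r1 ^+ 2 - sa * sa * r2 ^+ 2 = - (sb * sb) -> rational_fixed act G K.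
Proof.
move=> /fixpP[r1K r1G] /fixpP[r2K r2G] nrm.
pose v0 := (r1 + r2 * sa) / sb.
have n0 : (r1 + r2 * sa) * (r1 - r2 * sa) = - (sb * sb) by rewrite -nrm; ring.
have p0 : r1 + r2 * sa != 0.
  by apply: contraTneq isT => e; move/eqP: n0; rewrite e mul0r eq_sym oppr_eq0 mulf_eq0 (negbTE sb0).
have v00 : v0 != 0 by rewrite mulf_neq0 ?invr_eq0.
have vi : v0^-1 = - ((r1 - r2 * sa) / sb).
  have -> : r1 - r2 * sa = - (sb * sb) / (r1 + r2 * sa) by rewrite -n0 mulrAC divff ?mul1r.
  by rewrite /v0; field; rewrite p0 sb0.
have v0K : v0 \in K by rewrite rpredM ?rpredV // rpredD ?rpredM.
apply: (d4_point actG stabK char_n2 tr_X tr_Y full d4 v0K) => g gG.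
have [p [q kg]] := kind_ex d4 gG; rewrite (w_act kg) vi.
have -> : act g v0 = (r1 + r2 * ((-1) ^+ p * sa)) / ((-1) ^+ (p (+) q) * sb).
  by rewrite fmorph_div rmorphD rmorphM r1G ?r2G // (sa_act gG kg) (sb_act gG kg).
case: p q {kg} => [] [] /=; rewrite ?expr0 ?expr1 ?mul1r ?mulN1r.
- by constructor 4; split=> //; rewrite opprK mulrN.
- by constructor 3; split=> //; rewrite mulrN invrN mulrN.
- by constructor 2; rewrite invrN mulrN.
- by constructor 1.
Qed.

Lemma norm_identity : exists A B, [/\ forall g, g \in G -> act g A = A, forall g, g \in G -> act g B = B &
  B * B = sa * sa * (A * A) + 4%:R * (sa * sa) * (sb * sb)].
Proof.
exists (sb * (w - w^-1)), (sa * sb * (w + w^-1)); split.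
- move=> g gG; have [p [q kg]] := kind_ex d4 gG.
  rewrite rmorphM rmorphB fmorphV (w_act kg) (sb_act gG kg).
  move: (w) => v; rewrite invfM invr_sign.
  by case: p q {kg} => [] [] /=; rewrite ?invrK ?expr0 ?expr1; move: (v^-1) => v'; ring.
- move=> g gG; have [p [q kg]] := kind_ex d4 gG.
  rewrite !rmorphM rmorphD fmorphV (w_act kg) (sb_act gG kg) (sa_act gG kg).
  move: (w) => v; rewrite invfM invr_sign.
  by case: p q {kg} => [] [] /=; rewrite ?invrK ?expr0 ?expr1; move: (v^-1) => v'; ring.
- by field; rewrite X0 Y0.
Qed.

Lemma KN_quadratic s : s \in G -> kind true true s ->
  (forall g p q, g \in G -> kind p q g -> p = q) ->
  forall al, al \in K -> (forall n, n \in N -> act n al = al) ->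
  exists c d, [/\ c \in fixp act K G, d \in fixp act K G & al = c + d * sa].
Proof.
move=> sG ks rot al alK alN.
exists ((al + act s al) / (1 + 1)), ((al - act s al) / ((1 + 1) * sa)).
have r2 g : act g (1 + 1) = 1 + 1 by rewrite rmorphD rmorph1.
have n2K : 1 + 1 \in K by rewrite rpredD ?rpred1.
have k1 := kind1 actG X Y; have [a1 _] := actG.
have act1 g : g \in G -> kind false false g -> act g al = al.
  by move=> gG kg; rewrite (kind_act_KN gG (group1 G) kg k1) // a1.
have cases g : g \in G -> (act g al = al /\ act g (act s al) = act s al /\ act g sa = sa) \/
    (act g al = act s al /\ act g (act s al) = al /\ act g sa = - sa).
  move=> gG; have [p [q kg]] := kind_ex d4 gG; have pq := rot _ _ _ gG kg; rewrite -pq in kg.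
  rewrite -!actM // (sa_act gG kg); have kgs := kindM gG sG kg ks.
  case: p kg kgs {pq} => kg kgs; [right|left]; rewrite ?expr0 ?expr1 ?mul1r ?mulN1r.
    by split; [exact: (kind_act_KN gG sG kg ks) | rewrite act1 ?groupM].
  by split; [exact: act1 | split=> //; apply: (kind_act_KN (groupM gG sG) sG kgs ks)].
split.
- apply/fixpP; split; first by rewrite rpred_div // rpredD ?stabK.
  by move=> g gG; rewrite fmorph_div rmorphD r2; case: (cases g gG) => [[-> [-> _]]|[-> [-> _]]] //; rewrite addrC.
- apply/fixpP; split; first by rewrite rpred_div ?rpredM // rpredB ?stabK.
  move=> g gG; rewrite fmorph_div rmorphB rmorphM r2; case: (cases g gG) => [[-> [-> ->]]|[-> [-> ->]]] //.
  by rewrite mulrN invrN mulrN -mulNr opprB.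
- by field; rewrite sa0.
Qed.

Lemma KN_biquadratic s t : s \in G -> kind true true s -> t \in G -> kind false true t ->
  forall al, al \in K -> (forall n, n \in N -> act n al = al) ->
  exists c0 c1 c2 c3, [/\ c0 \in fixp act K G, c1 \in fixp act K G, c2 \in fixp act K G,
    c3 \in fixp act K G & al = c0 + c1 * sa + c2 * sb + c3 * (sa * sb)].
Proof.
move=> sG ks tG kt al alK alN; have [a1 _] := actG.
pose e (p q : bool) := if p then (if q then s else s * t)%g else (if q then t else 1%g).
have eG p q : e p q \in G by case: p q => [] [] /=; rewrite ?groupM.
have ke p q : kind p q (e p q).
  by case: p q => [] [] //=; [apply: (kindM sG tG ks kt) | apply: (kind1 actG)].
pose x p q := act (e p q) al.
have xK p q : x p q \in K by apply: stabK.
have x_act g p q p' q' : g \in G -> kind p q g -> act g (x p' q') = x (p (+) p') (q (+) q').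
  move=> gG kg; rewrite /x -actM //; apply: (kind_act_KN _ _ _ (ke _ _)) => //; rewrite ?groupM //.
  exact: kindM.
have al00 : al = x false false by rewrite /x /= a1.
pose four : F := (1 + 1) * (1 + 1).
have four_act g : act g four = four by rewrite rmorphM rmorphD rmorph1.
have fourK : four \in K by rewrite rpredM // rpredD ?rpred1.
(* Four times the component of [al] on which the kind [(p, q)] acts by the sign of [p i + q j];
   divided by an element of [K] with the same character it becomes invariant. *)
pose n (i j : bool) := x false false + (-1) ^+ i * x true false + (-1) ^+ j * x false true
   + (-1) ^+ (i (+) j) * x true true.
have n_act i j g p q : g \in G -> kind p q g -> act g (n i j) = (-1) ^+ ((p && i) (+) (q && j)) * n i j.
  move=> gG kg; rewrite /n !rmorphD !rmorphM !rmorph_sign !(x_act _ _ _ _ _ gG kg).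
  by case: p q i j {kg} => [] [] [] []; rewrite /= ?expr0 ?expr1; ring.
pose c (i j : bool) z := n i j / (four * z).
have cP i j z : z \in K -> (forall g p q, g \in G -> kind p q g -> act g z = (-1) ^+ ((p && i) (+) (q && j)) * z) ->
    c i j z \in fixp act K G.
  move=> zK zact; apply/fixpP; split.
    by rewrite rpred_div // ?rpredM // !rpredD ?rpredM ?rpredX ?rpredN ?rpred1.
  move=> g gG; have [p [q kg]] := kind_ex d4 gG.
  rewrite /c fmorph_div rmorphM four_act (zact _ _ _ gG kg) (n_act _ _ _ _ _ gG kg).
  by rewrite mulrCA -mulf_div divff ?mul1r // signr_eq0.
have ssa g p q : g \in G -> kind p q g -> act g (sa * sb) = (-1) ^+ ((p && false) (+) (q && true)) * (sa * sb).
  move=> gG kg; rewrite rmorphM (sa_act gG kg) (sb_act gG kg).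
  by case: p q {kg} => [] [] /=; rewrite ?expr0 ?expr1; ring.
exists (c false false 1), (c true false sa), (c true true sb), (c false true (sa * sb)); split.
- by apply: cP; rewrite ?rpred1 // => g p q _ _; rewrite rmorph1 !andbF mul1r.
- by apply: cP => // g p q gG kg; rewrite andbT andbF addbF; apply: sa_act gG kg.
- by apply: cP => // g p q gG kg; rewrite !andbT; apply: sb_act gG kg.
- by apply: cP => //; rewrite rpredM.
rewrite {1}al00 /c /n /= ?expr0 ?expr1.
move: (x false false) (x true false) (x false true) (x true true) => x00 x10 x01 x11.
have four0 : 4%:R != 0 :> F by rewrite (_ : 4%:R = (1 + 1) * (1 + 1)) ?mulf_neq0 //; ring.
by rewrite /four; field; rewrite four0 sa0 sb0.
Qed.
End Roots.

(** From [Y^2 (u - w^2) = u - 1] it follows that [S(X, Y)] is quadratic over [S(u, w)], generated by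
    [Y], with [h0] as conjugation. Sign changes fix this [u] and exchanging [X] with [Y] inverts it,
    which is the action wanted in the theorem. *)
Lemma half_turn_invariants (S : divringClosed F) (u := (1 - X ^+ 2) / (1 - Y ^+ 2)) :
  (forall z, z \in S -> act h0 z = z) ->
  forall z, (z \in adj (adj S X) Y /\ act h0 z = z) <-> z \in adj (adj S u) w.
Proof.
move=> Sh z.
have nalg c : c \in K -> c - Y != 0.
  move=> cK; apply/eqP => /eqP; rewrite subr_eq0 => /eqP e; apply/tr_Y/alg_id/adj_base.
  by rewrite -e.
have Y2 : 1 - Y ^+ 2 != 0.
  rewrite (_ : 1 - Y ^+ 2 = - ((1 - Y) * (- 1 - Y))); last by ring.
  by rewrite oppr_eq0 mulf_neq0 ?nalg ?rpredN ?rpred1.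
have XY (i : bool) : (-1) ^+ i * X - Y != 0.
  apply/eqP => /eqP; rewrite subr_eq0 => /eqP e; apply/tr_Y/alg_id; rewrite -e.
  by rewrite rpredM ?adj_gen // rpredX // rpredN rpred1.
have uw : u - w ^+ 2 != 0.
  rewrite (_ : u - w ^+ 2 = ((X - Y) * (- X - Y)) / ((1 - Y ^+ 2) * Y ^+ 2)); last first.
    by rewrite /u; field; rewrite Y0 Y2.
  have [p m] := (XY false, XY true); rewrite expr0 mul1r in p; rewrite expr1 mulN1r in m.
  by rewrite mulf_neq0 ?invr_eq0 ?mulf_neq0 ?expf_neq0.
have hu : act h0 u = u.
  by rewrite /u fmorph_div !rmorphB !rmorphXn !rmorph1 h0X h0Y !sqrrN.
have hw : act h0 w = w by rewrite fmorph_div h0X h0Y invrN mulrNN.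
pose T := adj (adj S u) w.
have uT : u \in T by apply: adj2_gen1.
have wT : w \in T by apply: adj_gen.
have Th y : y \in T -> act h0 y = y.
  by apply: fix_adj => //; apply: fix_adj.
have YT : Y ^+ 2 \in T.
  have -> : Y ^+ 2 = (u - 1) / (u - w ^+ 2).
    apply: (mulIf uw); rewrite mulfVK //; rewrite /u; by field; rewrite Y0 Y2.
  by rewrite rpred_div ?rpredB ?rpred1 ?rpredX.
split=> [[zS hz]|zT].
  apply: (@fixed_quadratic F T (act h0) Y) => //.
  - by rewrite h0Y -subr_eq0 -opprD oppr_eq0 -[Y]mul1r -mulrDl mulf_neq0.
  - by rewrite h0Y subrr rpred0.
  - by rewrite h0Y mulrN rpredN -expr2.
  apply: (@adj2_sub F S _ X Y _ _ _ z zS) => [y yS||]; last exact: adj_gen.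
    by apply/adj_base/adj2_base.
  have e : X = w * Y by rewrite mulfVK.
  rewrite [Z in Z \in _]e.
  by apply: rpredM; [apply: adj_base | apply: adj_gen].
split; last exact: Th.
have XS : X \in adj (adj S X) Y by apply: adj2_gen1.
have YS : Y \in adj (adj S X) Y by apply: adj_gen.
apply: (adj2_sub _ _ _ zT); first exact: adj2_base.
  by rewrite rpred_div ?rpredB ?rpred1 ?rpredX.
by rewrite rpred_div.
Qed.

Lemma turn_u (u := (1 - X ^+ 2) / (1 - Y ^+ 2)) p q g : kind p q g -> act g u = if p then u^-1 else u.
Proof.
have sq (i : bool) (z : F) : ((-1) ^+ i * z) ^+ 2 = z ^+ 2 by rewrite exprMn sqrr_sign mul1r.
case=> e [a b]; rewrite /u fmorph_div !rmorphB !rmorphXn !rmorph1 a b !sq.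
by case: p {a b}; rewrite ?invf_div.
Qed.
End HalfTurn.

(** * Rational or exceptional *)

Section Dichotomy.
Variables (gT : finGroupType) (F : fieldType) (act : gT -> {rmorphism F -> F}).
Variables (G H N : {group gT}) (K : divringClosed F).
Hypothesis actG : acts_auto act G.
Hypothesis stabK : forall g s, g \in G -> s \in K -> act g s \in K.
Hypothesis HK : forall g, reflect (g \in G /\ forall a, a \in K -> act g a = a) (g \in H).
Hypothesis faithful : forall g, g \in G -> (forall z, act g z = z) -> g = 1%g.
Variables x y : F.
Hypothesis NP : forall g, reflect (g \in G /\ (act g x = x /\ act g y = y)) (g \in N).
Hypothesis tr_x : ~ alg K x.
Hypothesis tr_y : ~ alg (adj K x) y.
Hypothesis full : forall z, z \in adj (adj K x) y.
Hypothesis monomial : forall g, g \in G -> exists a b c d : int,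
  act g x = x ^ a * y ^ c /\ act g y = x ^ b * y ^ d.
Let actM g h z : g \in G -> h \in G -> act (g * h)%g z = act g (act h z).
Proof. by case: actG => _; apply. Qed.

Lemma monomial_norm : G \subset 'N(N)%g.
Proof.
apply/subsetP => g gG; rewrite inE; apply/subsetP => _ /imsetP[n /NP[nG [nx ny]] ->].
have fx z : act n (act g z) = act g z -> act (n ^ g)%g z = z.
  by move=> e; rewrite conjgE !actM ?groupV ?groupM // e (actVK actG).
have [a [b [c [d [ex ey]]]]] := monomial gG.
by apply/NP; rewrite groupJ //; do 2!split=> //; apply: fx; rewrite ?ex ?ey rmorphM !fmorphXz nx ny.
Qed.

Lemma same_field_NP X Y : same_field x y X Y ->
  forall g, reflect (g \in G /\ (act g X = X /\ act g Y = Y)) (g \in N).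
Proof.
move=> sf g; have fixk : g \in G -> forall s, s \in fixp act K G -> act g s = s.
  by move=> gG s /fixpP[_]; apply.
apply: (iffP (NP g)) => -[gG e]; split=> //.
  exact/(same_field_fixed sf (fixk gG)).
exact/(same_field_fixed sf (fixk gG)).
Qed.

(** Among the 12 maps only those that permute the three monomials cyclically have a nontrivial
    square, and their fourth powers move [X]. *)
Lemma hex_fourth X Y c : ~ alg K X -> ~ alg (adj K X) Y -> c \in G -> hexagonal X Y (act c) ->
  act (c * c * (c * c))%g X = X -> act (c * c)%g X = X /\ act (c * c)%g Y = Y.
Proof.
move=> trX trY cG hx; have [_ _ d] := hex_distinct trX trY; have [dxy _ _] := hex_distinct trX trY.
have e4 z : act (c * c * (c * c))%g z = act c (act c (act c (act c z))) by rewrite !actM ?groupM.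
have e2 z : act (c * c)%g z = act c (act c z) by rewrite actM.
rewrite e4 !e2; case: hx; move: {e4 e2} (X * Y)^-1 d => Z d a b e.
all: try by rewrite ?a ?b ?e ?fmorphV ?a ?b ?e ?invrK.
- by rewrite a b e a => E; rewrite E eqxx in dxy.
- by rewrite a e b a => E; rewrite E eqxx in d.
- by rewrite a fmorphV b invrK e fmorphV a invrK => E; rewrite E eqxx in dxy.
- by rewrite a fmorphV e invrK b fmorphV a invrK => E; rewrite E eqxx in d.
Qed.

Lemma signed_swap_coords : 1 + 1 != 0 :> F -> forall x1 y1, same_field x y x1 y1 ->
  (forall g, g \in G -> signed_swap x1 y1 (act g)) ->
  exists X Y, same_field x y X Y /\ forall g, g \in G -> signed_perm2 X Y (act g).
Proof.
move=> n2 x1 y1 sf sw; have [tr1 tr2] := same_field_tr sf tr_x tr_y.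
have [x10 x11] := cayley_neq0 n2 tr1; have [y10 y11] := cayley_neq0 n2 tr2.
exists (cayley x1), (cayley y1); split.
  exact: same_field_trans sf (same_field_cayley n2 x11 y11).
by move=> g gG; apply: signed_cayley => //; apply: sw.
Qed.

Lemma lattice_cases : exists x1 y1, same_field x y x1 y1 /\
  ((forall g, g \in G -> signed_swap x1 y1 (act g)) \/ (forall g, g \in G -> hexagonal x1 y1 (act g))).
Proof.
have [x1 [y1 [a b c]]] := lattice_normal_form actG tr_x tr_y monomial.
by exists x1, y1; split=> // S; have [? ?] := a S; have [? ?] := b S.
Qed.

Lemma rational_or_exceptional : rational_fixed act G K \/
  [/\ 1 + 1 != 0 :> F, #|(H * N / N)%g| = 2%N & (G / N)%g \isog Zp 4 \/ (G / N)%g \isog 'D_8].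
Proof.
have [x1 [y1 [sf cases]]] := lattice_cases.
suff main x2 y2 : same_field x y x2 y2 -> (forall g, g \in G -> signed_swap x2 y2 (act g)) ->
    rational_fixed act G K \/
    [/\ 1 + 1 != 0 :> F, #|(H * N / N)%g| = 2%N & (G / N)%g \isog Zp 4 \/ (G / N)%g \isog 'D_8].
  case: cases => [sw|hx]; first exact: main sf sw.
  have [tr1 tr2] := same_field_tr sf tr_x tr_y.
  have full1 z : z \in adj (adj K x1) y1 by rewrite -(same_fieldP _ _ sf).
  have [[c [cG [cx cy]]]|no3] := classic (exists c, c \in G /\ (act c x1 = y1 /\ act c y1 = (x1 * y1)^-1)).
    by left; apply: (hex_outcome actG stabK HK faithful tr1 tr2 full1 hx cG).
  have [x2 [y2 [sf2 sw]]] := hex_signed_swap actG tr1 tr2 hx (fun c cG e => no3 (ex_intro _ c (conj cG e))).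
  by apply: main sw; apply: same_field_trans sf2.
move=> {x1 y1 sf cases} sf sw; have [tr1 tr2] := same_field_tr sf tr_x tr_y.
have [c2|n2] := eqVneq (1 + 1 : F) 0.
  left; apply: (d4_char2 actG stabK c2 tr1 tr2) => // z.
  by rewrite -(same_fieldP _ _ sf).
have [X [Y [sfX d4]]] := signed_swap_coords n2 sf sw.
have [trX trY] := same_field_tr sfX tr_x tr_y.
have fullX z : z \in adj (adj K X) Y by rewrite -(same_fieldP _ _ sfX).
have NPX := same_field_NP sfX.
have [|[[h0 [h0H hX hY]] hw [s [sG sw']]]] := d4_outcome actG stabK HK n2 trX trY fullX d4 faithful; first by left.
right; split=> //.
  rewrite (card_HN actG HK faithful NPX fullX d4).
  exact: (card_kernel actG HK faithful NPX n2 trX trY fullX d4 h0H hX hY hw).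
have [X0 Y0] := d4_nz trX trY; have w0 : X / Y != 0 by rewrite mulf_neq0 ?invr_eq0.
have ks : kind act X Y true true s.
  have [p [q ks]] := kind_ex d4 sG; have := kind_act trX trY ks; rewrite sw'.
  have nn (z : F) : z != 0 -> z != - z by move=> z0; rewrite -subr_eq0 opprK -[z]mul1r -mulrDl mulf_neq0.
  case: p ks => ks.
    case: q ks => ks //; rewrite mul1r => e; have := nn (X / Y)^-1; rewrite invr_eq0 => /(_ w0).
    by rewrite -e opprK e eqxx.
  (* If [s] did not invert [w], then [- w^-1] would be [w] up to sign, and [w^2] would be 1 or
     -1. *)
  move: (X / Y) (ratio_square trX trY (~~ q)) w0 => v v2 v0 e; case/eqP: v2.
  have ev : (-1) ^+ q * v * v = - 1 by rewrite -e mulNr mulVf.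
  by case: q {ks e} ev => /=; rewrite ?expr0 ?expr1 ?mul1r ?mulN1r ?mulNr // => /oppr_inj.
have [[t [p [q [tG kt pq]]]]|no] := classic (exists t p q, [/\ t \in G, kind act X Y p q t & p != q]).
  right; apply: (turn_flip_quotient actG NPX n2 trX trY d4 sG ks tG (p := p)).
  by rewrite (_ : ~~ p = q) //; case: p q pq {kt} => [] [].
left; apply: (turn_quotient actG NPX n2 trX trY d4 sG ks) => g p q gG kg.
by apply/eqP; rewrite -[_ == _]negbK; apply/negP => pq; case: no; exists g, p, q.
Qed.

(** An element of order 4 in [G / N] rules out the hexagonal alternative by [hex_fourth]. *)
Lemma exceptional_coords : 1 + 1 != 0 :> F -> (G / N)%g \isog Zp 4 \/ (G / N)%g \isog 'D_8 ->
  exists X Y, same_field x y X Y /\ forall g, g \in G -> signed_perm2 X Y (act g).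
Proof.
move=> n2 iso; have [x1 [y1 [sf [sw|hx]]]] := lattice_cases; first exact: signed_swap_coords sf sw.
have [tr1 tr2] := same_field_tr sf tr_x tr_y; have NP1 := same_field_NP sf.
have [c [c4 c2 cG]] : exists c, [/\ c ^+ 4 = 1, c ^+ 2 != 1 & c \in G / N]%g.
  case: iso => [/isog_cyclic4[c [c4 c2 <-]]|/isog_dihedral8[c [d [c4 c2 _ _ <-]]]]; exists c; split=> //.
    exact: cycle_id.
  by rewrite mem_gen // inE cycle_id.
case/morphimP: cG => s sN sG es; rewrite es in c4 c2.
have n1 g : g \in G -> (g \in N) = (coset N g == 1)%g.
  move=> gG; apply/idP/eqP => [/coset_id //|/coset_idr]; apply.
  exact: (subsetP monomial_norm).
have ssG : (s * s)%g \in G by rewrite groupM.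
case/eqP: c2; rewrite expgS expg1 -morphM //=; apply/eqP; rewrite -n1 //.
apply/NP1; split=> //; apply: (hex_fourth tr1 tr2 sG (hx s sG)).
have : (s * s * (s * s))%g \in N.
  by rewrite n1 ?groupM // !morphM ?groupM //= -c4 (expgM _ 2 2) !expgS !expg0 !mulg1.
by case/NP1 => _ [].
Qed.
End Dichotomy.

Section ExceptionalCases.
Variables (gT : finGroupType) (F : fieldType) (act : gT -> {rmorphism F -> F}).
Variables (G H N : {group gT}) (K : divringClosed F).
Hypothesis actG : acts_auto act G.
Hypothesis stabK : forall g s, g \in G -> s \in K -> act g s \in K.
Hypothesis HK : forall g, reflect (g \in G /\ forall a, a \in K -> act g a = a) (g \in H).
Hypothesis faithful : forall g, g \in G -> (forall z, act g z = z) -> g = 1%g.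
Variables x y : F.
Hypothesis NP : forall g, reflect (g \in G /\ (act g x = x /\ act g y = y)) (g \in N).
Hypothesis tr_x : ~ alg K x.
Hypothesis tr_y : ~ alg (adj K x) y.
Hypothesis full : forall z, z \in adj (adj K x) y.
Hypothesis monomial : forall g, g \in G -> exists a b c d : int,
  act g x = x ^ a * y ^ c /\ act g y = x ^ b * y ^ d.
Hypothesis char_n2 : 1 + 1 != 0 :> F.
Hypothesis oHN : #|(H * N / N)%g| = 2%N.
Local Notation k := (fixp act K G).
Let actM g h z : g \in G -> h \in G -> act (g * h)%g z = act g (act h z).
Proof. by case: actG => _; apply. Qed.

(** Stated for every subfield [S] fixed by [G], to be applied to the image of [k]. *)
Definition generated_invariants u v := forall S : divringClosed F,
  (forall g z, g \in G -> z \in S -> act g z = z) ->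
  forall z, (z \in adj (adj S x) y /\ forall g, g \in (H * N)%g -> act g z = z) <-> z \in adj (adj S u) v.

(** Both directions of the criterion: a solution of the norm equation gives rationality, and the
    invariant point [(A, B)] of the conic turns unirationality into such a solution. *)
Definition norm_criterion a b :=
  (forall r1 r2, r1 \in k -> r2 \in k -> r1 ^+ 2 - a * r2 ^+ 2 = - b -> rational_fixed act G K) /\
  exists A B, [/\ forall g, g \in G -> act g A = A, forall g, g \in G -> act g B = B &
    B * B = a * (A * A) + 4%:R * a * b].

Lemma half_turn_generated X Y h0 : same_field x y X Y -> ~ alg K X -> ~ alg (adj K X) Y ->
  h0 \in H -> act h0 X = - X -> act h0 Y = - Y -> #|H| = 2%N ->
  generated_invariants ((1 - X ^+ 2) / (1 - Y ^+ 2)) (X / Y).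
Proof.
move=> sf trX trY h0H hX hY oH S SG z.
have HG h : h \in H -> h \in G by case/HK.
rewrite -(half_turn_invariants char_n2 trX trY hX hY (SG h0 ^~ (HG h0 h0H))) -(same_fieldP S z sf).
split=> -[zS zf]; split=> //.
  by apply: zf; rewrite -[h0]mulg1 mem_mulg.
have fixN n : n \in N -> act n z = z.
  case/NP=> nG [nx ny]; apply: (@fix_adj F (adj S x) (act n) y) => //; apply: fix_adj => // s sS.
  exact: SG.
have HE : [set 1%g; h0] = H.
  have h01 : 1%g != h0.
    apply/eqP => e; have [a1 _] := actG; have [X0 _] := d4_nz trX trY.
    move: hX; rewrite -e a1 => /eqP; rewrite -subr_eq0 opprK.
    by rewrite -[X]mul1r -mulrDl mulf_eq0 (negbTE X0) (negbTE char_n2).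
  by apply/eqP; rewrite eqEcard subUset !sub1set group1 h0H oH cards2 h01.
have [a1 _] := actG.
move=> _ /mulsgP[h n hH nN ->]; have /NP[nG _] := nN; rewrite (actM _ (HG h hH) nG).
by rewrite fixN //; move: hH; rewrite -HE !inE => /orP[] /eqP -> //; rewrite a1.
Qed.

Lemma cyclic_case : (G / N)%g \isog Zp 4 -> exists u v sa s,
  [/\ generated_invariants u v, sa \in K /\ sa != 0, sa * sa \in k &
    forall al, al \in K -> ((forall n, n \in N -> act n al = al) <->
      exists c d, [/\ c \in k, d \in k & al = c + d * sa])] /\
  [/\ s \in G, <[coset N s]>%g = (G / N)%g,
    [/\ act s sa = - sa, act s u = u^-1 & act s v = - v^-1] & norm_criterion (sa * sa) 1].
Proof.
move=> iso.
have [X [Y [sf d4]]] := exceptional_coords actG NP tr_x tr_y monomial char_n2 (or_introl iso).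
have [trX trY] := same_field_tr sf tr_x tr_y.
have fullX z : z \in adj (adj K X) Y by rewrite -(same_fieldP _ _ sf).
have NPX := same_field_NP K NP sf.
have oH : #|H| = 2%N by rewrite -(card_HN actG HK faithful NPX fullX d4).
have [s [sG ks gen]] := cyclic_turn actG NPX char_n2 trX trY d4 iso.
have [[h0 [h0H hX hY]] kH] := kernel_half_turn actG stabK HK faithful NPX char_n2 trX trY fullX d4 oH sG ks.
have kpow i : kind act X Y (odd i) (odd i) (s ^+ i)%g.
  elim: i => [|i IH]; first exact: (kind1 actG).
  by rewrite expgS /= -[~~ odd i]addTb; apply: (kindM actG); rewrite ?groupX.
have rot g p q : g \in G -> kind act X Y p q g -> p = q.
  move=> gG [e kg]; have : coset N g \in <[coset N s]>%g by rewrite gen mem_quotient.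
  case/cycleP => i; rewrite -morphX ?(subsetP (norm_N actG NPX d4)) // => /(coset_eq actG NPX d4 gG (groupX i sG))[eX eY].
  have kg' : kind act X Y p q (s ^+ i)%g by exists e; rewrite -eX -eY.
  by have [-> ->] := kind_uniq char_n2 trX trY kg' (kpow i).
have [sa [saK sa0 sa_act']] := anti_fixed actG stabK HK NPX char_n2 trX trY d4 h0H hX hY kH oH
  (a := true) (b := false) sG ks isT.
have sa_act g p q : g \in G -> kind act X Y p q g -> act g sa = (-1) ^+ p * sa.
  by move=> gG kg; rewrite (sa_act' g p q) // andbT andbF addbF.
(* All kinds have equal entries here, so 1 has the character demanded of [sb]; hence [b = 1] in the
   criterion. *)
have one_act g p q : g \in G -> kind act X Y p q g -> act g 1 = (-1) ^+ (p (+) q) * 1.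
  by move=> gG kg; rewrite (rot g p q) // addbb rmorph1 mulr1.
have K1 : 1 \in K by apply: rpred1.
have [aa _] := roots_fixed d4 saK K1 sa_act one_act.
exists ((1 - X ^+ 2) / (1 - Y ^+ 2)), (X / Y), sa, s; split; split=> //.
- exact: (half_turn_generated sf trX trY h0H hX hY oH).
- move=> al alK; split.
    exact: (KN_quadratic actG stabK HK NPX char_n2 trX trY d4 h0H hX hY saK sa0 sa_act sG ks rot alK).
  move=> [c [d [/fixpP[_ ck'] /fixpP[_ dk] ->]]] n nN; have /NPX[nG [nX nY]] := nN.
  rewrite rmorphD rmorphM ck' ?dk // (sa_act n false false) ?mul1r //.
  by exists false; rewrite nX nY !mul1r.
- split; first by rewrite (sa_act s true true) // mulN1r.
    exact: (turn_u ks).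
  by rewrite (kind_act trX trY ks) mulN1r.
split.
  move=> r1 r2 r1k r2k e.
  apply: (norm_rational actG stabK char_n2 trX trY fullX d4 saK K1 (oner_neq0 _) sa_act one_act r1k r2k).
  by rewrite e mulr1.
have [A [B [AG BG e]]] := norm_identity trX trY d4 sa_act one_act.
by exists A, B; split=> //; rewrite e mulr1.
Qed.

Lemma dihedral_case : (G / N)%g \isog 'D_8 -> exists u v sa sb s t,
  [/\ generated_invariants u v, [/\ sa \in K, sb \in K, sa != 0 & sb != 0],
    sa * sa \in k /\ sb * sb \in k &
    forall al, al \in K -> ((forall n, n \in N -> act n al = al) <->
      exists c0 c1 c2 c3, [/\ c0 \in k, c1 \in k, c2 \in k, c3 \in k &
        al = c0 + c1 * sa + c2 * sb + c3 * (sa * sb)])] /\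
  [/\ [/\ s \in G, t \in G & <<[set coset N s; coset N t]>>%g = (G / N)%g],
    [/\ act s sa = - sa, act s sb = sb, act s u = u^-1 & act s v = - v^-1],
    [/\ act t sa = sa, act t sb = - sb, act t u = u & act t v = - v] & norm_criterion (sa * sa) (sb * sb)].
Proof.
move=> iso.
have [X [Y [sf d4]]] := exceptional_coords actG NP tr_x tr_y monomial char_n2 (or_intror iso).
have [trX trY] := same_field_tr sf tr_x tr_y.
have fullX z : z \in adj (adj K X) Y by rewrite -(same_fieldP _ _ sf).
have NPX := same_field_NP K NP sf.
have oH : #|H| = 2%N by rewrite -(card_HN actG HK faithful NPX fullX d4).
have [s [t [sG tG ks kt gen]]] := dihedral_turn actG NPX char_n2 trX trY d4 iso.
have [[h0 [h0H hX hY]] kH] := kernel_half_turn actG stabK HK faithful NPX char_n2 trX trY fullX d4 oH sG ks.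
have [sa [saK sa0 sa_act']] := anti_fixed actG stabK HK NPX char_n2 trX trY d4 h0H hX hY kH oH
  (a := true) (b := false) sG ks isT.
have [sb [sbK sb0 sb_act']] := anti_fixed actG stabK HK NPX char_n2 trX trY d4 h0H hX hY kH oH
  (a := true) (b := true) tG kt isT.
have sa_act g p q : g \in G -> kind act X Y p q g -> act g sa = (-1) ^+ p * sa.
  by move=> gG kg; rewrite (sa_act' g p q) // andbT andbF addbF.
have sb_act g p q : g \in G -> kind act X Y p q g -> act g sb = (-1) ^+ (p (+) q) * sb.
  by move=> gG kg; rewrite (sb_act' g p q) // !andbT.
exists ((1 - X ^+ 2) / (1 - Y ^+ 2)), (X / Y), sa, sb, s, t; split; split=> //.
- exact: (half_turn_generated sf trX trY h0H hX hY oH).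
- exact: (roots_fixed d4 saK sbK sa_act sb_act).
- move=> al alK; split.
    exact: (KN_biquadratic actG stabK HK NPX char_n2 trX trY d4 h0H hX hY saK sbK sa0 sb0 sa_act sb_act
      sG ks tG kt alK).
  move=> [c0 [c1 [c2 [c3 [/fixpP[_ k0] /fixpP[_ k1] /fixpP[_ k2] /fixpP[_ k3] ->]]]]] n nN.
  have /NPX[nG [nX nY]] := nN.
  have kn : kind act X Y false false n by exists false; rewrite nX nY !mul1r.
  by rewrite !rmorphD !rmorphM k0 ?k1 ?k2 ?k3 // (sa_act n _ _ nG kn) (sb_act n _ _ nG kn) !mul1r.
- split; rewrite ?(sa_act s _ _ sG ks) ?(sb_act s _ _ sG ks) ?mulN1r ?mul1r //; first exact: (turn_u ks).
  by rewrite (kind_act trX trY ks) mulN1r.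
- split; rewrite ?(sa_act t _ _ tG kt) ?(sb_act t _ _ tG kt) ?mulN1r ?mul1r //; first exact: (turn_u kt).
  by rewrite (kind_act trX trY kt) mulN1r.
split.
  move=> r1 r2 r1k r2k e.
  exact: (norm_rational actG stabK char_n2 trX trY fullX d4 saK sbK sb0 sa_act sb_act r1k r2k).
exact: (norm_identity trX trY d4 sa_act sb_act).
Qed.
End ExceptionalCases.

(** * Translation to the given action *)

Lemma rmorphism_of (R S : pzRingType) (f : R -> S) :
  (forall z w, f (z + w) = f z + f w) -> (forall z w, f (z * w) = f z * f w) -> f 1 = 1 ->
  exists g : {rmorphism R -> S}, forall z, g z = f z.
Proof.
move=> fD fM f1.
have f_zmod : zmod_morphism f.
  by move=> z w; apply/eqP; rewrite eq_sym subr_eq -fD subrK.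
pose f_add := GRing.isZmodMorphism.Build R S f f_zmod.
pose f_mul := GRing.isMonoidMorphism.Build R S f (conj f1 fM).
pose g : {rmorphism R -> S} := HB.pack f f_add f_mul.
by exists g.
Qed.

(** A square root of [e * e] is [e] or [- e], and [f] fixes neither because 2 is nonzero. *)
Lemma anti_nonsquare (F : fieldType) (f : {rmorphism F -> F}) e c :
  1 + 1 != 0 :> F -> e != 0 -> f e = - e -> f c = c -> c * c != e * e.
Proof.
move=> n2 e0 fe fc; apply/eqP => /eqP; rewrite -subr_eq0 -!expr2 subr_sqr mulf_eq0.
have ne : e != - e by rewrite -subr_eq0 opprK -[e]mul1r -mulrDl mulf_neq0.
case/orP; rewrite ?subr_eq0 ?addr_eq0 => /eqP ce; move: fc; rewrite ce ?rmorphN fe => /eqP.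
  by rewrite eq_sym (negbTE ne).
by rewrite opprK (negbTE ne).
Qed.

Lemma anti_nonsquare_mul (F : fieldType) (f : {rmorphism F -> F}) e e' c :
  1 + 1 != 0 :> F -> e != 0 -> e' != 0 -> f e = - e -> f e' = e' -> f c = c ->
  c * c != e * e * (e' * e').
Proof.
move=> n2 e0 e'0 fe fe' fc; rewrite mulrACA; apply: (anti_nonsquare (f := f)) => //.
  by rewrite mulf_neq0.
by rewrite rmorphM fe fe' mulNr.
Qed.

Section Assembly.
Variables (k : fieldType) (K : fieldExtType k) (gT : finGroupType) (G : {group gT}).
Variable act : gT -> RF K -> RF K.
Hypothesis pqm : pqm_action G act.

(** The hypotheses make [act g] a ring morphism only for [g] in [G]; elsewhere the identity is
    substituted. *)
Lemma pqm_rmorphism : exists act' : gT -> {rmorphism RF K -> RF K},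
  forall g, g \in G -> forall z, act' g z = act g z.
Proof.
have [_ [_ [_ [rm _]]]] := pqm.
have ex g : exists f : {rmorphism RF K -> RF K}, g \in G -> forall z, f z = act g z.
  have [gG|_] := boolP (g \in G); last by exists idfun.
  have [fD fM f1 _] := rm g gG; have [f fE] := rmorphism_of fD fM f1.
  by exists f.
exists (fun g => proj1_sig (constructive_indefinite_description _ (ex g))) => g gG z.
by case: constructive_indefinite_description => f /=; apply.
Qed.

Variable act' : gT -> {rmorphism RF K -> RF K}.
Hypothesis actE : forall g, g \in G -> forall z, act' g z = act g z.
Local Notation Kf := (image_field (cKf K)).
Local Notation kf := (image_field (ckf K)).
Local Notation x := (xF K).
Local Notation y := (yF K).
Local Notation FG := (fixedF act G).

Lemma pqm_acts : acts_auto act' G.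
Proof.
have [a1 [aM _]] := pqm; split=> [z|g h z gG hG]; first by rewrite actE.
by rewrite !actE ?groupM ?aM.
Qed.

Lemma pqm_stab g s : g \in G -> s \in Kf -> act' g s \in Kf.
Proof.
have [_ [_ [_ [_ [st _]]]]] := pqm.
move=> gG /image_fieldP[a ->]; rewrite actE //; have [b e] := st g a gG.
by apply/image_fieldP; exists b; apply: e.
Qed.

Lemma pqm_faithful g : g \in G -> (forall z, act' g z = z) -> g = 1%g.
Proof.
have [_ [_ [fa _]]] := pqm.
by move=> gG e; apply: fa => // z; rewrite -actE.
Qed.

Lemma NN_P g : reflect (g \in G /\ (act' g x = x /\ act' g y = y)) (g \in NN G act).
Proof.
rewrite inE; apply: (iffP andP) => [[gG /andP[/eqP ex /eqP ey]]|[gG]]; first by rewrite !actE.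
by rewrite !actE // => -[-> ->]; rewrite !eqxx.
Qed.

Lemma HH_P g : reflect (g \in G /\ forall a, a \in Kf -> act' g a = a) (g \in HH G act).
Proof.
rewrite inE; apply: (iffP andP) => -[gG].
  by move/cboolP => e; split=> // _ /image_fieldP[a ->]; rewrite actE //; apply: e.
move=> e; split=> //; apply/cboolP => a; rewrite -actE //.
by apply: e; apply/image_fieldP; exists a.
Qed.

Lemma NN_group : group_set (NN G act).
Proof.
have [a1 aM] := pqm_acts.
apply/group_setP; split=> [|g h /NN_P[gG [ex ey]] /NN_P[hG [ex' ey']]].
  by apply/NN_P; rewrite group1 !a1.
by apply/NN_P; rewrite groupM // !aM // ex' ey' ex ey.
Qed.

Lemma HH_group : group_set (HH G act).
Proof.
have [a1 aM] := pqm_acts.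
apply/group_setP; split=> [|g h /HH_P[gG e] /HH_P[hG e']].
  by apply/HH_P; rewrite group1; split=> // a _; rewrite a1.
by apply/HH_P; rewrite groupM //; split=> // a aK; rewrite aM // e' // e.
Qed.

Lemma pqm_monomial g : g \in G -> exists a b c d : int,
  act' g x = x ^ a * y ^ c /\ act' g y = x ^ b * y ^ d.
Proof.
have [_ [_ [_ [_ [_ [_ mo]]]]]] := pqm.
move=> gG; have [M [_ ex ey]] := mo g gG; rewrite !actE //.
by exists (M ord0 ord0), (M ord0 ord_max), (M ord_max ord0), (M ord_max ord_max).
Qed.

Lemma act_ck g c : g \in G -> act' g (ck K c) = ck K c.
Proof.
have [_ [_ [_ [rm _]]]] := pqm.
by move=> gG; rewrite actE //; have [_ _ _] := rm g gG; apply.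
Qed.

Lemma kf_fixed g z : g \in G -> z \in kf -> act' g z = z.
Proof. by move=> gG /image_fieldP[c ->]; apply: act_ck. Qed.

Lemma fixp_kf z : (z \in fixp act' Kf G) = (z \in kf).
Proof.
have [_ [_ [_ [_ [_ [fi _]]]]]] := pqm.
apply/fixpP/idP => [[/image_fieldP[a ->] e]|zk].
  have [c ->] := fi a (fun g gG => etrans (esym (actE gG _)) (e g gG)).
  by apply/image_fieldP; exists c.
split=> [|g gG]; last exact: kf_fixed.
by case/image_fieldP: zk => c ->; apply/image_fieldP; exists c%:A.
Qed.

Lemma rational_fixed_RF : rational_fixed act' G Kf -> k_rational FG.
Proof.
move=> [t1 [t2 [n1 n2 tG gen]]]; exists 2%N, (pair2 t1 t2).
have sub : {subset kf <= fixp act' Kf G} by move=> z; rewrite fixp_kf.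
have sub' : {subset fixp act' Kf G <= kf} by move=> z; rewrite fixp_kf.
split.
  apply: alg_indep2 => h; [apply: n1|apply: n2]; apply: alg_sub h => //.
  exact: adj_sub.
move=> z; split=> [zG|/in_kgen2 zk g gG].
  apply/in_kgen2; apply: (adj_sub (adj_sub sub')); apply: gen => g gG.
  by rewrite actE // zG.
rewrite -actE //; have [e1 e2] := tG g gG.
apply: (@fix_adj _ (adj kf t1) (act' g) t2) => //; apply: fix_adj => // s.
exact: kf_fixed.
Qed.

Lemma FG_closed : [/\ forall z w, FG z -> FG w -> FG (z + w), forall z w, FG z -> FG w -> FG (z * w) &
  forall c, FG (ck K c)].
Proof.
split=> [z w fz fw g gG|z w fz fw g gG|c g gG]; rewrite -actE ?rmorphD ?rmorphM //=.
- by rewrite !actE // fz // fw.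
- by rewrite !actE // fz // fw.
- exact: act_ck.
Qed.

(** Everything passes through the solvability of [p^2 - a q^2 = - b]: rationality, unirationality
    and splitting are each equivalent to it, and without a solution the quaternion algebra is a
    division algebra. *)
Lemma norm_criterion_RF (a b : k) : 1 + 1 != 0 :> k -> nonsquare a -> b != 0 ->
  norm_criterion act' G Kf (ck K a) (ck K b) ->
  (k_rational FG <-> quat_split a (- b)) /\
  (~ k_rational FG -> Br_nontrivial k /\ ~ k_unirational FG).
Proof.
move=> n2 na b0 [rat [A [B [AG BG e]]]]; have [FD FM Fk] := FG_closed.
have nb0 : - b != 0 by rewrite oppr_eq0.
have norm_rat p q : p ^+ 2 - a * q ^+ 2 = - b -> k_rational FG.
  move=> pq; apply/rational_fixed_RF/(rat (ck K p) (ck K q)).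
  - by rewrite fixp_kf; apply/image_fieldP; exists p.
  - by rewrite fixp_kf; apply/image_fieldP; exists q.
  - have := congr1 (ckf K) pq; rewrite rmorphB rmorphN rmorphXn rmorphM rmorphXn; exact.
have uni_norm : k_unirational FG -> exists p q, p ^+ 2 - a * q ^+ 2 = - b.
  apply: (@unirational_norm k K FG A B a b n2 na b0 FD FM Fk) => [g gG|g gG|].
  - by rewrite -actE // AG.
  - by rewrite -actE // BG.
  - by rewrite e; congr (_ + _); rewrite -[RHS]/(ckf K _) !rmorphM rmorph_nat.
split.
  split=> [rFG|/(quat_split_norm na)[p [q pq]]]; last exact: (norm_rat p q pq).
  have [p [q pq]] := uni_norm (k_rational_unirational rFG FD FM Fk).
  exact: (norm_quat_split n2 na nb0 pq).
move=> nrat; split.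
  by apply: (quaternion_division n2 na nb0) => p q pq; apply: nrat; exact: (norm_rat p q pq).
by move=> /uni_norm[p [q pq]]; apply: nrat; exact: (norm_rat p q pq).
Qed.
End Assembly.

Section ExceptionalAssembly.
Variables (k : fieldType) (K : fieldExtType k) (gT : finGroupType) (G : {group gT}).
Variable act : gT -> RF K -> RF K.
Hypothesis pqm : pqm_action G act.
Hypothesis char_n2 : 1 + 1 != 0 :> k.
Local Notation N := (NN G act).
Local Notation H := (HH G act).
Local Notation FG := (fixedF act G).
Local Notation kxy := (in_kgen (pair2 (xF K) (yF K))).
Hypothesis oHN : #|((H * N) / N)%g| = 2%N.

Let n2 : 1 + 1 != 0 :> RF K.
Proof. by have := fmorph_eq0 (ckf K) (1 + 1); rewrite rmorphD rmorph1 => ->. Qed.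

Lemma in_kxy act' u v : (forall g, g \in G -> forall z, act' g z = act g z) ->
  (forall z, (z \in adj (adj (image_field (ckf K)) (xF K)) (yF K) /\
     forall g, g \in (H * N)%g -> act' g z = z) <-> z \in adj (adj (image_field (ckf K)) u) v) ->
  [/\ kxy u, kxy v & forall z, (kxy z /\ fixedF act (H * N)%g z) <-> in_kgen (pair2 u v) z].
Proof.
move=> actE inv.
have HNG g : g \in (H * N)%g -> g \in G.
  by case/mulsgP => h n; rewrite !inE => /andP[hG _] /andP[nG _] ->; rewrite groupM.
split.
- by apply/in_kgen2; have [_ /(_ (adj2_gen1 _ _ _))[]] := inv u.
- by apply/in_kgen2; have [_ /(_ (adj_gen _ _))[]] := inv v.
move=> z; split=> [[/in_kgen2 zk zf]|/in_kgen2 zk].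
  apply/in_kgen2/inv; split=> // g gHN.
  by rewrite actE ?HNG // zf.
have [_ /(_ zk)[zk' zf]] := inv z; split; first exact/in_kgen2.
by move=> g gHN; rewrite -actE ?HNG // zf.
Qed.

Let cK_inj (a b : K) : cK a = cK b -> a = b.
Proof. exact: (fmorph_inj (cKf K)). Qed.
Let cKD (a b : K) : cK (a + b) = cK a + cK b. Proof. exact: (rmorphD (cKf K)). Qed.
Let cKM (a b : K) : cK (a * b) = cK a * cK b. Proof. exact: (rmorphM (cKf K)). Qed.
Let ckM (a b : k) : ck K (a * b) = ck K a * ck K b. Proof. exact: (rmorphM (ckf K)). Qed.

Lemma cyclic_RF : (G / N)%g \isog Zp 4 ->
  exists (u v : RF K) (a : k) (sa : K) (s : gT),
     [/\ kxy u, kxy v &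
         (forall z, (kxy z /\ fixedF act (H * N)%g z) <-> in_kgen (pair2 u v) z)] /\
     [/\ nonsquare a /\ sa * sa = a%:A,
         (forall al : K, fixedF act N (cK al) <->
                         exists c d : k, al = c%:A + d%:A * sa),
         s \in G /\ <[coset N s]>%g = (G / N)%g,
         [/\ act s (cK sa) = - cK sa, act s u = u^-1 & act s v = - v^-1] &
         (k_rational FG <-> quat_split a (-1)) /\
         (~ k_rational FG -> Br_nontrivial k /\ ~ k_unirational FG)].
Proof.
move=> iso; have [act' actE] := pqm_rmorphism pqm.
have [u [v [z0 [s [[inv [saK sa0] aa KN] [sG gen [ssa su sv] crit]]]]]] :=
  @cyclic_case gT _ act' G (Group (HH_group pqm actE)) (Group (NN_group pqm actE)) _
    (pqm_acts pqm actE) (pqm_stab pqm actE) (HH_P actE) (pqm_faithful pqm actE) _ _ (NN_P actE)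
    (@tr_xF k K) (@tr_yF k K) (@full_RF k K) (pqm_monomial pqm actE) n2 oHN iso.
move: saK sa0 aa KN ssa crit => /image_fieldP[sa ->] sa0; rewrite (fixp_kf pqm actE) => /image_fieldP[a aE].
move=> KN ssa crit.
have saE : sa * sa = a%:A by apply: cK_inj; rewrite cKM.
have na : nonsquare a.
  move=> c; apply/eqP => e; have := anti_nonsquare n2 sa0 ssa (act_ck pqm actE c sG).
  by rewrite -ckM e aE eqxx.
exists u, v, a, sa, s; split; first exact: (in_kxy actE (inv _ (@kf_fixed _ _ _ _ _ pqm _ actE))).
split=> //.
- move=> al; have alK : cK al \in image_field (cKf K) by apply/image_fieldP; exists al.
  have [KN1 KN2] := KN _ alK; have NG n : n \in N -> n \in G by rewrite inE => /andP[].
  split=> [alN|[c [d e]] n nN].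
    have [|c [d []]] := KN1; first by move=> n nN; rewrite actE ?NG // alN.
    rewrite !(fixp_kf pqm actE) => /image_fieldP[c' ->] /image_fieldP[d' ->] e.
    by exists c', d'; apply: cK_inj; rewrite cKD cKM.
  rewrite -actE ?NG //; apply: KN2 => //; exists (ck K c), (ck K d); rewrite !(fixp_kf pqm actE).
  by split; [apply/image_fieldP; exists c | apply/image_fieldP; exists d | rewrite e cKD cKM].
- by rewrite -!actE.
- apply: (norm_criterion_RF pqm actE char_n2 na (oner_neq0 _)).
  by rewrite (rmorph1 (ckf K)) -aE.
Qed.

Lemma dihedral_RF : (G / N)%g \isog 'D_8 ->
   exists (u v : RF K) (a b : k) (sa sb : K) (s t : gT),
     [/\ kxy u, kxy v &
         (forall z, (kxy z /\ fixedF act (H * N)%g z) <-> in_kgen (pair2 u v) z)] /\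
     [/\ [/\ nonsquare a, nonsquare b, nonsquare (a * b),
             sa * sa = a%:A & sb * sb = b%:A],
         (forall al : K, fixedF act N (cK al) <->
            exists c0 c1 c2 c3 : k,
              al = c0%:A + c1%:A * sa + c2%:A * sb + c3%:A * (sa * sb)),
         [/\ s \in G, t \in G & <<[set coset N s; coset N t]>>%g = (G / N)%g],
         [/\ act s (cK sa) = - cK sa, act s (cK sb) = cK sb,
             act s u = u^-1 & act s v = - v^-1] /\
         [/\ act t (cK sa) = cK sa, act t (cK sb) = - cK sb,
             act t u = u & act t v = - v] &
         (k_rational FG <-> quat_split a (- b)) /\
         (~ k_rational FG -> Br_nontrivial k /\ ~ k_unirational FG)].
Proof.
move=> iso; have [act' actE] := pqm_rmorphism pqm.
have [u [v [za [zb [s [t [[inv [saK sbK sa0 sb0] [aa bb] KN] [[sG tG gen] [ssa ssb su sv] [tsa tsb tu tv] crit]]]]]]]] :=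
  @dihedral_case gT _ act' G (Group (HH_group pqm actE)) (Group (NN_group pqm actE)) _
    (pqm_acts pqm actE) (pqm_stab pqm actE) (HH_P actE) (pqm_faithful pqm actE) _ _ (NN_P actE)
    (@tr_xF k K) (@tr_yF k K) (@full_RF k K) (pqm_monomial pqm actE) n2 oHN iso.
move: saK sbK sa0 sb0 aa bb KN ssa ssb tsa tsb crit => /image_fieldP[sa ->] /image_fieldP[sb ->] sa0 sb0.
rewrite !(fixp_kf pqm actE) => /image_fieldP[a aE] /image_fieldP[b bE] KN ssa ssb tsa tsb crit.
have saE : sa * sa = a%:A by apply: cK_inj; rewrite cKM.
have sbE : sb * sb = b%:A by apply: cK_inj; rewrite cKM.
have na : nonsquare a.
  move=> c; apply/eqP => e; have := anti_nonsquare n2 sa0 ssa (act_ck pqm actE c sG).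
  by rewrite -ckM e aE eqxx.
have nb : nonsquare b.
  move=> c; apply/eqP => e; have := anti_nonsquare n2 sb0 tsb (act_ck pqm actE c tG).
  by rewrite -ckM e bE eqxx.
have nab : nonsquare (a * b).
  move=> c; apply/eqP => e; have := anti_nonsquare_mul n2 sa0 sb0 ssa ssb (act_ck pqm actE c sG).
  by rewrite -ckM e ckM aE bE eqxx.
exists u, v, a, b, sa, sb, s, t; split; first exact: (in_kxy actE (inv _ (@kf_fixed _ _ _ _ _ pqm _ actE))).
split=> //.
- move=> al; have alK : cK al \in image_field (cKf K) by apply/image_fieldP; exists al.
  have [KN1 KN2] := KN _ alK; have NG n : n \in N -> n \in G by rewrite inE => /andP[].
  split=> [alN|[c0 [c1 [c2 [c3 e]]]] n nN].
    have [|c0 [c1 [c2 [c3 []]]]] := KN1; first by move=> n nN; rewrite actE ?NG // alN.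
    rewrite !(fixp_kf pqm actE) => /image_fieldP[d0 ->] /image_fieldP[d1 ->] /image_fieldP[d2 ->] /image_fieldP[d3 ->] e.
    by exists d0, d1, d2, d3; apply: cK_inj; rewrite !cKD !cKM.
  rewrite -actE ?NG //; apply: KN2 => //; exists (ck K c0), (ck K c1), (ck K c2), (ck K c3).
  rewrite !(fixp_kf pqm actE).
  split; [apply/image_fieldP; exists c0 | apply/image_fieldP; exists c1 |
    apply/image_fieldP; exists c2 | apply/image_fieldP; exists c3 | by rewrite e !cKD !cKM] => //.
- by rewrite -!actE.
- have b0 : b != 0 by have := nb 0; rewrite mul0r eq_sym.
  apply: (norm_criterion_RF pqm actE char_n2 na b0).
  by rewrite -aE -bE.
Qed.
End ExceptionalAssembly.

Theorem theorem1p14 (k : fieldType) (K : fieldExtType k)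
  (gT : finGroupType) (G : {group gT}) (act : gT -> RF K -> RF K) :
  pqm_action G act ->
  let N := NN G act in
  let H := HH G act in
  let FG := fixedF act G in
  let case_C4 := (2 \notin [pchar k])%N /\
                 ((G / N)%g \isog Zp 4) /\ #|((H * N) / N)%g| = 2%N in
  let case_D4 := (2 \notin [pchar k])%N /\
                 ((G / N)%g \isog 'D_8) /\ #|((H * N) / N)%g| = 2%N in
  (* rational outside the exceptional cases *)
  (~ case_C4 -> ~ case_D4 -> k_rational FG) /\
  (* case (i): (G/N, HN/N) ~ (C4, C2) *)
  (case_C4 ->
   exists (u v : RF K) (a : k) (sa : K) (s : gT),
     [/\ in_kgen (pair2 (xF K) (yF K)) u, in_kgen (pair2 (xF K) (yF K)) v &
         (forall z, (in_kgen (pair2 (xF K) (yF K)) z /\ fixedF act (H * N)%g z)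
                    <-> in_kgen (pair2 u v) z)] /\
     [/\
         nonsquare a /\ sa * sa = a%:A,
         (forall al : K, fixedF act N (cK al) <->
                         exists c d : k, al = c%:A + d%:A * sa),
         s \in G /\ <[coset N s]>%g = (G / N)%g,
         [/\ act s (cK sa) = - cK sa, act s u = u^-1 & act s v = - v^-1] &
         (k_rational FG <-> quat_split a (-1))]) /\
  (* case (ii): (G/N, HN/N) ~ (D4, C2) *)
  (case_D4 ->
   exists (u v : RF K) (a b : k) (sa sb : K) (s t : gT),
     [/\ in_kgen (pair2 (xF K) (yF K)) u, in_kgen (pair2 (xF K) (yF K)) v &
         (forall z, (in_kgen (pair2 (xF K) (yF K)) z /\ fixedF act (H * N)%g z)
                    <-> in_kgen (pair2 u v) z)] /\
     [/\
         [/\ nonsquare a, nonsquare b, nonsquare (a * b),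
             sa * sa = a%:A & sb * sb = b%:A],
         (forall al : K, fixedF act N (cK al) <->
            exists c0 c1 c2 c3 : k,
              al = c0%:A + c1%:A * sa + c2%:A * sb + c3%:A * (sa * sb)),
         [/\ s \in G, t \in G & <<[set coset N s; coset N t]>>%g = (G / N)%g],
         [/\ act s (cK sa) = - cK sa, act s (cK sb) = cK sb,
             act s u = u^-1 & act s v = - v^-1] /\
         [/\ act t (cK sa) = cK sa, act t (cK sb) = - cK sb,
             act t u = u & act t v = - v] &
         (k_rational FG <-> quat_split a (- b))]) /\
  (* non-rational implies Br(k) nontrivial and non-unirational *)
  (~ k_rational FG -> Br_nontrivial k /\ ~ k_unirational FG).
Proof.
move=> pqm N H FG case_C4 case_D4.
have n2 : (2 \notin [pchar k])%N -> 1 + 1 != 0 :> k by rewrite inE.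
have rat : ~ case_C4 -> ~ case_D4 -> k_rational FG.
  move=> nC4 nD4; have [act' actE] := pqm_rmorphism pqm.
  have [|[m2 oHN iso]] := @rational_or_exceptional gT _ act' G (Group (HH_group pqm actE)) (Group (NN_group pqm actE)) _
    (pqm_acts pqm actE) (pqm_stab pqm actE) (HH_P actE) (pqm_faithful pqm actE) _ _ (NN_P actE)
    (@tr_xF k K) (@tr_yF k K) (@full_RF k K) (pqm_monomial pqm actE).
    exact: rational_fixed_RF.
  have c2 : (2 \notin [pchar k])%N.
    rewrite inE /=; apply: contraNN m2 => /eqP e.
    by rewrite -(rmorph1 (ckf K)) -rmorphD -mulr2n e rmorph0.
  by case: iso => iso; [case: nC4 | case: nD4].
split=> //; split.
  case=> c2 [iso oHN]; have [u [v [a [sa [s [e1 [e2 e3 e4 e5 [e6 _]]]]]]]] := cyclic_RF pqm (n2 c2) oHN iso.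
  by exists u, v, a, sa, s.
split.
  case=> c2 [iso oHN].
  have [u [v [a [b [sa [sb [s [t [e1 [e2 e3 e4 e5 [e6 _]]]]]]]]]]] := dihedral_RF pqm (n2 c2) oHN iso.
  by exists u, v, a, b, sa, sb, s, t.
move=> nrat; have [[c2 [iso oHN]]|nC4] := classic case_C4.
  have [u [v [a [sa [s [_ [_ _ _ _ [_ e]]]]]]]] := cyclic_RF pqm (n2 c2) oHN iso.
  exact: e.
have [[c2 [iso oHN]]|nD4] := classic case_D4; last by case: nrat; apply: rat.
have [u [v [a [b [sa [sb [s [t [_ [_ _ _ _ [_ e]]]]]]]]]]] := dihedral_RF pqm (n2 c2) oHN iso.
exact: e.
Qed.
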